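(* Let $k\ge3$ and consider a Poisson random hypergraph on $N$ vertices with parameters $(\beta_j)_{j\ge2}$ satisfying $\beta_j=1/(j(j-1))$ for $2\le j\le k-1$ and $\beta_k>1/(k(k-1))$. Let $z(t)=1-t-\exp(-\beta'(t))$, $t^*=\inf\{t\ge0:z(t)<0\}$, and assume $z$ has no zeros in $(0,t^* )$. Let $Z_N$ be the breadth-first walk, extended to real times by the exponential interpolation described in the context. Then for any $0<\sigma<t^*$, $$\Big(\tfrac{1}{\sqrt N}\big(Z_N(Nt)-Nz(t)\big)\Big)_{0\le t\le\sigma}\xrightarrow{d}(X_t)_{0\le t\le\sigma},\qquad X_t=\exp(-\beta'(t))\int_0^t\exp(\beta'(s))\,dG_s,$$ where $(G_t)_{t\ge0}$ is a Gaussian process with the same distribution as $(B_{z(t)+t})_{t\ge0}$ for a standard Brownian motion $(B_t)_{t\ge0}$.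
   Context: Poisson random hypergraph: vertex set $\{1,\dots,N\}$; $(\beta_j)_{j\ge2}$ nonnegative reals, $\beta(t)=\sum_{j\ge2}\beta_jt^j$ with $\beta'(1)<\infty$; for each $A$ with $|A|=j\ge2$, the number of hyperedges on $A$ is Poisson with mean $N\beta_j/\binom{N}{j}$, independently. A 1-edge is a patch; deleting a patched vertex $v$ removes it and replaces each other hyperedge containing $v$ by the hyperedge on its remaining vertices. Breadth-first walk: put a patch on the lowest-labelled vertex, call it $v(1)$. Having processed $v(1),\dots,v(i-1)$, the children of $v(i)$ are the not-yet-numbered vertices $w$ such that some original hyperedge consists of $v(i)$, $w$ and a subset of $\{v(1),\dots,v(i-1)\}$; they get the next numbers in order of original label, then $v(i)$ is deleted; if no numbered-but-undeleted vertex remains, a patch is placed on the lowest-labelled un-numbered vertex, which becomes the next numbered vertex. With $C_N(i)$ the number of children of $v(i)$: $Z_N(0)=0$, $Z_N(i)=Z_N(i-1)+C_N(i)-1$; $P_N(0)=1$, $P_N(i)=1-\min_{j\le i}Z_N(j)$. Let $\lambda_2(N,i)=N\sum_{j=0}^{i}\beta_{j+2}\binom{i}{j}/\binom{N}{j+2}$. Exponential interpolation: for $1\le i\le N$ let $(E_{i,j})_{1\le j\le N-(i-1)-Z_N(i-1)-P_N(i-1)}$ be, conditionally on the past, i.i.d. exponential random variables with rate $\lambda_2(N,i-1)$, coupled so that $C_N(i)=\#\{j:E_{i,j}\le1\}$, and set for $0\le u\le1$ $$Z_N(i-1+u)=Z_N(i-1)-u+\sum_{j=1}^{N-(i-1)-Z_N(i-1)-P_N(i-1)}\mathbb{1}_{\{E_{i,j}\le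 u\}}.$$ *)

(* Defs.v *)
From HB Require Import structures.
From mathcomp Require Import all_boot all_order all_algebra.
From mathcomp Require Import all_classical all_reals all_analysis.
From mathcomp Require Import normal_distribution exponential_distribution.

Set Implicit Arguments.
Unset Strict Implicit.
Unset Printing Implicit Defensive.

Import Order.TTheory GRing.Theory Num.Def Num.Theory.
Import numFieldTopology.Exports numFieldNormedType.Exports.

Local Open Scope classical_set_scope.
Local Open Scope ring_scope.

(* Breadth-first walk on a hypergraph with vertex set 'I_N (labels      *)
(* 0..N-1, i.e. vertex v+1 of the paper is the ordinal v).             *)
(* [has A] holds iff the hypergraph has at least one hyperedge on A.   *)
(* A state is the sequence of numbered vertices v(1), v(2), ... in     *)
(* order.  Step m (0-based, i.e. processing v(m+1)).                   *)

Definition bfw_process (N : nat) (has : pred {set 'I_N}) (m : nat)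
  (v : 'I_N) (s : seq 'I_N) : seq 'I_N * nat :=
  (* s: numbered vertices, v = nth s m, prev = {v(1),...,v(m)} *)
  let prev := [set x in take m s] in
  let ch := [seq w <- enum 'I_N | (w \notin s) &&
              [exists S : {set 'I_N}, (S \subset prev) && has (v |: (w |: S))]] in
  (s ++ ch, size ch).

Definition bfw_step (N : nat) (has : pred {set 'I_N}) (m : nat)
  (s : seq 'I_N) : seq 'I_N * nat :=
  match drop m s with
  | v :: _ => bfw_process has m v s
  | [::] =>
      (* no numbered-but-undeleted vertex: patch the lowest-labelled
         un-numbered vertex *)
      match [seq w <- enum 'I_N | w \notin s] with
      | [::] => (s, 0%N)
      | v :: _ => bfw_process has m v (rcons s v)
      end
  end.

Fixpoint bfw_state (N : nat) (has : pred {set 'I_N}) (m : nat) : seq 'I_N :=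
  if m is m'.+1 then (bfw_step has m' (bfw_state has m')).1 else [::].

(* C_N(i), number of children of v(i), for i >= 1 *)
Definition bfw_C (N : nat) (has : pred {set 'I_N}) (i : nat) : nat :=
  (bfw_step has i.-1 (bfw_state has i.-1)).2.

Definition bfw_Z (N : nat) (has : pred {set 'I_N}) (i : nat) : int :=
  (\sum_(1 <= m < i.+1) (bfw_C has m)%:Z) - i%:Z.

(* P_N(i) = 1 - min_{j <= i} Z_N(j)  (Z_N(0) = 0 is among the j's) *)
Definition bfw_P (N : nat) (has : pred {set 'I_N}) (i : nat) : int :=
  1 - \big[Num.min/0]_(j < i.+1) bfw_Z has j.

Definition trunc_nat (x : int) : nat := if x < 0 then 0%N else absz x.

(* N - (i-1) - Z_N(i-1) - P_N(i-1), the number of E_{i,j} *)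
Definition bfw_navail (N : nat) (has : pred {set 'I_N}) (i : nat) : nat :=
  trunc_nat (N%:Z - (i.-1)%:Z - bfw_Z has i.-1 - bfw_P has i.-1).

Definition hasM (N : nat) (M : {set 'I_N} -> nat) : pred {set 'I_N} :=
  fun A => (0 < M A)%N.

Definition lambda2 {R : realType} (beta : nat -> R) (N i : nat) : R :=
  N%:R * \sum_(j < i.+1) beta (j + 2)%N * 'C(i, j)%:R / 'C(N, j + 2)%:R.

Definition bfw_interp {R : realType} (N : nat) (has : pred {set 'I_N})
  (E : nat -> nat -> R) (x : R) : R :=
  let q := absz (Num.floor x) in
  let u := x - q%:R in
  (bfw_Z has q)%:~R - u
  + (count (fun j => E q.+1 j <= u) (iota 1 (bfw_navail has q.+1)))%:R.

Definition betap_terms {R : realType} (beta : nat -> R) (t : R) (j : nat) : R :=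
  if (2 <= j)%N then j%:R * beta j * t ^+ j.-1 else 0.

Definition betap {R : realType} (beta : nat -> R) (t : R) : R :=
  limn (series (betap_terms beta t)).

Definition zfun {R : realType} (beta : nat -> R) (t : R) : R :=
  1 - t - expR (- betap beta t).

Definition tstar {R : realType} (beta : nat -> R) : R :=
  inf [set t | 0 <= t /\ zfun beta t < 0].

Definition pois_pmf {R : realType} (mu : R) (n : nat) : R :=
  expR (- mu) * mu ^+ n / n`!%:R.

(* mean number of hyperedges on A: N beta_j / binom(N, j), j = |A| >= 2;
   there are no original hyperedges with fewer than 2 vertices *)
Definition hmean {R : realType} (beta : nat -> R) (N : nat) (A : {set 'I_N}) : R :=
  if (2 <= #|A|)%N then N%:R * beta #|A| / 'C(N, #|A|)%:R else 0.

(* M w A = number of hyperedges on A; independent Poisson(hmean A) *)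
Definition poisson_hypergraph {R : realType} (d : measure_display)
  (Omega : measurableType d) (P : probability Omega R) (beta : nat -> R)
  (N : nat) (M : Omega -> {set 'I_N} -> nat) : Prop :=
  (forall A n, measurable [set w | M w A = n]) /\
  (forall n : {set 'I_N} -> nat,
     P [set w | forall A, M w A = n A]
     = (\prod_(A : {set 'I_N}) pois_pmf (hmean beta A) (n A))%:E).

Definition past_gen {R : realType} (d : measure_display) (Omega : measurableType d)
  (E : Omega -> nat -> nat -> R) (i : nat) : set (set Omega) :=
  [set S | exists m j (A : set R),
     [/\ (1 <= m < i)%N, measurable A & S = (fun w => E w m j) @^-1` A]].

(* Exponential interpolation: conditionally on the past, the
   E_{i,1..navail_i} are i.i.d. Exp(lambda2(N,i-1)), and
   C_N(i) = #{j : E_{i,j} <= 1}. *)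
Definition exp_interpolation {R : realType} (d : measure_display)
  (Omega : measurableType d) (P : probability Omega R) (beta : nat -> R)
  (N : nat) (M : Omega -> {set 'I_N} -> nat) (E : Omega -> nat -> nat -> R) : Prop :=
  [/\ (forall i j, measurable_fun setT (fun w => E w i j)),
      (forall w i, (1 <= i <= N)%N ->
         bfw_C (hasM (M w)) i
         = count (fun j => E w i j <= 1) (iota 1 (bfw_navail (hasM (M w)) i)))
    & (forall i, (1 <= i <= N)%N ->
       forall (n : nat) (B : set Omega) (A : nat -> set R),
         <<s past_gen E i >> B ->
         B `<=` [set w | bfw_navail (hasM (M w)) i = n] ->
         (forall j, measurable (A j)) ->
         P (B `&` [set w | forall j, (1 <= j <= n)%N -> A j (E w i j)])
         = (P B * \prod_(1 <= j < n.+1)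
                    exponential_prob (lambda2 beta N i.-1) (A j))%E)].

Definition scaled_walk {R : realType} (beta : nat -> R) (N : nat)
  (M : {set 'I_N} -> nat) (E : nat -> nat -> R) (t : R) : R :=
  (bfw_interp (hasM M) E (N%:R * t) - N%:R * zfun beta t) / Num.sqrt N%:R.

Definition brownian {R : realType} (d : measure_display) (Omega : measurableType d)
  (P : probability Omega R) (B : Omega -> R -> R) : Prop :=
  [/\ (forall t, measurable_fun setT (fun w => B w t)),
      (forall w, B w 0 = 0),
      (forall w, {within `[0, +oo[, continuous (B w)})
    & (forall (n : nat) (ts : nat -> R) (A : nat -> set R),
         ts 0%N = 0 -> (forall k, (k < n)%N -> ts k < ts k.+1) ->
         (forall k, measurable (A k)) ->
         P [set w | forall k, (k < n)%N -> A k (B w (ts k.+1) - B w (ts k))]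
         = (\prod_(k < n) normal_prob 0 (Num.sqrt (ts k.+1 - ts k)) (A k))%E)].

Definition is_RS_integral {R : realType} (f g : R -> R) (a b I : R) : Prop :=
  forall e, 0 < e -> exists2 delta, 0 < delta &
    forall (n : nat) (p tg : nat -> R), p 0%N = a -> p n = b ->
      (forall k, (k < n)%N ->
         [/\ p k <= tg k, tg k <= p k.+1 & p k.+1 - p k < delta]) ->
      `| \sum_(k < n) f (tg k) * (g (p k.+1) - g (p k)) - I | < e.

Definition cadlag_on {R : realType} (s : R) (f : R -> R) : Prop :=
  (forall t, 0 <= t < s -> f x @[x --> t^'+] --> f t) /\
  (forall t, 0 < t <= s -> cvg (f x @[x --> t^'-])).

Definition time_change {R : realType} (s : R) (l : R -> R) : Prop :=
  [/\ l 0 = 0, l s = s,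
      (forall x y, 0 <= x -> x < y -> y <= s -> l x < l y)
    & {within `[0, s], continuous l}].

(* Skorokhod distance d_s(f, g) < delta (up to the boundary) *)
Definition skorokhod_close {R : realType} (s : R) (f g : R -> R) (delta : R) : Prop :=
  exists l, time_change s l /\
    forall t, 0 <= t <= s -> `|l t - t| < delta /\ `|f t - g (l t)| < delta.

Definition skorokhod_continuous {R : realType} (s : R) (F : (R -> R) -> R) : Prop :=
  forall f, cadlag_on s f -> forall e, 0 < e -> exists2 delta, 0 < delta &
    forall g, cadlag_on s g -> skorokhod_close s f g delta -> `|F f - F g| < e.

Definition bounded_on_cadlag {R : realType} (s : R) (F : (R -> R) -> R) : Prop :=
  exists C : R, forall f, cadlag_on s f -> `|F f| <= C.

(* (Y_N(t))_{0<=t<=s} converges in distribution to (X(t))_{0<=t<=s} in D[0,s]: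
   E[F(Y_N)] -> E[F(X)] for every bounded Skorokhod-continuous F
   (measurability of the compositions is automatic for such F, since
   the Borel sigma-algebra of D[0,s] is generated by the coordinates). *)
Definition cvg_dist_D {R : realType} (s : R)
  (dN : nat -> measure_display) (Omega : forall N, measurableType (dN N))
  (P : forall N, probability (Omega N) R) (Y : forall N, Omega N -> R -> R)
  (d' : measure_display) (Omega' : measurableType d') (P' : probability Omega' R)
  (X : Omega' -> R -> R) : Prop :=
  forall F : (R -> R) -> R, bounded_on_cadlag s F -> skorokhod_continuous s F ->
    (forall N, measurable_fun setT (fun w => F (Y N w))) ->
    measurable_fun setT (fun w => F (X w)) ->
    (fun N => (\int[P N]_w (F (Y N w))%:E)%E) @ \oo
      --> (\int[P']_w (F (X w))%:E)%E.

(* Main.v *)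
(* The number of unnumbered vertices, multiplied by A_i = exp(sum of the first i
   rates lambda_2), is a martingale up to a drift caused by the patches.  Solving
   for the walk gives Z_N(i) = N z(i/N) + sqrt(N) exp(-beta'(i/N)) Q_i + error,
   where Q is the normalized martingale.  An exponential maximal inequality bounds
   the oscillation of Q on each of m blocks of time; since z stays positive on
   (0, sigma], this keeps the number of patches, hence the error, of order smaller
   than sqrt(N).  So the scaled walk is uniformly close to a step path built from
   the m block increments of Q.

   A test functional F is replaced by its c-Lipschitz envelope for the uniform
   norm and then, as a function of the block increments, by a spline
   approximation.  For this smooth function of finitely many variables,
   Lindeberg's replacement exchanges, one step at a time, the increments of Q for
   the Gaussian variables A_k (B(tau_(k+1)) - B(tau_k)) with tau_k = 1 - 1/A_k; the
   limits of the block sums of these are increments of the Riemann-Stieltjes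
   integral of exp(beta'(s)) with respect to B(z(s) + s), because
   z(s) + s = 1 - exp(-beta'(s)).  This yields the inequality
   limsup E F(Y_N) <= E F(X), and the theorem follows on applying it to -F too. *)

Require Import Defs.
From HB Require Import structures.
From mathcomp Require Import all_boot all_order all_algebra.
From mathcomp Require Import all_classical all_reals all_analysis.
From mathcomp Require Import normal_distribution exponential_distribution.
From mathcomp Require Import measurable_realfun.
From mathcomp Require Import ring lra zify.

Import Order.TTheory GRing.Theory Num.Def Num.Theory.
Import numFieldTopology.Exports numFieldNormedType.Exports.
Local Open Scope classical_set_scope.
Local Open Scope ring_scope.

Set Implicit Arguments.
Unset Strict Implicit.
Unset Printing Implicit Defensive.


(** * The function beta' and the rates *)

(** The delicate point is time 0: z(0) = 0 and, as 2 beta_2 = 1, also z'(0) = 0, so there the drift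
    N z does not keep the walk away from its running minimum. On the first block only the small
    oscillation e of Q limits the patches, to order sqrt(N) e; on later blocks sqrt(N) z exceeds
    every value that Q reaches on good histories. For given e the number m of blocks is taken large,
    and N goes to infinity last. The factor A_i produces no error term, because a child is born with
    probability exactly p = 1 - exp(-lambda2). The clock tau_k = 1 - 1/A_k gives A_k^2 (tau_(k+1) -
    tau_k) = A_k p_k, which is the conditional variance of the increment of Q to leading order. The
    series of beta' is only known to converge up to 1, so the uniform estimates live on [0, sigma']
    with sigma < sigma' < [tstar] <= 1, where powers decay geometrically. Uniform closeness to step
    paths with finitely many blocks takes the place of a tightness argument. *)

Section GeometricBounds.
Context {R : realFieldType}.

(** Each of the n + 1 powers rho^i with i <= n is at least rho^n, and together they sum to at most
    1/(1 - rho). *)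
Lemma geom_mul_bound (rho : R) n : 0 <= rho < 1 -> n.+1%:R * rho ^+ n <= (1 - rho)^-1.
Proof.
move=> /andP[r0 r1].
have h : 0 < 1 - rho by lra.
rewrite -[leRHS]mul1r ler_pdivlMr//.
apply: (@le_trans _ _ ((\sum_(i < n.+1) rho ^+ i) * (1 - rho))).
  rewrite ler_wpM2r//; first exact: ltW.
  rewrite mulr_natl -[in leLHS](card_ord n.+1) -sumr_const.
  by apply: ler_sum => i _; apply: ler_wiXn2l; rewrite ?(ltW r1)// leq_ord.
have -> : (\sum_(i < n.+1) rho ^+ i) * (1 - rho) = 1 - rho ^+ n.+1.
  rewrite [in RHS](_ : 1 - rho ^+ n.+1 = - (rho ^+ n.+1 - 1)); last by rewrite opprB.
  by rewrite subrX1; ring.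
by rewrite gerBl exprn_ge0.
Qed.

Lemma powB_le (rho s t : R) n : 0 <= s -> s <= t -> t <= rho ->
  t ^+ n.+1 - s ^+ n.+1 <= n.+1%:R * rho ^+ n * (t - s).
Proof.
move=> s0 st tr; rewrite subrXX mulrC ler_wpM2r ?subr_ge0//.
rewrite mulr_natl -[in leRHS](card_ord n.+1) -sumr_const.
apply: ler_sum => i _ /=.
apply: (@le_trans _ _ (rho ^+ (n - i) * rho ^+ i)); last first.
  by rewrite -exprD subnK// leq_ord.
have t0 : 0 <= t by lra.
have r0 : 0 <= rho by lra.
by apply: ler_pM; rewrite ?exprn_ge0// lerXn2r ?nnegrE//; lra.
Qed.

End GeometricBounds.

(** The square of [geom_mul_bound] at sqrt(rho). *)
Lemma geom_sq_bound (R : rcfType) (rho : R) n : 0 <= rho < 1 ->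
  n.+1%:R ^+ 2 * rho ^+ n <= (1 - Num.sqrt rho)^-1 ^+ 2.
Proof.
move=> /andP[r0 r1].
have h : 0 <= Num.sqrt rho < 1.
  by rewrite sqrtr_ge0 -[X in _ < X]sqrtr1 ltr_sqrt.
have := geom_mul_bound n h => le.
rewrite -[in leLHS](sqr_sqrtr r0) -exprM mulnC exprM -exprMn.
by rewrite lerXn2r ?nnegrE ?mulr_ge0 ?exprn_ge0 ?invr_ge0 ?subr_ge0//; case/andP: h => // _ /ltW.
Qed.

(** * Ratios of binomial coefficients compared with powers *)

Section Binratio.
Context {R : realType}.
Variables (N i : nat).

Definition binratio (r : nat) : R := 'C(i, r)%:R / 'C(N.-1, r)%:R.

Lemma hockey_stick (j m : nat) : (\sum_(l < m) 'C(l, j) = 'C(m, j.+1))%N.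
Proof.
by elim: m => [|m IH]; rewrite ?big_ord0// big_ord_recr /= IH binS addnC.
Qed.

Hypothesis iN : (i < N.-1)%N.

(** So [binratio] is t^r with its factors replaced by (i - l)/(N - 1 - l). For r >= i both sides
    vanish, the natural subtraction i - r being 0. *)
Lemma binratioS r : binratio r.+1 = binratio r * ((i - r)%:R / (N.-1 - r)%:R).
Proof.
have [ri|ri] := leqP i r.
  by rewrite /binratio bin_small// (eqP ri) !mul0r mulr0.
have rN : (r < N.-1)%N by lia.
have cN : 'C(N.-1, r)%:R != 0 :> R by rewrite pnatr_eq0 -lt0n bin_gt0 ltnW.
have cN' : 'C(N.-1, r.+1)%:R != 0 :> R by rewrite pnatr_eq0 -lt0n bin_gt0.
have dN : (N.-1 - r)%:R != 0 :> R by rewrite pnatr_eq0 -lt0n subn_gt0.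
rewrite /binratio; apply/eqP; rewrite mulf_div eqr_div ?mulf_neq0//.
have := congr1 (fun x => x%:R : R) (mul_bin_left i r).
have := congr1 (fun x => x%:R : R) (mul_bin_left N.-1 r).
rewrite /= !natrM => e1 e2; apply/eqP.
have r1 : r.+1%:R != 0 :> R by rewrite pnatr_eq0.
apply: (mulfI r1).
have -> : r.+1%:R * ('C(i, r.+1)%:R * ('C(N.-1, r)%:R * (N.-1 - r)%:R))
  = (r.+1%:R * 'C(i, r.+1)%:R) * ((N.-1 - r)%:R * 'C(N.-1, r)%:R) :> R by ring.
by rewrite e2 -e1; ring.
Qed.

Variables (rho t c : R).
Hypothesis tE : t = i%:R / N%:R.
Hypothesis irho : i%:R <= rho * N.-1%:R.
Hypothesis rho1 : 0 <= rho < 1.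
Hypothesis c0 : 0 < c.
Hypothesis Nc : c * N%:R <= N.-1%:R - i%:R.

Lemma binratio_le r : 0 <= binratio r <= rho ^+ r.
Proof.
elim: r => [|r /andP[IH0 IH]]; first by rewrite /binratio !bin0 divr1 expr0 ler01 lexx.
rewrite binratioS mulr_ge0 ?divr_ge0//= exprSr ler_pM// ?divr_ge0//.
have [ri|ri] := leqP i r; first by rewrite (eqP ri) mul0r; case/andP: rho1.
have rN : (r < N.-1)%N by exact: ltn_trans iN.
have h : 0 < (N.-1 - r)%:R :> R by rewrite ltr0n subn_gt0.
rewrite ler_pdivrMr// !natrB ?(ltnW ri)// ?(ltnW rN)//.
rewrite mulrBr lerB//.
by rewrite ler_piMl//; case/andP: rho1 => _ /ltW.
Qed.

(** Induction on r: replacing the factor (i - r)/(N - 1 - r) by t costs at most rho^r (r + 1)/(c N),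
    and 1 + ... + r <= r^2. *)
Lemma binratio_near r :
  `|binratio r - t ^+ r| <= r%:R ^+ 2 * rho ^+ r.-1 / (c * N%:R).
Proof.
have N0n : (0 < N)%N by case: (N) iN.
have N0 : 0 < N%:R :> R by rewrite ltr0n.
have cN0 : 0 < c * N%:R by rewrite mulr_gt0.
have t0 : 0 <= t by rewrite tE divr_ge0.
have tr : t <= rho.
  rewrite tE ler_pdivrMr//; apply: le_trans irho _.
  by rewrite ler_wpM2l ?ler_nat ?leq_pred//; case/andP: rho1.
have /andP[r0 r1] := rho1.
elim: r => [|r IH].
  by rewrite /binratio !bin0 divr1 expr0 subrr normr0 expr0n /= !mul0r.
pose x : R := (i - r)%:R / (N.-1 - r)%:R.
have hx : binratio r * `|x - t| <= rho ^+ r * (r.+1%:R / (c * N%:R)).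
  have [ri|ri] := leqP r i; last first.
    by rewrite {1}/binratio bin_small// !mul0r mulr_ge0 ?exprn_ge0// divr_ge0// ltW.
  have /andP[b0 b1] := binratio_le r.
  apply: ler_pM => //; rewrite /x tE.
  have h : 0 < (N.-1 - r)%:R :> R by rewrite ltr0n subn_gt0 (leq_ltn_trans ri iN).
  have hE : (N.-1 - r)%:R = N%:R - 1 - r%:R :> R.
    by rewrite natrB ?(leq_trans ri (ltnW iN))// -subn1 natrB.
  have iE : N.-1%:R = N%:R - 1 :> R by rewrite -subn1 natrB.
  have -> : (i - r)%:R / (N.-1 - r)%:R - i%:R / N%:R =
     (i%:R - r%:R * (N%:R - i%:R)) / ((N.-1 - r)%:R * N%:R) :> R.
    rewrite natrB//; move: h; rewrite hE => h; field.
    by rewrite !gt_eqF.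
  rewrite normrM normfV (gtr0_norm (mulr_gt0 h N0)).
  rewrite ler_pdivrMr ?mulr_gt0//.
  have i0 : i%:R <= N%:R :> R by rewrite ler_nat (leq_trans (ltnW iN))// leq_pred.
  have r0' : 0 <= r%:R :> R by [].
  have ri' : r%:R <= i%:R :> R by rewrite ler_nat.
  have num : `|i%:R - r%:R * (N%:R - i%:R)| <= r.+1%:R * N%:R :> R.
    rewrite -natr1 ler_norml; apply/andP; split; last first.
      have : 0 <= r%:R * (N%:R - i%:R) :> R by rewrite mulr_ge0 ?subr_ge0.
      have : 0 <= r%:R * N%:R :> R by rewrite mulr_ge0.
      by lra.
    have : 0 <= r%:R * i%:R :> R by rewrite mulr_ge0.
    by lra.
  apply: le_trans num _.
  rewrite [leRHS](_ : _ = r.+1%:R * N%:R * ((N.-1 - r)%:R / (c * N%:R))); last by ring.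
  rewrite ler_peMr ?mulr_ge0// ler_pdivlMr// mul1r.
  by apply: le_trans Nc _; rewrite hE iE; lra.
rewrite binratioS -/x exprSr.
have -> : binratio r * x - t ^+ r * t = binratio r * (x - t) + (binratio r - t ^+ r) * t by ring.
have /andP[b0 b1] := binratio_le r.
apply: le_trans (ler_normD _ _) _; rewrite [X in X + _]normrM [X in _ + X]normrM.
rewrite (ger0_norm b0) (ger0_norm t0).
have h2 : `|binratio r - t ^+ r| * t <= r%:R ^+ 2 * rho ^+ r / (c * N%:R).
  apply: le_trans (ler_pM _ _ IH tr) _ => //.
  case: (r) => [|r']; first by rewrite expr0n /= !mul0r.
  by rewrite le_eqVlt; apply/orP; left; apply/eqP; rewrite /= (exprSr rho); ring.
apply: le_trans (lerD hx h2) _.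
rewrite [X in X + _](_ : _ = r.+1%:R * rho ^+ r / (c * N%:R)); last first.
  by rewrite mulrA (mulrC (rho ^+ r)).
rewrite -mulrDl -mulrDl ler_wpM2r ?invr_ge0 ?(ltW cN0)//.
rewrite ler_wpM2r ?exprn_ge0// -natr1.
have : 0 <= r%:R :> R by [].
have -> : (r%:R + 1) ^+ 2 = r%:R ^+ 2 + 2 * r%:R + 1 :> R by ring.
lra.
Qed.

End Binratio.

Lemma sum_shift2 (V : nmodType) (f : nat -> V) k : f 0%N = 0 -> f 1%N = 0 ->
  \sum_(0 <= j < k + 2) f j = \sum_(j < k) f (j + 2)%N.
Proof.
move=> f0 f1; rewrite addn2 big_nat_recl// big_nat_recl// f0 f1 !add0r big_mkord.
by apply: eq_bigr => j _; rewrite addn2.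
Qed.

(** * Growth of beta' and its approximation by sums of the rates *)

Section BetaP.
Context {R : realType} (beta : nat -> R).
Hypothesis beta0 : forall j, (2 <= j)%N -> 0 <= beta j.
Hypothesis beta2 : beta 2 = 1 / 2.
Hypothesis bcvg : cvg (series (betap_terms beta 1) @ \oo).

Local Notation aj := (betap_terms beta 1).
Local Notation bp := (betap beta).

Lemma aj_ge0 j : 0 <= aj j.
Proof.
rewrite /betap_terms; case: ifP => // j2.
by rewrite expr1n mulr1 mulr_ge0// beta0.
Qed.

Lemma betap_termsE t j : betap_terms beta t j = aj j * t ^+ j.-1.
Proof. by rewrite /betap_terms; case: ifP => _; rewrite ?mul0r// expr1n mulr1. Qed.

Lemma betap_cvg t : 0 <= t <= 1 -> cvgn (series (betap_terms beta t)).
Proof.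
move=> /andP[t0 t1]; apply: series_le_cvg bcvg => n.
- by rewrite betap_termsE mulr_ge0 ?aj_ge0 ?exprn_ge0.
- exact: aj_ge0.
- by rewrite betap_termsE ler_piMr ?aj_ge0// exprn_ile1.
Qed.

Lemma betap0 : bp 0 = 0.
Proof.
rewrite /betap (_ : series _ = fun=> 0) ?lim_cst//.
apply/funext => n; rewrite /series /= big1// => j _.
rewrite betap_termsE /betap_terms.
by case: j => [|[|j]]; rewrite ?mul0r//= expr0n /= mulr0.
Qed.

Lemma betapB_le s t s' t' C : 0 <= s <= 1 -> 0 <= t <= 1 ->
  0 <= s' <= 1 -> 0 <= t' <= 1 ->
  (forall j, betap_terms beta t j - betap_terms beta s j
     <= C * (betap_terms beta t' j - betap_terms beta s' j)) ->
  bp t - bp s <= C * (bp t' - bp s').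
Proof.
move=> /betap_cvg cs /betap_cvg ct /betap_cvg cs' /betap_cvg ct' le.
have h1 : series (betap_terms beta t) \- series (betap_terms beta s) @ \oo --> bp t - bp s.
  exact: cvgB.
have h2 : series (betap_terms beta t') \- series (betap_terms beta s') @ \oo --> bp t' - bp s'.
  exact: cvgB.
have h3 : (fun=> C) \* (series (betap_terms beta t') \- series (betap_terms beta s'))
    @ \oo --> C * (bp t' - bp s').
  by apply: cvgM h2; exact: cvg_cst.
apply: (ler_cvg_to h1 h3).
near=> n; rewrite /series /= ?fctE -!sumrB mulr_sumr.
by apply: ler_sum => j _; exact: le.
Unshelve. all: by end_near. Qed.

(** The term j = 2 alone contributes t - s, since 2 beta_2 = 1, and the other terms are
    nondecreasing. Hence beta' has a 1-Lipschitz inverse, on which the time change in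
    [discrete_integral] rests. *)
Lemma betap_expand s t : 0 <= s -> s <= t -> t <= 1 -> t - s <= bp t - bp s.
Proof.
move=> s0 st t1.
have S : 0 <= s <= 1 by lra.
have T : 0 <= t <= 1 by lra.
have h : series (betap_terms beta t) \- series (betap_terms beta s) @ \oo --> bp t - bp s.
  by apply: cvgB; exact: betap_cvg.
apply: (cvgr_to_ge h).
near=> n; rewrite /series /= -sumrB.
have n3 : (3 <= n)%N by near: n; exact: nbhs_infty_ge.
have [k ->] : exists k, n = (k.+1 + 2)%N by exists (n - 3)%N; lia.
rewrite sum_shift2 ?subrr// big_ord_recl /=.
have -> : betap_terms beta t (0 + 2)%N - betap_terms beta s (0 + 2)%N = t - s.
  by rewrite /betap_terms /= beta2; field.
rewrite lerDl; apply: sumr_ge0 => j _.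
rewrite (betap_termsE t) (betap_termsE s) -mulrBr mulr_ge0 ?aj_ge0// subr_ge0.
by rewrite lerXn2r ?nnegrE//; lra.
Unshelve. all: by end_near. Qed.

Lemma betap_mono s t : 0 <= s -> s <= t -> t <= 1 -> bp s <= bp t.
Proof. by move=> s0 st t1; have := betap_expand s0 st t1; lra. Qed.

Lemma betap_ge0 t : 0 <= t <= 1 -> 0 <= bp t.
Proof. by move=> /andP[t0 t1]; have := betap_mono (lexx 0) t0 t1; rewrite betap0. Qed.

(** On [0, rho] each power has slope at most (n + 1) rho^n <= 1/(1 - rho), so the comparison is with
    beta'(1) and no bound on the second derivative at 1 enters. *)
Lemma betap_lip (rho s t : R) : rho < 1 -> 0 <= s -> s <= t -> t <= rho ->
  bp t - bp s <= bp 1 / (1 - rho) * (t - s).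
Proof.
move=> r1 s0 st tr.
have r0 : 0 <= rho < 1 by lra.
have := @betapB_le s t 0 1 ((t - s) / (1 - rho)).
rewrite betap0 subr0 => H.
rewrite (_ : _ * (t - s) = (t - s) / (1 - rho) * bp 1); last by ring.
apply: H; [lra|lra|lra|lra|move=> j].
have -> : aj j - betap_terms beta 0 j = aj j.
  rewrite (betap_termsE 0) {2}/betap_terms; case: j => [|[|j]]; rewrite ?mul0r ?subr0//=.
  by rewrite expr0n /= mulr0 subr0.
rewrite (betap_termsE t) (betap_termsE s).
rewrite -mulrBr mulrC ler_wpM2r ?aj_ge0//.
case: (j.-1) => [|n]; first by rewrite !expr0 subrr divr_ge0//; lra.
apply: le_trans (powB_le _ s0 st tr) _.
by rewrite mulrC ler_wpM2l ?geom_mul_bound//; lra.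
Qed.

(** After exchanging the sums, the hockey-stick identity and N C(N-1, j+1) = (j+2) C(N, j+2) show
    that the summed rates are the series of beta'(m/N) with powers replaced by [binratio]. *)
Lemma Lam_series (N m : nat) : (0 < N)%N ->
  \sum_(l < m) lambda2 beta N l = \sum_(j < m) aj (j + 2)%N * binratio N m j.+1.
Proof.
move=> N0.
have -> : \sum_(l < m) lambda2 beta N l =
   \sum_(l < m) \sum_(j < m) N%:R * (beta (j + 2)%N * 'C(l, j)%:R / 'C(N, j + 2)%:R).
  apply: eq_bigr => l _; rewrite /lambda2 mulr_sumr.
  rewrite (big_ord_widen m (fun j => N%:R * (beta (j + 2)%N * 'C(l, j)%:R / 'C(N, j + 2)%:R)))//.
  rewrite big_mkcond /=; apply: eq_bigr => j _; case: ifPn => //.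
  by rewrite -leqNgt => lj; rewrite (bin_small lj) mulr0 mul0r mulr0.
rewrite exchange_big /=; apply: eq_bigr => j _.
rewrite -mulr_sumr -mulr_suml -mulr_sumr -natr_sum hockey_stick.
rewrite /betap_terms addn2 /= expr1n mulr1 /binratio.
have [jN|jN] := leqP j.+2 N; last first.
  by rewrite !(bin_small (n := N))// (bin_small (n := N.-1)) ?invr0 ?mulr0//; lia.
have := congr1 (fun x => x%:R : R) (mul_bin_diag N j.+1); rewrite !natrM => e.
have c1 : 'C(N, j.+2)%:R != 0 :> R by rewrite pnatr_eq0 -lt0n bin_gt0.
have c2 : 'C(N.-1, j.+1)%:R != 0 :> R by rewrite pnatr_eq0 -lt0n bin_gt0; lia.
have -> : N%:R * (beta j.+2 * 'C(m, j.+1)%:R / 'C(N, j.+2)%:R)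
  = N%:R * 'C(N.-1, j.+1)%:R * (beta j.+2 * 'C(m, j.+1)%:R)
      / ('C(N, j.+2)%:R * 'C(N.-1, j.+1)%:R) :> R.
  by field; rewrite c1 c2.
by rewrite e; field; rewrite c1 c2.
Qed.

(** The error of the term of index j + 2 is at most its coefficient times (j + 1)^2 r'^j/(c N), and
    [geom_sq_bound] bounds this uniformly in j. The total is therefore at most a multiple of
    beta'(1)/N. *)
Lemma Lam_near (rho : R) : 0 < rho < 1 -> exists C N0, 0 <= C /\ forall N m,
  (N0 <= N)%N -> m%:R <= rho * N%:R ->
  `|\sum_(l < m) lambda2 beta N l - bp (m%:R / N%:R)| <= C / N%:R.
Proof.
move=> /andP[rho0 rho1].
(* With rho = 1 - 2c and r' = 1 - c, the bound c N >= 2 leaves room for N - 1 in place of N and for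
   the gap c N <= N - 1 - m. *)
pose r' := (1 + rho) / 2; pose c := (1 - rho) / 2.
have r'1 : 0 <= r' < 1 by rewrite /r'; lra.
have c0 : 0 < c by rewrite /c; lra.
pose M := (1 - Num.sqrt r')^-1 ^+ 2 / c.
have M0 : 0 <= M by rewrite /M divr_ge0 ?sqr_ge0// ltW.
exists (M * bp 1), (Num.Def.truncn (2 / c)).+2.
have b10 : 0 <= bp 1 by apply: betap_ge0; lra.
split; first by rewrite mulr_ge0.
move=> N m NN mN.
have Nc : 2 / c <= N%:R.
  apply: (@le_trans _ _ (Num.Def.truncn (2 / c)).+1%:R); first exact/ltW/truncnS_gt.
  by rewrite ler_nat ltnW.
have N0 : (0 < N)%N by apply: leq_trans NN.
have NR : 0 < N%:R :> R by rewrite ltr0n.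
have cN : 2 <= c * N%:R by rewrite mulrC -ler_pdivrMr.
have PN : N.-1%:R = N%:R - 1 :> R by rewrite -subn1 natrB.
have cE : rho = 1 - 2 * c by rewrite /c; lra.
have r'E : r' = 1 - c by rewrite /r' /c; lra.
have c1 : c <= 1 by lra.
have mN1 : (m < N.-1)%N.
  rewrite -(ltr_nat R) PN; move: mN; rewrite cE; lra.
have mr' : m%:R <= r' * N.-1%:R.
  by rewrite PN r'E; move: mN; rewrite cE; lra.
have cNm : c * N%:R <= N.-1%:R - m%:R by rewrite PN; move: mN; rewrite cE; lra.
set t := m%:R / N%:R.
have t0 : 0 <= t by rewrite divr_ge0.
have t1 : t <= 1 by rewrite ler_pdivrMr// mul1r ler_nat; clear -mN1; lia.
have key j : `|aj (j + 2)%N * binratio N m j.+1 - betap_terms beta t (j + 2)%N|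
    <= M / N%:R * aj (j + 2)%N.
  rewrite (betap_termsE t) addn2 /= -mulrBr normrM (ger0_norm (aj_ge0 _)) mulrC.
  rewrite ler_wpM2r ?aj_ge0//.
  apply: le_trans (binratio_near mN1 (erefl _) mr' r'1 c0 cNm j.+1) _.
  rewrite /M -[leRHS]mulrA -invfM ler_wpM2r ?geom_sq_bound//.
  by rewrite invr_ge0 mulr_ge0// ltW.
rewrite Lam_series// distrC.
have T : 0 <= t <= 1 by rewrite t0.
set S := \sum_(j < m) _.
have h : series (betap_terms beta t) n - S @[n --> \oo] --> bp t - S.
  by apply: cvgB; [exact: betap_cvg|exact: cvg_cst].
apply: (cvgr_to_le (cvg_norm h)); rewrite {h}/S; near=> n.
have nm : (m.+2 <= n)%N by near: n; exact: nbhs_infty_ge.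
have [k nk] : exists k, n = (k + 2)%N.
  by exists (n - 2)%N; rewrite subnK// (leq_trans _ nm).
have mk : (m <= k)%N by move: nm; rewrite nk addn2.
rewrite /series /= nk sum_shift2; last first.
- by rewrite /betap_terms.
- by rewrite /betap_terms.
(* Terms with j >= m vanish because C(m, j+1) = 0, so both sums can run over the same range. *)
have -> : \sum_(j < m) aj (j + 2)%N * binratio N m j.+1
        = \sum_(j < k) aj (j + 2)%N * binratio N m j.+1 :> R.
  rewrite (big_ord_widen k (fun j => aj (j + 2)%N * binratio N m j.+1))//.
  rewrite big_mkcond /=; apply: eq_bigr => j _; case: ifPn => //.
  by rewrite -leqNgt => mj; rewrite /binratio bin_small// mul0r mulr0.
rewrite -sumrB; apply: le_trans (ler_norm_sum _ _ _) _.
apply: (@le_trans _ _ (\sum_(j < k) M / N%:R * aj (j + 2)%N)).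
  by apply: ler_sum => j _; rewrite distrC; exact: key.
rewrite -mulr_sumr mulrAC ler_wpM2r ?invr_ge0 ?(ltW NR)// ler_wpM2l//.
rewrite -sum_shift2; last first.
- by rewrite /betap_terms.
- by rewrite /betap_terms.
apply: nondecreasing_cvgn_le; last exact: bcvg.
by apply/nondecreasing_seqP => j; rewrite /series /= big_nat_recr//= lerDl aj_ge0.
Unshelve. all: by end_near. Qed.

End BetaP.

(** * Expectations along trees of histories *)

(* Histories are lists with the most recent entry first.  [kop s] is the
   conditional expectation, given the history [s], of a function of the next
   entry, which is supported on [0 .. kbd s]. *)
Record kern (R : realFieldType) := Kern {
  kop :> seq nat -> (nat -> R) -> R;
  kbd : seq nat -> nat;
  kop_lin : forall s a g h, kop s (fun x => a * g x + h x) = a * kop s g + kop s h;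
  kop_mono : forall s g h, (forall x, (x <= kbd s)%N -> g x <= h x) ->
    kop s g <= kop s h;
  kop_cst : forall s c, kop s (fun=> c) = c }.

Section KernTheory.
Context {R : realFieldType} (K : kern R).
Implicit Types (s : seq nat) (g h : nat -> R) (phi psi : seq nat -> R).

Lemma eq_kop s g h : (forall x, (x <= kbd K s)%N -> g x = h x) -> K s g = K s h.
Proof.
move=> gh; apply/eqP; rewrite eq_le !kop_mono// => x xs; by rewrite gh.
Qed.

Lemma kopD s g h : K s (fun x => g x + h x) = K s g + K s h.
Proof.
rewrite -[X in X + _]mul1r -kop_lin.
by apply: eq_kop => x _; rewrite mul1r.
Qed.

Lemma kopZ s a g : K s (fun x => a * g x) = a * K s g.
Proof.
rewrite -[RHS]addr0 -[X in _ + X](kop_cst K s 0) -kop_lin.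
by apply: eq_kop => x _; rewrite addr0.
Qed.

Lemma kopB s g h : K s (fun x => g x - h x) = K s g - K s h.
Proof.
rewrite -[X in _ - X]mul1r -mulNr -kopZ -kopD.
by apply: eq_kop => x _; rewrite mulN1r.
Qed.

Lemma kop_abs s g : `|K s g| <= K s (fun x => `|g x|).
Proof.
rewrite ler_norml; apply/andP; split.
  rewrite -mulN1r -kopZ; apply: kop_mono => x _.
  by rewrite mulN1r lerNl -normrN ler_norm.
by apply: kop_mono => x _; rewrite ler_norm.
Qed.

(* Expectation over [n] further steps from the history [s]. *)
Fixpoint EE (n : nat) (s : seq nat) (phi : seq nat -> R) : R :=
  if n is n'.+1 then K s (fun x => EE n' (x :: s) phi) else phi s.

(** Histories all of whose entries lie in the supports; [EE_mono] compares functions on these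
    only. *)
Fixpoint valid s : bool :=
  if s is x :: s' then (x <= kbd K s')%N && valid s' else true.

Lemma EE_mono n s phi psi : valid s ->
  (forall l, valid l -> size l = (size s + n)%N -> phi l <= psi l) ->
  EE n s phi <= EE n s psi.
Proof.
elim: n s => [|n IH] s vs le /=; first by apply: le => //; rewrite addn0.
apply: kop_mono => x xs; apply: IH => /=; first by rewrite xs vs.
by move=> l vl sl; apply: le => //; rewrite sl addnS.
Qed.

Lemma EE_cst n s c : EE n s (fun=> c) = c.
Proof.
elim: n s => [//|n IH] s /=; rewrite -[RHS](kop_cst K s).
by apply: eq_kop => x _; rewrite IH.
Qed.

Lemma EED n s phi psi : EE n s (fun l => phi l + psi l) = EE n s phi + EE n s psi.
Proof.
elim: n s => [//|n IH] s /=; rewrite -kopD.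
by apply: eq_kop => x _; rewrite IH.
Qed.

Lemma EEZ n s a phi : EE n s (fun l => a * phi l) = a * EE n s phi.
Proof.
elim: n s => [//|n IH] s /=; rewrite -kopZ.
by apply: eq_kop => x _; rewrite IH.
Qed.

Lemma EE_sum n s (I : Type) (r : seq I) (phi : I -> seq nat -> R) :
  EE n s (fun l => \sum_(i <- r) phi i l) = \sum_(i <- r) EE n s (phi i).
Proof.
elim: r => [|i r IH].
  rewrite big_nil -[RHS](EE_cst n s 0); elim: n s => [|n IH] s /=.
    by rewrite big_nil.
  by apply: eq_kop => x _; rewrite IH.
rewrite big_cons -IH -EED; clear IH; elim: n s => [|n IH] s /=.
  by rewrite big_cons.
by apply: eq_kop => x _; rewrite IH.
Qed.

(** Tails are earlier histories, so this looks back over the whole past. *)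
Fixpoint ever (bad : pred (seq nat)) s : bool :=
  bad s || (if s is _ :: s' then ever bad s' else false).

(* Ville's inequality: stop the nonnegative supermartingale G at the first bad
   history. *)
Lemma ville (bad : pred (seq nat)) (G : seq nat -> R) n s :
  (forall l, 0 <= G l) -> (forall l, bad l -> 1 <= G l) ->
  (forall l, valid l -> K l (fun x => G (x :: l)) <= G l) ->
  valid s -> (s == [::]) || ~~ ever bad (behead s) ->
  EE n s (fun l => (ever bad l)%:R) <= G s.
Proof.
move=> G0 G1 sup; elim: n s => [|n IH] s vs nb.
  rewrite /=; case: s vs nb => [|x s] /= vs nb.
    by rewrite orbF; case: (boolP (bad _)) => [/G1//|_]; exact: G0.
  by rewrite (negbTE nb) orbF; case: (boolP (bad _)) => [/G1//|_]; exact: G0.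
(* At the first bad history G has reached 1, which bounds the indicator whatever happens
   afterwards. *)
have [bs|nbs] := boolP (bad s).
  apply: le_trans (G1 _ bs).
  apply: le_trans (_ : EE n.+1 s (fun=> 1) <= _); last by rewrite EE_cst.
  apply: EE_mono => // l _ _.
  by case: (ever _ _).
apply: le_trans (sup _ vs) => /=.
apply: kop_mono => x xs; apply: IH => /=; first by rewrite xs vs.
by case: s nb nbs {vs xs} => [|y s] /= nb nbs; rewrite (negbTE nbs) ?(negbTE nb).
Qed.

End KernTheory.
Arguments EE {R} K n s phi.
Arguments valid {R} K s.

(* Expectation of [g] under the binomial distribution with parameters [n], [p]. *)
Fixpoint binE {R : pzRingType} (p : R) (n : nat) (g : nat -> R) : R :=
  if n is n'.+1 then p * binE p n' (fun x => g x.+1) + (1 - p) * binE p n' g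
  else g 0%N.

Section BinTheory.
Context {R : realFieldType}.
Implicit Types (p : R) (n : nat) (g h : nat -> R).

Lemma binE_lin p n a g h :
  binE p n (fun x => a * g x + h x) = a * binE p n g + binE p n h.
Proof. by elim: n g h => [//|n IH] g h /=; rewrite !IH; ring. Qed.

Lemma binE_mono p n g h : 0 <= p <= 1 ->
  (forall x, (x <= n)%N -> g x <= h x) -> binE p n g <= binE p n h.
Proof.
move=> /andP[p0 p1]; elim: n g h => [|n IH] g h gh /=; first exact: gh.
apply: lerD; apply: ler_wpM2l; rewrite ?subr_ge0//; apply: IH => x xn.
  by apply: gh.
by apply: gh; rewrite leqW.
Qed.

Lemma binE_cst p n c : binE p n (fun=> c) = c.
Proof. by elim: n => [//|n IH] /=; rewrite IH; ring. Qed.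

Lemma eq_binE p n g h : g =1 h -> binE p n g = binE p n h.
Proof.
elim: n g h => [|n IH] g h gh /=; first exact: gh.
by rewrite (IH _ _ gh) (IH (fun x => g x.+1) (fun x => h x.+1)).
Qed.

Lemma binE_exp p n (t : R) : binE p n (fun x => t ^+ x) = (1 - p + p * t) ^+ n.
Proof.
elim: n => [//|n IH] /=.
have -> : binE p n (fun x => t ^+ x.+1) = t * binE p n (fun x => t ^+ x).
  rewrite -[RHS]addr0 -(binE_cst p n 0) -binE_lin.
  by apply: eq_binE => x; rewrite addr0 exprS.
by rewrite IH exprS; ring.
Qed.

(** The centre c is arbitrary so that the induction can shift it by 1 when a trial succeeds. *)
Lemma binE_var p n (c : R) :
  binE p n (fun x => (x%:R - c) ^+ 2) = n%:R * p * (1 - p) + (n%:R * p - c) ^+ 2.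
Proof.
elim: n c => [|n IH] c /=; first by ring.
rewrite (_ : binE p n (fun x => (x.+1%:R - c) ^+ 2) =
             binE p n (fun x => (x%:R - (c - 1)) ^+ 2)); last first.
  by apply: eq_binE => x; congr (_ ^+ 2); rewrite -natr1; ring.
by rewrite !IH -natr1; ring.
Qed.

Lemma binE_mean p n (c : R) : binE p n (fun x => x%:R - c) = n%:R * p - c.
Proof.
elim: n c => [|n IH] c /=; first by ring.
rewrite (_ : binE p n (fun x => (x.+1%:R - c)) =
             binE p n (fun x => (x%:R - (c - 1)))); last first.
  by apply: eq_binE => x; rewrite -natr1; ring.
by rewrite !IH -natr1; ring.
Qed.

End BinTheory.

(** * Lindeberg replacement *)

Section Lindeberg.
Context {R : realFieldType}.
Implicit Types (y e : nat -> R) (t : R).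

Definition vadd y t e : nat -> R := fun r => y r + t * e r.

Lemma vaddC y t e t' e' : vadd (vadd y t e) t' e' = vadd (vadd y t' e') t e.
Proof. by apply/funext => r; rewrite /vadd; ring. Qed.

(* [a] and [b] play the role of the first and second derivatives of [f] in the
   direction [dir k]. *)
Definition smooth (dir : nat -> nat -> R) (c : R) (f : (nat -> R) -> R) : Prop :=
  forall k, exists a b : (nat -> R) -> R, forall y,
    [/\ `|a y| <= c, `|b y| <= c
      & forall t, `|f (vadd y t (dir k)) - f y - a y * t - b y * t ^+ 2 / 2|
                  <= c * `|t| ^+ 3].

Definition moment (K : kern R) (xi : seq nat -> nat -> R) (j : nat) (s : seq nat) :=
  K s (fun x => xi s x ^+ j).

Definition absmoment3 (K : kern R) (xi : seq nat -> nat -> R) (s : seq nat) :=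
  K s (fun x => `|xi s x| ^+ 3).

(** Each increment is added along the direction of its step. The directions used later are the unit
    vectors of the blocks of time, so that the coordinates become block sums. *)
Fixpoint vpath (dir : nat -> nat -> R) (xi : seq nat -> nat -> R) (s : seq nat) :
    nat -> R :=
  if s is x :: s' then vadd (vpath dir xi s') (xi s' x) (dir (size s'))
  else fun=> 0.

Variables (dir : nat -> nat -> R) (c : R).
Variables (K1 K2 : kern R) (xi1 xi2 : seq nat -> nat -> R).
Hypothesis K2size : forall s s' g, size s = size s' -> K2 s g = K2 s' g.
Hypothesis xi2size : forall s s', size s = size s' -> xi2 s = xi2 s'.

(* The conditional expectation of [f] when the increments from time [k] on are
   replaced by those of the second, history-independent, kernel. *)
Fixpoint remaining (f : (nat -> R) -> R) (n k : nat) (y : nat -> R) : R :=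
  if n is n'.+1 then
    K2 (nseq k 0%N) (fun x => remaining f n' k.+1 (vadd y (xi2 (nseq k 0%N) x) (dir k)))
  else f y.

Lemma EE_remaining f n s :
  EE K2 n s (fun l => f (vpath dir xi2 l)) = remaining f n (size s) (vpath dir xi2 s).
Proof.
elim: n s => [//|n IH] s /=.
have ss : size s = size (nseq (size s) 0%N) by rewrite size_nseq.
rewrite (K2size _ ss); apply: eq_kop => x _.
by rewrite IH /= (xi2size ss).
Qed.

(** The derivative data of f are averaged over the remaining increments. Averaging is linear and
    contracting, so the constant c does not grow with n. *)
Lemma smooth_remaining f n k : smooth dir c f -> smooth dir c (remaining f n k).
Proof.
move=> sf; elim: n k => [//|n IH] k j /=.
set s := nseq k 0%N.
have [a [b ab]] := IH k.+1 j.
exists (fun y => K2 s (fun x => a (vadd y (xi2 s x) (dir k)))).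
exists (fun y => K2 s (fun x => b (vadd y (xi2 s x) (dir k)))).
move=> y; split.
- apply: le_trans (kop_abs _ _ _) _; rewrite -[leRHS](kop_cst K2 s).
  by apply: kop_mono => x _; have [] := ab (vadd y (xi2 s x) (dir k)).
- apply: le_trans (kop_abs _ _ _) _; rewrite -[leRHS](kop_cst K2 s).
  by apply: kop_mono => x _; have [] := ab (vadd y (xi2 s x) (dir k)).
- move=> t.
  rewrite -!mulrA -[X in _ - X - _]mulrC -[X in _ - _ - X]mulrC -!kopZ -!kopB.
  apply: le_trans (kop_abs _ _ _) _; rewrite -[leRHS](kop_cst K2 s).
  apply: kop_mono => x _; have [_ _ /(_ t)] := ab (vadd y (xi2 s x) (dir k)).
  rewrite vaddC; apply: le_trans.
  by rewrite le_eqVlt; apply/orP; left; apply/eqP; congr (`|_|); ring.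
Qed.

Definition swap_err (s : seq nat) : R :=
  c * (`|moment K1 xi1 1 s - moment K2 xi2 1 s|
       + `|moment K1 xi1 2 s - moment K2 xi2 2 s|
       + (absmoment3 K1 xi1 s + absmoment3 K2 xi2 s)).

Fixpoint total_err (s : seq nat) : R :=
  if s is _ :: s' then total_err s' + swap_err s' else 0.

(** Both averages equal the same second-order expansion about y up to third absolute moments; the
    expansions then differ only through the first two moments. *)
Lemma swap_one f y s : smooth dir c f ->
  `|K1 s (fun x => f (vadd y (xi1 s x) (dir (size s))))
    - K2 s (fun x => f (vadd y (xi2 s x) (dir (size s))))| <= swap_err s.
Proof.
move=> /(_ (size s))[a [b /(_ y)[ay byy T]]].
have c0 : 0 <= c by apply: le_trans ay.
have one (K : kern R) xi :
   `|K s (fun x => f (vadd y (xi s x) (dir (size s))))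
     - (f y + a y * moment K xi 1 s + b y / 2 * moment K xi 2 s)|
   <= c * absmoment3 K xi s.
  rewrite -[X in X + _ + _](kop_cst K s) /moment /absmoment3 -!kopZ -!kopD -kopB.
  apply: le_trans (kop_abs _ _ _) _; apply: kop_mono => x _.
  apply: le_trans (T (xi s x)); rewrite expr1.
  by rewrite le_eqVlt; apply/orP; left; apply/eqP; congr (`|_|); ring.
have := one K1 xi1; have := one K2 xi2.
rewrite /swap_err.
set A1 := K1 s _; set A2 := K2 s _.
set m1 := moment K1 xi1 1 s; set m2 := moment K2 xi2 1 s.
set v1 := moment K1 xi1 2 s; set v2 := moment K2 xi2 2 s.
move=> h2 h1.
have hm : `|a y * (m1 - m2)| <= c * `|m1 - m2|.
  by rewrite normrM ler_wpM2r.
have hv : `|b y / 2 * (v1 - v2)| <= c * `|v1 - v2|.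
  rewrite normrM ler_wpM2r// normrM normfV (ger0_norm (ler0n _ 2)).
  apply: le_trans byy; rewrite ler_pdivrMr//.
  by rewrite ler_peMr//; lra.
rewrite (_ : A1 - A2 = (A1 - (f y + a y * m1 + b y / 2 * v1))
   - (A2 - (f y + a y * m2 + b y / 2 * v2)) + a y * (m1 - m2)
   + b y / 2 * (v1 - v2)); last by ring.
apply: le_trans (ler_normD _ _) _.
apply: le_trans (lerD (ler_normD _ _) hv) _.
apply: le_trans (lerD (lerD (ler_normB _ _) hm) (lexx _)) _.
by rewrite !mulrDr; lra.
Qed.

(** The right-hand side is the expected error of the n steps still to come. In this form the
    induction closes: averaging over the next entry leaves exactly the one swap at the current
    step. *)
Lemma lindeberg f n s : smooth dir c f ->
  `|EE K1 n s (fun l => f (vpath dir xi1 l))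
    - remaining f n (size s) (vpath dir xi1 s)|
  <= EE K1 n s total_err - total_err s.
Proof.
move=> sf; elim: n s => [|n IH] s /=; first by rewrite !subrr normr0.
set A := K1 s _; set B := K2 _ _; set y := vpath dir xi1 s.
pose M := K1 s (fun x => remaining f n (size s).+1 (vadd y (xi1 s x) (dir (size s)))).
rewrite (_ : A - B = (A - M) + (M - B)); last by ring.
apply: le_trans (ler_normD _ _) _.
have h1 : `|A - M| <= K1 s (fun x => EE K1 n (x :: s) total_err)
                       - (total_err s + swap_err s).
  rewrite /A /M -kopB; apply: le_trans (kop_abs _ _ _) _.
  rewrite -[X in _ - X](kop_cst K1 s) -kopB.
  by apply: kop_mono => x _; exact: (IH (x :: s)).
have h2 : `|M - B| <= swap_err s.
  have ss : size (nseq (size s) 0%N) = size s by rewrite size_nseq.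
  rewrite /B (xi2size ss) (K2size _ ss).
  exact: swap_one (smooth_remaining n (size s).+1 sf).
by move: h1 h2; lra.
Qed.

End Lindeberg.

(** * Smoothing by cubic splines *)

Section Spline.
Context {R : realFieldType}.
Implicit Types (x t y : R).

Definition pos x : R := Num.max x 0.

(* The cubic B-spline with knots -2, ..., 2, written with truncated powers. *)
Definition bspline x : R :=
  (pos (x + 2) ^+ 3 - 4 * pos (x + 1) ^+ 3 + 6 * pos x ^+ 3
   - 4 * pos (x - 1) ^+ 3 + pos (x - 2) ^+ 3) / 6.

(** A smooth step from 0 (for x <= -2) to 1 (for x >= 1), the running sum of shifted B-splines; sums
    of B-splines telescope through it. *)
Definition sstep x : R :=
  (pos (x + 2) ^+ 3 - 3 * pos (x + 1) ^+ 3 + 3 * pos x ^+ 3 - pos (x - 1) ^+ 3) / 6.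

Lemma bspline_sstep x : bspline x = sstep x - sstep (x - 1).
Proof.
rewrite /bspline /sstep (_ : x - 1 + 2 = x + 1); last by ring.
rewrite (_ : x - 1 + 1 = x); last by ring.
rewrite (_ : x - 1 - 1 = x - 2); last by ring.
by ring.
Qed.

Lemma pos_ge x : 0 <= x -> pos x = x. Proof. by move=> x0; rewrite /pos max_l. Qed.
Lemma pos_le x : x <= 0 -> pos x = 0. Proof. by move=> x0; rewrite /pos max_r. Qed.

Lemma sstep1 x : 1 <= x -> sstep x = 1.
Proof.
move=> x1; by rewrite /sstep !pos_ge; try lra; field.
Qed.

Lemma sstep0 x : x <= -2 -> sstep x = 0.
Proof. by move=> x1; rewrite /sstep !pos_le; try lra; ring. Qed.

Lemma bspline0 x : 2 <= `|x| -> bspline x = 0.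
Proof.
rewrite ler_normr => /orP[x2|x2]; rewrite bspline_sstep.
  by rewrite !sstep1 ?subrr//; lra.
by rewrite !sstep0 ?subrr//; lra.
Qed.

Lemma bspline_ge0 x : 0 <= bspline x.
Proof.
rewrite /bspline; apply: mulr_ge0; last by rewrite invr_ge0; lra.
have [h1|h1] := lerP x (-2); first by rewrite !pos_le; try lra; rewrite expr0n; lra.
have [h2|h2] := lerP x (-1).
  rewrite (@pos_ge (x + 2)); last by lra.
  rewrite !pos_le; try lra; rewrite expr0n /=.
  have := exprn_ge0 3 (_ : 0 <= x + 2); lra.
have [h3|h3] := lerP x 0.
  rewrite (@pos_ge (x + 2)) ?(@pos_ge (x + 1)); try lra.
  rewrite !pos_le; try lra; rewrite expr0n /=.
  have -> : (x + 2) ^+ 3 - 4 * (x + 1) ^+ 3 + 6 * 0 - 4 * 0 + 0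
    = 1 + 3 * ((1 + x) * (- x) * (1 + x)) + 3 * (1 + x) by ring.
  have : 0 <= (1 + x) * (- x) * (1 + x) by rewrite !mulr_ge0//; lra.
  lra.
have [h4|h4] := lerP x 1.
  rewrite (@pos_ge (x + 2)) ?(@pos_ge (x + 1)) ?(@pos_ge x); try lra.
  rewrite !pos_le; try lra; rewrite expr0n /=.
  have -> : (x + 2) ^+ 3 - 4 * (x + 1) ^+ 3 + 6 * x ^+ 3 - 4 * 0 + 0
    = 1 + 3 * ((1 - x) * x * (1 - x)) + 3 * (1 - x) by ring.
  have : 0 <= (1 - x) * x * (1 - x) by rewrite !mulr_ge0//; lra.
  lra.
have [h5|h5] := lerP x 2.
  rewrite (@pos_ge (x + 2)) ?(@pos_ge (x + 1)) ?(@pos_ge x) ?(@pos_ge (x - 1)); try lra.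
  rewrite !pos_le; try lra; rewrite expr0n /=.
  have -> : (x + 2) ^+ 3 - 4 * (x + 1) ^+ 3 + 6 * x ^+ 3 - 4 * (x - 1) ^+ 3 + 0
    = (2 - x) ^+ 3 by ring.
  by apply: exprn_ge0; lra.
by rewrite !pos_ge; lra.
Qed.

Lemma sum_bspline (M : nat) x : `|x| + 2 <= M%:R ->
  \sum_(z < (M + M).+1) bspline (x + M%:R - z%:R) = 1.
Proof.
move=> xM.
transitivity (sstep (x + M%:R) - sstep (x + M%:R - (M + M).+1%:R)).
  elim: (M + M).+1 => [|n IH]; first by rewrite big_ord0 subr0 subrr.
  rewrite big_ord_recr /= IH bspline_sstep -natr1.
  rewrite (_ : x + M%:R - n%:R - 1 = x + M%:R - (n%:R + 1)); last by ring.
  by ring.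
have := ler_norm x; have := ler_norm (- x); rewrite normrN => ? ?.
rewrite sstep1 ?sstep0 ?subr0//; last by lra.
by rewrite -natr1 natrD; lra.
Qed.

(** The second derivative 6 x_+ of x_+^3 is Lipschitz with constant 6, so the Taylor remainder is at
    most |t|^3. *)
Lemma pos_taylor x t :
  `|pos (x + t) ^+ 3 - pos x ^+ 3 - (3 * pos x ^+ 2) * t - (6 * pos x) * t ^+ 2 / 2|
   <= `|t| ^+ 3.
Proof.
have [a|a] := lerP 0 x; have [b|b] := lerP 0 (x + t).
- rewrite (pos_ge a) (pos_ge b) -normrX.
  by rewrite le_eqVlt; apply/orP; left; apply/eqP; congr (`|_|); field.
- rewrite (pos_ge a) (pos_le (ltW b)) expr0n /=.
  have t0 : t < 0 by lra.
  rewrite (ltr0_norm t0).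
  have -> : 0 - x ^+ 3 - 3 * x ^+ 2 * t - 6 * x * t ^+ 2 / 2
     = - ((- t) ^+ 3 - (- (x + t)) ^+ 3) by field.
  have h1 : 0 <= (- (x + t)) ^+ 3 by rewrite exprn_ge0; lra.
  have h2 : (- (x + t)) ^+ 3 <= (- t) ^+ 3 by rewrite lerXn2r ?nnegrE; lra.
  by rewrite normrN ger0_norm; lra.
- rewrite (pos_le (ltW a)) (pos_ge b) expr0n /=.
  have t0 : 0 < t by lra.
  rewrite (gtr0_norm t0) expr0n /= !mulr0 !mul0r !subr0.
  by rewrite ger0_norm ?exprn_ge0// lerXn2r ?nnegrE; lra.
- by rewrite (pos_le (ltW a)) (pos_le (ltW b)) !expr0n /= !mulr0 !mul0r !subr0 normr0 exprn_ge0.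
Qed.

Lemma pos_bound x : `|x| <= 2 -> forall d, `|d| <= 2 -> 0 <= pos (x + d) <= 4.
Proof.
rewrite ler_norml => /andP[x1 x2] d; rewrite ler_norml => /andP[d1 d2].
have [h|/ltW h] := lerP 0 (x + d); rewrite ?(pos_ge h) ?(pos_le h); lra.
Qed.

Lemma bspline_taylor : exists c, exists a b : R -> R, forall x,
  [/\ `|a x| <= c, `|b x| <= c
    & forall t, `|bspline (x + t) - bspline x - a x * t - b x * t ^+ 2 / 2|
         <= c * `|t| ^+ 3].
Proof.
pose a x : R := (pos (x + 2) ^+ 2 - 4 * pos (x + 1) ^+ 2 + 6 * pos x ^+ 2
   - 4 * pos (x - 1) ^+ 2 + pos (x - 2) ^+ 2) / 2.
pose b x : R := pos (x + 2) - 4 * pos (x + 1) + 6 * pos x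
   - 4 * pos (x - 1) + pos (x - 2).
have ab0 x : 2 <= `|x| -> a x = 0 /\ b x = 0.
  rewrite ler_normr /a /b => /orP[x2|x2].
    by rewrite !pos_ge; try lra; split; field.
  by rewrite !pos_le; try lra; rewrite ?expr0n /=; split; lra.
(* For |x| <= 2 each truncated term is at most 4; the coefficients 1, 4, 6, 4, 1 sum to 16, so |a|
   <= 16 * 16 / 2 = 128. For |x| >= 2 the truncated powers cancel. *)
exists 128, a, b => x; split.
- have [x2|/ltW/pos_bound pb] := leP 2 `|x|; first by rewrite (ab0 _ x2).1 normr0; lra.
  have sq y : 0 <= y <= 4 -> 0 <= y ^+ 2 <= (16 : R).
    move=> /andP[y0 y4]; rewrite exprn_ge0//= (_ : (16 : R) = 4 ^+ 2); last by ring.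
    by rewrite lerXn2r ?nnegrE//; lra.
  have /sq/andP[? ?] : 0 <= pos (x + 2) <= 4 by apply: pb; rewrite ger0_norm; lra.
  have /sq/andP[? ?] : 0 <= pos (x + 1) <= 4 by apply: pb; rewrite ger0_norm; lra.
  have /sq/andP[? ?] : 0 <= pos x <= 4 by rewrite -[x]addr0; apply: pb; rewrite normr0; lra.
  have /sq/andP[? ?] : 0 <= pos (x - 1) <= 4 by apply: pb; rewrite normrN ger0_norm; lra.
  have /sq/andP[? ?] : 0 <= pos (x - 2) <= 4 by apply: pb; rewrite normrN ger0_norm; lra.
  by rewrite ler_norml /a; apply/andP; split; lra.
- have [x2|/ltW/pos_bound pb] := leP 2 `|x|; first by rewrite (ab0 _ x2).2 normr0; lra.
  have /andP[? ?] : 0 <= pos (x + 2) <= 4 by apply: pb; rewrite ger0_norm; lra.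
  have /andP[? ?] : 0 <= pos (x + 1) <= 4 by apply: pb; rewrite ger0_norm; lra.
  have /andP[? ?] : 0 <= pos x <= 4 by rewrite -[x]addr0; apply: pb; rewrite normr0; lra.
  have /andP[? ?] : 0 <= pos (x - 1) <= 4 by apply: pb; rewrite normrN ger0_norm; lra.
  have /andP[? ?] : 0 <= pos (x - 2) <= 4 by apply: pb; rewrite normrN ger0_norm; lra.
  by rewrite ler_norml /b; apply/andP; split; lra.
- move=> t; have tay d := pos_taylor (x + d) t.
  have := tay 2; have := tay 1; have := tay 0; have := tay (-1); have := tay (-2).
  rewrite !(addrAC x _ t) !addr0 !ler_norml /bspline /a /b.
  set u := `|t| ^+ 3; have u0 : 0 <= u by rewrite exprn_ge0.
  move=> /andP[? ?] /andP[? ?] /andP[? ?] /andP[? ?] /andP[? ?].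
  by apply/andP; split; lra.
Qed.

End Spline.

(** * Tensor-product spline approximation in finitely many variables *)

Section GridApprox.
Context {R : realType}.
Implicit Types (x t : R) (y : nat -> R).

Lemma sum_bspline_tel (m : nat) x :
  \sum_(z < m) bspline (x - z%:R) = sstep x - sstep (x - m%:R).
Proof.
elim: m => [|n IH]; first by rewrite big_ord0 subr0 subrr.
rewrite big_ord_recr /= IH bspline_sstep -natr1.
rewrite (_ : x - n%:R - 1 = x - (n%:R + 1)); last by ring.
by ring.
Qed.

(** Both [sstep x] and 1 - [sstep x] are finite sums of B-splines, hence nonnegative. *)
Lemma sstep_itv x : 0 <= sstep x <= 1.
Proof.
have up (y : R) : y < (Num.Def.truncn `|y|).+1%:R.
  by apply: le_lt_trans (ler_norm _) _; exact: truncnS_gt.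
apply/andP; split.
  pose m := (Num.Def.truncn `|x + 2|).+1.
  have := sum_bspline_tel m x; rewrite (sstep0 (x := x - m%:R)).
    by rewrite subr0 => <-; apply: sumr_ge0 => i _; exact: bspline_ge0.
  by have := up (x + 2); rewrite -/m; lra.
pose m := (Num.Def.truncn `|1 - x|).+1.
have := sum_bspline_tel m (x + m%:R); rewrite addrK (sstep1 (x := x + m%:R)).
  by move=> h; rewrite -subr_ge0 -h; apply: sumr_ge0 => i _; exact: bspline_ge0.
by have := up (1 - x); rewrite -/m; lra.
Qed.

Lemma bspline_le1 x : bspline x <= 1.
Proof.
by rewrite bspline_sstep; have /andP[_ ?] := sstep_itv x;
  have /andP[? _] := sstep_itv (x - 1); lra.
Qed.

Lemma sum_bspline_le1 m x : \sum_(z < m) bspline (x - z%:R) <= 1.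
Proof.
rewrite sum_bspline_tel; have /andP[_ ?] := sstep_itv x.
by have /andP[? _] := sstep_itv (x - m%:R); lra.
Qed.

Variables (d : nat) (H : (nat -> R) -> R).

(** Grid points of mesh 1/(n+1) then cover [-n, n] together with the supports of the splines: n (n +
    1) + 2 <= (n + 3)^2. *)
Definition gridM (n : nat) : nat := (n.+3 ^ 2)%N.

Definition gridpt (n : nat) (z : {ffun 'I_d -> 'I_(gridM n + gridM n).+1}) :
    nat -> R :=
  fun r => if insub r is Some i then ((z i)%:R - (gridM n)%:R) / n.+1%:R else 0.

Definition gridw (n : nat) y (z : {ffun 'I_d -> 'I_(gridM n + gridM n).+1}) : R :=
  \prod_(i < d) bspline (n.+1%:R * y i + (gridM n)%:R - (z i)%:R).

(** Spline quasi-interpolation: grid values of H weighted by products of B-splines. The sum is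
    finite, so it is smooth whatever H is. *)
Definition grid_approx (n : nat) y : R :=
  \sum_(z : {ffun 'I_d -> 'I_(gridM n + gridM n).+1}) H (gridpt z) * gridw y z.

Lemma gridw_ge0 n y z : 0 <= @gridw n y z.
Proof. by apply: prodr_ge0 => i _; exact: bspline_ge0. Qed.

Lemma sum_gridw n y : \sum_z @gridw n y z =
  \prod_(i < d) \sum_(z < (gridM n + gridM n).+1)
    bspline (n.+1%:R * y i + (gridM n)%:R - z%:R).
Proof. by rewrite bigA_distr_bigA. Qed.

Lemma sum_gridw_le1 n y : \sum_z @gridw n y z <= 1.
Proof.
rewrite sum_gridw; apply: prodr_ile1 => i _.
rewrite sum_bspline_le1 andbT.
by apply: sumr_ge0 => z _; exact: bspline_ge0.
Qed.

Lemma grid_approx_bound n y C : (forall y', `|H y'| <= C) -> `|grid_approx n y| <= C.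
Proof.
move=> HC; apply: le_trans (ler_norm_sum _ _ _) _.
apply: (@le_trans _ _ (\sum_z C * @gridw n y z)).
  apply: ler_sum => z _; rewrite normrM (ger0_norm (gridw_ge0 _ _)).
  by apply: ler_wpM2r => //; exact: gridw_ge0.
have C0 : 0 <= C by apply: le_trans (HC y).
by rewrite -mulr_sumr -[leRHS]mulr1; apply: ler_wpM2l => //; exact: sum_gridw_le1.
Qed.

Hypothesis Hext : forall y y', (forall r, (r < d)%N -> y r = y' r) -> H y = H y'.
Variable Lc : R.
Hypothesis Hlip : forall y y' e, 0 <= e -> (forall r, (r < d)%N -> `|y r - y' r| <= e) ->
  `|H y - H y'| <= Lc * e.

(** In the box the weights sum to 1, and a nonzero weight forces the grid point within 2/(n+1) of y
    in every coordinate. *)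
Lemma grid_approx_near n y : (forall r, (r < d)%N -> `|y r| <= n%:R) ->
  `|grid_approx n y - H y| <= Lc * (2 / n.+1%:R).
Proof.
move=> yn.
have n1 : 0 < n.+1%:R :> R by rewrite ltr0n.
have e0 : 0 <= 2 / n.+1%:R :> R by rewrite divr_ge0// ltW.
have one : \sum_z @gridw n y z = 1.
  rewrite sum_gridw big1// => i _; apply: sum_bspline.
  rewrite normrM (ger0_norm (ltW n1)).
  have h : `|y i| <= n%:R by exact: yn.
  apply: (@le_trans _ _ (n.+1%:R * n%:R + 2)).
    by rewrite lerD2r ler_wpM2l// ltW.
  by rewrite -[2]/(2%:R) -natrM -natrD ler_nat /gridM expnS expn1; lia.
have -> : H y = \sum_z H y * @gridw n y z by rewrite -mulr_sumr one mulr1.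
have -> : Lc * (2 / n.+1%:R) = \sum_z Lc * (2 / n.+1%:R) * @gridw n y z.
  by rewrite -mulr_sumr one mulr1.
rewrite -sumrB; apply: le_trans (ler_norm_sum _ _ _) _.
apply: ler_sum => z _.
rewrite -mulrBl normrM (ger0_norm (gridw_ge0 _ _)).
have [->|w0] := eqVneq (gridw y z) 0; first by rewrite !mulr0.
apply: ler_wpM2r; first exact: gridw_ge0.
apply: Hlip => // r rd.
rewrite /gridpt insubT /=.
have : bspline (n.+1%:R * y r + (gridM n)%:R - (z (Sub r rd))%:R) != 0.
  by move: w0; rewrite /gridw => /prodf_neq0 /(_ (Sub r rd) isT).
apply: contraNT; rewrite -ltNge => lt; apply/eqP; apply: bspline0.
rewrite (_ : _ - _ = - (((z (Sub r rd))%:R - (gridM n)%:R) / n.+1%:R - y r) * n.+1%:R).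
  rewrite normrM normrN (ger0_norm (ltW n1)) -ler_pdivrMr//; exact: ltW.
by field; rewrite (addrC 1) natr1 gt_eqF.
Qed.

(** The constant is fixed before [blk]: the assignment of steps to blocks varies with N, while the
    smoothness constant must not. Moving one coordinate varies a single factor of each product; the
    chain rule gives the cube of the inverse mesh. *)
Lemma grid_approx_smooth n :
  exists c, forall blk : nat -> nat, smooth (fun k r => (r == blk k)%:R) c (grid_approx n).
Proof.
have [c0 [a0 [b0 tay]]] := @bspline_taylor R.
have c00 : 0 <= c0 by have [h _ _] := tay 0; apply: le_trans h.
have n1 : 1 <= n.+1%:R :> R by rewrite ler1n.
set N := n.+1%:R : R in n1 *.
pose T := (\sum_z `|H (@gridpt n z)|) : R.
have T0 : 0 <= T by apply: sumr_ge0.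
exists (T * (c0 * N ^+ 3)) => blk k.
have NN1 : N <= N ^+ 3 by rewrite -[leLHS]expr1 ler_weXn2l.
have NN2 : N ^+ 2 <= N ^+ 3 by rewrite ler_weXn2l.
have c'0 : 0 <= T * (c0 * N ^+ 3) by rewrite !mulr_ge0// exprn_ge0//; lra.
(* A step assigned to no coordinate below d leaves the approximation unchanged. *)
have [jd|jd] := boolP (blk k < d)%N; last first.
  exists (fun=> 0), (fun=> 0) => y; rewrite normr0; split=> // t.
  have -> : grid_approx n (vadd y t (fun r => (r == blk k)%:R)) = grid_approx n y.
    apply: eq_bigr => z _; congr (_ * _); apply: eq_bigr => i _.
    rewrite /vadd (_ : (i : nat) == blk k = false) ?mulr0 ?addr0//.
    by apply/eqP => e; move: jd; rewrite -e ltn_ord.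
  by rewrite subrr !mul0r !subr0 normr0 mulr_ge0// exprn_ge0.
pose j := Ordinal jd.
pose w y (z : {ffun 'I_d -> 'I_(gridM n + gridM n).+1}) : R :=
  \prod_(i < d | i != j) bspline (N * y i + (gridM n)%:R - (z i)%:R).
pose X y (z : {ffun 'I_d -> 'I_(gridM n + gridM n).+1}) : R :=
  N * y j + (gridM n)%:R - (z j)%:R.
have w01 y z : `|w y z| <= 1.
  rewrite ger0_norm; last by apply: prodr_ge0 => i _; exact: bspline_ge0.
  by apply: prodr_ile1 => i _; rewrite bspline_ge0 bspline_le1.
exists (fun y => \sum_z H (gridpt z) * (w y z * (a0 (X y z) * N))).
exists (fun y => \sum_z H (gridpt z) * (w y z * (b0 (X y z) * N ^+ 2))).
have bnd (F : {ffun 'I_d -> 'I_(gridM n + gridM n).+1} -> R) y B : 0 <= B ->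
    (forall z, `|F z| <= B) ->
    `|\sum_z H (gridpt z) * (w y z * F z)| <= T * B.
  move=> B0 FB; apply: le_trans (ler_norm_sum _ _ _) _.
  rewrite /T mulr_suml; apply: ler_sum => z _.
  rewrite normrM ler_wpM2l// normrM -[leRHS]mul1r.
  by apply: ler_pM.
move=> y; split.
- apply: bnd => [|z]; first by rewrite mulr_ge0// exprn_ge0//; lra.
  rewrite normrM; apply: ler_pM => //; first by have [] := tay (X y z).
  by rewrite ger0_norm//; lra.
- apply: bnd => [|z]; first by rewrite mulr_ge0// exprn_ge0//; lra.
  rewrite normrM; apply: ler_pM => //; first by have [] := tay (X y z).
  by rewrite ger0_norm// exprn_ge0//; lra.
- move=> t; set e := (fun r => _).
  have gE y' : grid_approx n y' = \sum_z H (gridpt z) * (w y' z * bspline (X y' z)).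
    apply: eq_bigr => z _; congr (_ * _); rewrite /gridw (bigD1 j)//= mulrC.
    by congr (_ * _).
  have wE z : w (vadd y t e) z = w y z.
    apply: eq_bigr => i ij; rewrite /vadd /e (_ : (i : nat) == blk k = false).
      by rewrite mulr0 addr0.
    by apply: contraNF ij => /eqP ij; apply/eqP/val_inj.
  have XE z : X (vadd y t e) z = X y z + N * t.
    by rewrite /X /vadd /e /= eqxx mulr1; ring.
  rewrite (_ : T * _ * _ = T * (c0 * `|N * t| ^+ 3)); last first.
    by rewrite normrM exprMn (@ger0_norm _ N) ?mulrA//; lra.
  set rhs := T * _; rewrite !gE -!mulrA !mulr_suml -!sumrB.
  under eq_bigr do rewrite wE XE.
  rewrite (_ : \sum_ _ _ = \sum_z H (gridpt z) * (w y z *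
     (bspline (X y z + N * t) - bspline (X y z) - a0 (X y z) * (N * t)
      - b0 (X y z) * (N * t) ^+ 2 / 2))); last first.
    by apply: eq_bigr => z _; field.
  apply: bnd => [|z]; first by rewrite mulr_ge0// exprn_ge0.
  by have [_ _ /(_ (N * t))] := tay (X y z).
Qed.

End GridApprox.

(** * The walk as a martingale plus a drift *)

(* [Zmin], [Zlist] and [navail] are min Z, Z and the number of available
   vertices as functions of the list of numbers of children. *)
Fixpoint Zmin (s : seq nat) : int :=
  if s is x :: s' then
    Num.min (Zmin s') ((sumn (x :: s'))%:Z - (size (x :: s'))%:Z)
  else 0.

Definition Zlist (s : seq nat) : int := (sumn s)%:Z - (size s)%:Z.

Definition navail (N : nat) (s : seq nat) : nat :=
  trunc_nat (N%:Z - (size s)%:Z - Zlist s - (1 - Zmin s)).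

(* The history of length [i] of which [s] is an extension. *)
Definition pre (i : nat) (s : seq nat) : seq nat := drop (size s - i) s.

Lemma pre_cons i x s : (i <= size s)%N -> pre i (x :: s) = pre i s.
Proof. by move=> le; rewrite /pre /= subSn. Qed.

Lemma pre_id i s : (size s <= i)%N -> pre i s = s.
Proof. by rewrite /pre => le; rewrite (eqP le) drop0. Qed.

Lemma size_pre i s : (i <= size s)%N -> size (pre i s) = i.
Proof. by move=> le; rewrite size_drop subKn. Qed.

Lemma pre0 s : pre 0 s = [::].
Proof. by rewrite /pre subn0 drop_size. Qed.

Lemma pre_pre i j s : (i <= j)%N -> pre i (pre j s) = pre i s.
Proof.
move=> ij; have [js|js] := leqP j (size s); last by rewrite (pre_id (ltnW js)).
rewrite /pre size_drop drop_drop subKn//; congr drop; lia.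
Qed.

Lemma ever_pre (bad : pred (seq nat)) s i :
  (i <= size s)%N -> ~~ ever bad s -> ~~ bad (pre i s).
Proof.
elim: s => [|x s IH] /=; first by rewrite leqn0 => /eqP->; rewrite orbF.
rewrite leq_eqVlt negb_or => /orP[/eqP->|h] /andP[nb ne].
  by rewrite pre_id.
by rewrite pre_cons// IH.
Qed.

Lemma Zmin_le0 s : Zmin s <= 0.
Proof. by elim: s => //= x s IH; rewrite ge_min IH. Qed.

(** * Exponential inequalities for binomial variables *)

Section ExpIneq.
Context {R : realType}.

(** Use exp(-x) >= 1 - x and (1 + x + 2 x^2)(1 - x) = 1 + x^2 (1 - 2x) >= 1. *)
Lemma expR_quad_bound (x : R) : x <= 1 / 2 -> expR x <= 1 + x + 2 * x ^+ 2.
Proof.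
move=> x1; have h : 1 - x <= expR (- x) by apply: le_trans (expR_ge1Dx _).
have x0 : 0 < 1 - x by lra.
have : (1 + x + 2 * x ^+ 2) * (1 - x) >= 1.
  have -> : (1 + x + 2 * x ^+ 2) * (1 - x) = 1 + x ^+ 2 * (1 - 2 * x) by ring.
  by rewrite lerDl mulr_ge0 ?sqr_ge0//; lra.
have p0 : 0 <= 1 + x + 2 * x ^+ 2.
  have -> : 1 + x + 2 * x ^+ 2 = (1 + x) ^+ 2 / 2 + (1 + 3 * x ^+ 2) / 2 by field.
  by have := sqr_ge0 (1 + x); have := sqr_ge0 x; lra.
move=> h1.
have h2 : 1 <= (1 + x + 2 * x ^+ 2) * expR (- x).
  by apply: le_trans h1 _; rewrite ler_wpM2l.
have := ler_wpM2l (expR_ge0 x) h2.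
by rewrite mulr1 mulrCA -expRD subrr expR0 mulr1.
Qed.

(** For y >= 0, cube y/6 <= exp(y/6); the constant is 6^3. *)
Lemma cube_le_expR (x : R) : `|x| ^+ 3 <= 216 * (expR (x / 2) + expR (- (x / 2))).
Proof.
have pos (y : R) : 0 <= y -> y ^+ 3 <= 216 * expR (y / 2).
  move=> y0.
  have -> : y / 2 = y / 6 + y / 6 + y / 6 by field.
  rewrite !expRD.
  have h : y / 6 <= expR (y / 6) by apply: le_trans (expR_ge1Dx _); lra.
  have y60 : 0 <= y / 6 by lra.
  have -> : y ^+ 3 = 216 * (y / 6 * (y / 6) * (y / 6)) by field.
  by rewrite ler_wpM2l// !ler_pM// ?mulr_ge0.
have [x0|/ltW x0] := lerP 0 x.
  rewrite ger0_norm//; apply: le_trans (pos _ x0) _.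
  by rewrite ler_wpM2l// lerDl expR_ge0.
have nx : 0 <= - x by lra.
rewrite ler0_norm//; apply: le_trans (pos _ nx) _.
by rewrite ler_wpM2l// mulNr lerDr expR_ge0.
Qed.

(** One trial gives 1 - p + p exp(eta) <= exp(p (eta + 2 eta^2)), whose linear part is cancelled by
    the centring. *)
Lemma binE_mgf (p : R) n (eta : R) : 0 <= p <= 1 -> eta <= 1 / 2 ->
  binE p n (fun x => expR (eta * (x%:R - p * n%:R))) <= expR (2 * n%:R * p * eta ^+ 2).
Proof.
move=> /andP[p0 p1] eta1.
rewrite (@eq_binE _ _ _ _ (fun x => expR (- (eta * (p * n%:R))) * expR eta ^+ x + 0)).
  rewrite binE_lin binE_cst addr0 binE_exp.
  have h : 1 - p + p * expR eta <= expR (p * (eta + 2 * eta ^+ 2)).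
    apply: le_trans (expR_ge1Dx _); have := expR_quad_bound eta1.
    move=> /(ler_wpM2l p0); lra.
  have h0 : 0 <= 1 - p + p * expR eta.
    by rewrite addr_ge0 ?mulr_ge0 ?expR_ge0//; lra.
  have hn : (1 - p + p * expR eta) ^+ n <= expR (p * (eta + 2 * eta ^+ 2)) ^+ n.
    by rewrite lerXn2r ?nnegrE ?expR_ge0.
  apply: le_trans (ler_wpM2l (expR_ge0 _) hn) _.
  rewrite -expRM_natr -expRD ler_expR le_eqVlt; apply/orP; left; apply/eqP; ring.
move=> x; rewrite addr0 -expRM_natr -expRD; congr expR; ring.
Qed.

End ExpIneq.

(** * The kernel of the walk, its martingale, the patches and a maximal inequality *)

Section Walk.
Context {R : realType} (N : nat) (lam : nat -> R).
Hypothesis lam0 : forall m, 0 <= lam m.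

(** The probability that an exponential variable of rate [lam m] is at most 1, that is, that a given
    vertex becomes a child. *)
Definition pm m : R := 1 - expR (- lam m).
Definition Lam m : R := \sum_(l < m) lam l.
Definition Am m : R := expR (Lam m).

Lemma pm01 m : 0 <= pm m <= 1.
Proof.
rewrite /pm; have := expR_ge0 (- lam m).
have : expR (- lam m) <= 1 by rewrite -expR0 ler_expR oppr_le0.
lra.
Qed.

Lemma pm_le m : pm m <= lam m.
Proof. by rewrite /pm; have := expR_ge1Dx (- lam m); lra. Qed.

Lemma Am_gt0 m : 0 < Am m. Proof. exact: expR_gt0. Qed.

Lemma AmS m : Am m.+1 * (1 - pm m) = Am m.
Proof.
rewrite /pm opprB addrCA subrr addr0 /Am -expRD /Lam big_ord_recr /=.
by rewrite addrK.
Qed.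

Lemma Am_le i j : (i <= j)%N -> Am i <= Am j.
Proof.
move=> ij; rewrite ler_expR /Lam -(subnK ij) addnC big_split_ord /=.
by rewrite lerDl sumr_ge0.
Qed.

Lemma Am_ge1 i : 1 <= Am i.
Proof. by have := Am_le (leq0n i); rewrite {1}/Am /Lam big_ord0 expR0. Qed.

Let walk_lin s a (g h : nat -> R) :
  binE (pm (size s)) (navail N s) (fun x => a * g x + h x)
  = a * binE (pm (size s)) (navail N s) g + binE (pm (size s)) (navail N s) h.
Proof. exact: binE_lin. Qed.

Let walk_mono (s : seq nat) (g h : nat -> R) :
  (forall x, (x <= navail N s)%N -> g x <= h x) ->
  binE (pm (size s)) (navail N s) g <= binE (pm (size s)) (navail N s) h.
Proof. exact: binE_mono (pm01 _). Qed.

Let walk_cst (s : seq nat) (c : R) :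
  binE (pm (size s)) (navail N s) (fun=> c) = c.
Proof. exact: binE_cst. Qed.

(** That the actual numbers of children follow this kernel is [childX_law]. *)
Definition walkK : kern R := Kern walk_lin walk_mono walk_cst.

(** The truncation at 0 in [navail] does not act. If the last step left the minimum of Z unchanged,
    it took at most [navail] vertices; if it set a new minimum, the count is N minus the length
    minus 1. *)
Lemma navailE s : valid walkK s -> (size s < N)%N ->
  (navail N s)%:Z = N%:Z - (sumn s)%:Z - (1 - Zmin s).
Proof.
have -> : N%:Z - (sumn s)%:Z - (1 - Zmin s)
  = N%:Z - (size s)%:Z - Zlist s - (1 - Zmin s) by rewrite /Zlist; ring.
rewrite /navail /trunc_nat.
suff : valid walkK s -> (size s < N)%N ->
   0 <= N%:Z - (size s)%:Z - Zlist s - (1 - Zmin s).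
  by move=> H v /(H v) h; rewrite ltNge h /= gez0_abs.
elim: s => [|x s IH] /=; first by rewrite /Zlist /=; lia.
move=> /andP[xs vs] sN.
have {}IH := IH vs (ltnW sN).
move: xs; rewrite /navail /trunc_nat ltNge IH /= => xs.
have {}xs : x%:Z <= N%:Z - (size s)%:Z - Zlist s - (1 - Zmin s) by lia.
by move: xs IH; rewrite /Zlist /=; lia.
Qed.

Definition Pl s : R := (1 - Zmin s)%:~R.

Lemma navailR s : valid walkK s -> (size s < N)%N ->
  (navail N s)%:R = N%:R - (sumn s)%:R - Pl s.
Proof.
move=> vs sN; rewrite -[LHS]/((navail N s)%:Z%:~R) navailE//.
by rewrite /Pl !rmorphB.
Qed.

Lemma navail_le s : valid walkK s -> (size s < N)%N -> (navail N s <= N)%N.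
Proof. by move=> vs sN; have := navailE vs sN; have := Zmin_le0 s; lia. Qed.

Lemma Pl_ge1 s : 1 <= Pl s.
Proof. by rewrite /Pl (_ : 1 = 1%:~R)// ler_int; have := Zmin_le0 s; lia. Qed.

Lemma Pl_cons x s : Pl (x :: s) = Num.max (Pl s) (1 - (Zlist (x :: s))%:~R).
Proof.
have e (a : int) : (1 - a)%:~R = 1 - a%:~R :> R by rewrite rmorphB.
have le (a b : int) : a <= b -> 1 - b%:~R <= 1 - a%:~R :> R.
  by rewrite lerD2l lerN2 ler_int.
rewrite /Pl /= -/(Zlist (x :: s)) !e.
have /orP[h|h] := le_total (Zmin s) (Zlist (x :: s)).
  by rewrite min_l// max_l//; exact: le.
by rewrite min_r// max_r//; exact: le.
Qed.

Lemma Pl_mono x s : Pl s <= Pl (x :: s).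
Proof. by rewrite Pl_cons le_max lexx. Qed.

(* Since a child is born with probability [pm], the number U of unnumbered
   vertices contracts by 1 - pm = Am m / Am m.+1 at each step, up to the
   patches; so Am * U is a martingale up to the drift [Dl], and [xi], [Ql] are
   its normalized increments and sum. *)
Definition xi (s : seq nat) (x : nat) : R :=
  Am (size s).+1 * (x%:R - pm (size s) * (navail N s)%:R) / Num.sqrt N%:R.

Fixpoint Ql (s : seq nat) : R := if s is x :: s' then Ql s' + xi s' x else 0.

Fixpoint Dl (s : seq nat) : R :=
  if s is _ :: s' then Dl s' + (Am (size s').+1 - Am (size s')) * Pl s' else 0.

Hypothesis N0 : (0 < N)%N.

Lemma sqrtN0 : 0 < Num.sqrt N%:R :> R.
Proof. by rewrite sqrtr_gt0 ltr0n. Qed.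

(** N minus [sumn s] counts the unnumbered vertices together with the patches [Pl], while only the
    former can become children; this discrepancy accumulates in [Dl]. *)
Lemma walk_identity s : valid walkK s -> (size s <= N)%N ->
  N%:R - Am (size s) * (N%:R - (sumn s)%:R) = Num.sqrt N%:R * Ql s - Dl s.
Proof.
elim: s => [|x s IH] /=.
  by move=> _ _; rewrite /Am /Lam big_ord0 expR0; ring.
move=> /andP[_ vs] sN; have {IH} := IH vs (ltnW sN).
have := navailR vs sN; rewrite /xi => -> IH.
have hx (y : R) : Num.sqrt N%:R * (y / Num.sqrt N%:R) = y.
  by rewrite mulrC divfK ?gt_eqF ?sqrtN0.
rewrite [Num.sqrt _ * (_ + _)]mulrDr hx natrD.
move: IH; rewrite -(AmS (size s)) => IH.
rewrite (_ : Num.sqrt N%:R * Ql s = N%:R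
    - Am (size s).+1 * (1 - pm (size s)) * (N%:R - (sumn s)%:R) + Dl s).
  by ring.
by rewrite IH; ring.
Qed.

Lemma Dl_ge0 s : 0 <= Dl s.
Proof.
elim: s => [|x s IH] //=; rewrite addr_ge0// mulr_ge0//.
  by rewrite subr_ge0 Am_le.
by apply: le_trans (Pl_ge1 s).
Qed.

(** [Pl] is nondecreasing along the history, so its last value can be taken out of the sum of
    increments of [Am]. *)
Lemma Dl_le s : Dl s <= (Am (size s) - 1) * Pl s.
Proof.
elim: s => [|x s IH].
  by rewrite /= mulr_ge0 ?subr_ge0 ?Am_ge1// /Pl /=.
have : (Am (size s).+1 - 1) * Pl s <= (Am (size s).+1 - 1) * Pl (x :: s).
  by rewrite ler_wpM2l ?Pl_mono// subr_ge0 Am_ge1.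
by move=> h; apply: le_trans h => /=; lra.
Qed.

Lemma Zlist_formula s : valid walkK s -> (size s <= N)%N ->
  (Zlist s)%:~R = N%:R - (size s)%:R - N%:R / Am (size s)
    + (Num.sqrt N%:R * Ql s - Dl s) / Am (size s).
Proof.
move=> vs sN; rewrite -(walk_identity vs sN) /Zlist rmorphB /=.
rewrite mulrBl mulrAC divff ?gt_eqF ?Am_gt0// -!pmulrn; ring.
Qed.

(** Patches feed back on themselves through the drift. A new minimum gives P = 1 - Z <= 1 + q + D/A,
    and D <= (A - 1) b if earlier patches are at most b. The value b = Amax (1 + q) closes the loop,
    because 1 + q + (1 - 1/A) b <= b for A <= Amax. *)
Lemma Pl_le (Amax q : R) s : valid walkK s -> (size s <= N)%N -> 0 <= q ->
  Am (size s) <= Amax ->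
  (forall i, (i <= size s)%N ->
     - (N%:R - i%:R - N%:R / Am i) - Num.sqrt N%:R * Ql (pre i s) / Am i <= q) ->
  Pl s <= Amax * (1 + q).
Proof.
move=> vs sN q0 sA hq.
have A1 : 1 <= Amax by apply: le_trans (Am_ge1 _) sA.
have base : 1 <= Amax * (1 + q).
  by rewrite -[leLHS]mulr1 ler_pM//; lra.
elim: s vs sN sA hq => [|x s IH] vs sN sA hq; first by rewrite /Pl /=.
have vs' : valid walkK s by case/andP: vs.
have {}IH : Pl s <= Amax * (1 + q).
  apply: IH => //; first exact: ltnW.
    by apply: le_trans sA; rewrite Am_le.
  by move=> i is_; rewrite -(pre_cons x)//; apply: hq; rewrite leqW.
rewrite Pl_cons ge_max IH /=.
have := hq _ (leqnn _); rewrite pre_id// => {}hq.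
rewrite (Zlist_formula vs sN).
set A := Am _ in hq sA *.
have A1' : 1 <= A by exact: Am_ge1.
have A0 : 0 < A by lra.
(* The drift only sees the patches of earlier histories, so the induction hypothesis bounds it. *)
have hD : Dl (x :: s) <= (A - 1) * (Amax * (1 + q)).
  have h1 : (Am (size s).+1 - Am (size s)) * Pl s
        <= (Am (size s).+1 - Am (size s)) * (Amax * (1 + q)).
    by rewrite ler_wpM2l ?subr_ge0 ?Am_le.
  have h2 : (Am (size s) - 1) * Pl s <= (Am (size s) - 1) * (Amax * (1 + q)).
    by rewrite ler_wpM2l ?subr_ge0 ?Am_ge1.
  by have := Dl_le s; rewrite /A /=; lra.
rewrite mulrBl.
have hD' : Dl (x :: s) / A <= Amax * (1 + q) - Amax * (1 + q) / A.
  rewrite ler_pdivrMr// mulrBl divfK ?gt_eqF//.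
  by apply: le_trans hD _; lra.
have : 1 + q <= Amax * (1 + q) / A.
  rewrite ler_pdivlMr// mulrC ler_wpM2r//; lra.
by lra.
Qed.

Lemma xi_mean s : walkK s (xi s) = 0.
Proof.
rewrite /= /xi.
rewrite (@eq_binE _ _ _ _ (fun x => Am (size s).+1 / Num.sqrt N%:R *
   (x%:R - pm (size s) * (navail N s)%:R) + 0)); last by move=> x; ring.
by rewrite binE_lin binE_mean binE_cst; ring.
Qed.

Lemma xi_var s : moment walkK xi 2 s =
  Am (size s).+1 ^+ 2 / N%:R * ((navail N s)%:R * pm (size s) * (1 - pm (size s))).
Proof.
rewrite /moment /= /xi.
rewrite (@eq_binE _ _ _ _ (fun x => Am (size s).+1 ^+ 2 / N%:R *
   (x%:R - pm (size s) * (navail N s)%:R) ^+ 2 + 0)); last first.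
  move=> x; rewrite addr0 !exprMn exprVn sqr_sqrtr ?ler0n//; ring.
rewrite binE_lin binE_var binE_cst; ring.
Qed.

Variables (c0 Amax : R) (L : nat).
Hypothesis LN : (L <= N)%N.
Hypothesis lamc : forall m, (m < L)%N -> lam m <= c0 / N%:R.
Hypothesis AmL : Am L <= Amax.

Lemma c0_ge0 : (0 < L)%N -> 0 <= c0.
Proof.
by move=> L0; have := le_trans (lam0 0) (lamc L0); rewrite pmulr_lge0// invr_gt0 ltr0n.
Qed.

Lemma np_le s : valid walkK s -> (size s < L)%N ->
  (navail N s)%:R * pm (size s) <= c0.
Proof.
move=> vs sL.
have NR : 0 < N%:R :> R by rewrite ltr0n.
apply: (@le_trans _ _ (N%:R * (c0 / N%:R))); last by rewrite mulrC divfK ?gt_eqF.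
apply: ler_pM => //; first by case/andP: (pm01 (size s)).
  by rewrite ler_nat navail_le//; apply: leq_trans LN.
by apply: le_trans (pm_le _) (lamc sL).
Qed.

(** [cube_le_expR] followed by [binE_mgf] at +1/2 and -1/2: the mean number of children is at most
    c0, so each exponential moment is at most exp(c0), and 432 = 2 * 216. *)
Lemma xi_third s : valid walkK s -> (size s < L)%N ->
  absmoment3 walkK xi s <= 432 * Amax ^+ 3 * expR c0 / (N%:R * Num.sqrt N%:R).
Proof.
move=> vs sL; have sN := sqrtN0.
have A0 := Am_gt0 (size s).+1.
have AA : Am (size s).+1 <= Amax by apply: le_trans AmL; rewrite Am_le.
have NR : 0 < N%:R :> R by rewrite ltr0n.
have sq3 : Num.sqrt N%:R ^+ 3 = N%:R * Num.sqrt N%:R :> R.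
  by rewrite exprSr sqr_sqrtr.
pose y x : R := x%:R - pm (size s) * (navail N s)%:R.
rewrite /absmoment3 (@eq_kop _ _ _ _ (fun x => Am (size s).+1 ^+ 3 / (N%:R * Num.sqrt N%:R)
   * `|y x| ^+ 3)); last first.
  move=> x _; rewrite /xi -sq3 normrM normfV normrM !exprMn exprVn.
  by rewrite (gtr0_norm sN) (gtr0_norm A0) mulrAC.
rewrite kopZ.
have h : walkK s (fun x => `|y x| ^+ 3) <= 432 * expR c0.
  apply: (@le_trans _ _ (walkK s (fun x => 216 * (expR (1 / 2 * y x) + expR (- (1 / 2) * y x))))).
    apply: (@kop_mono _ walkK) => x _; apply: le_trans (cube_le_expR _) _.
    by rewrite mulNr !mul1r (mulrC 2^-1).
  rewrite kopZ kopD /=.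
  have b (eta : R) : eta <= 1 / 2 -> eta ^+ 2 <= 1 / 4 ->
    binE (pm (size s)) (navail N s) (fun x => expR (eta * y x)) <= expR c0.
    move=> e1 e2; apply: le_trans (binE_mgf _ (pm01 _) e1) _.
    rewrite ler_expR; have := np_le vs sL.
    have : 0 <= (navail N s)%:R * pm (size s).
      by rewrite mulr_ge0//; case/andP: (pm01 (size s)).
    rewrite -(mulrA 2); set u := _ * pm _ => u0 uc.
    have := c0_ge0 (leq_ltn_trans (leq0n _) sL) => c00.
    apply: le_trans (ler_wpM2l _ e2) _; lra.
  have h1 := b (1 / 2) (lexx _) ltac:(rewrite expr2; lra).
  have h2 := b (- (1 / 2)) ltac:(lra) ltac:(rewrite expr2; lra).
  by lra.
apply: le_trans (ler_wpM2l _ h) _.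
  by rewrite divr_ge0 ?exprn_ge0 ?mulr_ge0// ltW.
have hA : Am (size s).+1 ^+ 3 <= Amax ^+ 3 by rewrite lerXn2r ?nnegrE//; lra.
have D0 : 0 <= (N%:R * Num.sqrt N%:R)^-1 :> R by rewrite invr_ge0 mulr_ge0// ltW.
set D := _^-1 in D0 *.
have e0 := expR_ge0 c0.
rewrite (_ : _ * (432 * _) = Am (size s).+1 ^+ 3 * (432 * (expR c0 * D))); last by ring.
rewrite (_ : 432 * _ * _ * _ = Amax ^+ 3 * (432 * (expR c0 * D))); last by ring.
have h432 : 0 <= 432 :> R by rewrite ler0n.
exact: ler_wpM2r (mulr_ge0 h432 (mulr_ge0 e0 D0)) _ _ hA.
Qed.

Definition overshoot (i0 i1 : nat) (sg e : R) (l : seq nat) : bool :=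
  [&& (i0 <= size l)%N, (size l <= i1)%N & e < sg * (Ql l - Ql (pre i0 l))].

(* Ville's inequality for the exponential supermartingale of sg * (Ql - Ql i0). *)
Lemma maximal_inequality i0 i1 (sg e theta : R) : (i0 <= i1)%N -> (i1 <= L)%N ->
  sg ^+ 2 = 1 -> 0 <= theta -> theta * Amax <= Num.sqrt N%:R / 2 ->
  EE walkK L [::] (fun l => (ever (overshoot i0 i1 sg e) l)%:R)
  <= expR (- (theta * e) + 2 * c0 * Amax ^+ 2 * theta ^+ 2 / N%:R * (i1 - i0)%:R).
Proof.
move=> i01 i1L sg1 th0 thA.
have NR : 0 < N%:R :> R by rewrite ltr0n.
set kap := 2 * c0 * _ * _ / _.
(* [kap] bounds the logarithm of the exponential moment of one step. G is constant before i0,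
   compensated between i0 and i1, and frozen after i1 through [pre i1]. *)
pose G l : R := if (size l < i0)%N then expR (- (theta * e) + kap * (i1 - i0)%:R)
  else expR (theta * (sg * (Ql (pre i1 l) - Ql (pre i0 l)) - e) + kap * (i1 - size l)%:R).
(* The sign of c0 is read off from a rate, which requires L > 0. *)
have [L0|L0] := posnP L.
  have i10 : i1 = 0%N by lia.
  have i00 : i0 = 0%N by lia.
  rewrite L0 /= i10 i00 subnn mulr0 addr0 orbF /overshoot /= subrr mulr0.
  have [e0|e0] := ltP e 0; last by rewrite expR_ge0.
  by rewrite -expR0 ler_expR oppr_ge0 mulr_ge0_le0// ltW.
have c00 := c0_ge0 L0.
have Amax0 : 0 <= Amax by apply: le_trans AmL; exact: ltW (Am_gt0 _).
have kap0 : 0 <= kap by rewrite /kap divr_ge0// !mulr_ge0.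
have G0 l : 0 <= G l by rewrite /G; case: ifP => _; exact: expR_ge0.
apply: (@le_trans _ _ (G [::])).
  apply: ville => //.
  - move=> l /and3P[l0 l1 he]; rewrite /G ltnNge l0 /= (pre_id l1).
    rewrite -[leLHS]expR0 ler_expR addr_ge0 ?mulr_ge0 ?ler0n// subr_ge0 ltW//.
  - move=> l vl; have [li0|li0] := leqP i0 (size l); last first.
      have Gl : G l = expR (- (theta * e) + kap * (i1 - i0)%:R) by rewrite /G li0.
      rewrite Gl -[leRHS](kop_cst walkK l); apply: (@kop_mono _ walkK) => x _.
      rewrite /G /=; case: ifPn => // ; rewrite -leqNgt => h.
      have e0 : i0 = (size l).+1 by lia.
      rewrite !pre_id /=; [|lia|lia].
      by rewrite subrr mulr0 sub0r mulrN -e0.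
    have [li1|li1] := leqP i1 (size l).
      rewrite -[leRHS](kop_cst walkK l); apply: (@kop_mono _ walkK) => x _.
      rewrite /G /= !ltnNge li0 (leqW li0) /= !pre_cons//.
      by rewrite (_ : (i1 - (size l).+1 = i1 - size l)%N)//; lia.
    have Gl : G l = expR (theta * (sg * (Ql l - Ql (pre i0 l)) - e)
                          + kap * (i1 - size l)%:R).
      by rewrite /G ltnNge li0 /= (@pre_id i1) // ltnW.
    pose eta := theta * sg * Am (size l).+1 / Num.sqrt N%:R.
    have eta2 : eta ^+ 2 <= theta ^+ 2 * Amax ^+ 2 / N%:R.
      rewrite /eta !exprMn sg1 mulr1 exprVn sqr_sqrtr//.
      rewrite ler_wpM2r ?invr_ge0// ler_wpM2l ?sqr_ge0//.
      rewrite lerXn2r ?nnegrE ?(ltW (Am_gt0 _))//.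
      by apply: le_trans AmL; rewrite Am_le//; lia.
    have eta1 : eta <= 1 / 2.
      apply: le_trans (ler_norm _) _.
      rewrite -(@ler_pXn2r _ 2) ?nnegrE// ?divr_ge0// -normrX ger0_norm ?sqr_ge0//.
      apply: le_trans eta2 _; rewrite -exprMn ler_pdivrMr//.
      apply: le_trans (_ : (Num.sqrt N%:R / 2) ^+ 2 <= _).
        by rewrite lerXn2r ?nnegrE// ?divr_ge0// ?mulr_ge0.
      rewrite !exprMn sqr_sqrtr//; rewrite exprVn; lra.
    rewrite Gl.
    rewrite (@eq_kop _ _ _ _ (fun x => expR (theta * (sg * (Ql l - Ql (pre i0 l)) - e)
           + kap * (i1 - (size l).+1)%:R) * expR (eta * (x%:R - pm (size l) * (navail N l)%:R)))); last first.
      move=> x _; rewrite /G /= ltnNge (leqW li0) /= (@pre_id i1 (x :: l))// pre_cons//=.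
      rewrite -expRD; congr expR; rewrite /xi /eta; ring.
    have -> : kap * (i1 - size l)%:R = kap * (i1 - (size l).+1)%:R + kap.
      by rewrite -(subnSK li1) -natr1 mulrDr mulr1.
    rewrite kopZ addrA (expRD _ kap) ler_wpM2l ?expR_ge0//.
    rewrite /=; apply: le_trans (binE_mgf _ (pm01 _) eta1) _.
    rewrite ler_expR.
    have lL : (size l < L)%N by exact: leq_trans li1 i1L.
    have := np_le vl lL => npc.
    apply: (@le_trans _ _ (2 * c0 * eta ^+ 2)).
      by rewrite ler_wpM2r ?sqr_ge0// -mulrA ler_wpM2l.
    rewrite /kap -(mulrA (2 * c0)) -(mulrA (2 * c0)) ler_wpM2l//; first by lra.
    by rewrite (mulrC (Amax ^+ 2)).
have [i00|i00] := posnP i0; rewrite /G (_ : size [::] = 0%N)//; last by rewrite i00.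
by rewrite i00 ltnn !pre_id// subrr mulr0 sub0r mulrN.
Qed.

End Walk.

(** * Laws of random histories *)

Section RintDct.
Context {d : measure_display} {T : measurableType d} {R : realType}.
Variable mu : {measure set T -> \bar R}.

Lemma Rint_dct (f_ : nat -> T -> R) (f g : T -> R) :
  (forall n, measurable_fun setT (f_ n)) -> measurable_fun setT f ->
  (forall w, f_ ^~ w @ \oo --> f w) ->
  mu.-integrable setT (EFin \o g) -> (forall n w, `|f_ n w| <= g w) ->
  (fun n => \int[mu]_w f_ n w) @ \oo --> \int[mu]_w f w.
Proof.
move=> mf_ mf cv ig le.
have mE n : measurable_fun setT (EFin \o f_ n) by exact/measurable_EFinP.
have mE' : measurable_fun setT (EFin \o f) by exact/measurable_EFinP.
have cvE : {ae mu, forall w, setT w -> (fun n => (f_ n w)%:E) @ \oo --> (f w)%:E}.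
  by apply: aeW => w _; apply: cvg_EFin; [exact: nearW|exact: cv].
have leE : {ae mu, forall w n, setT w -> (`|(f_ n w)%:E| <= (g w)%:E)%E}.
  by apply: aeW => w n _; rewrite lee_fin.
have [itf _ H] := dominated_convergence measurableT mE mE' cvE ig leE.
apply: fine_cvg.
rewrite /Rintegral fineK; first exact: H.
exact: integrable_fin_num.
Qed.

End RintDct.

Section ProbInt.
Context {d : measure_display} {T : measurableType d} {R : realType}.
Variable P : probability T R.
Implicit Types (f g : T -> R) (C : R).

Lemma bdd_integrable f C : measurable_fun setT f -> (forall w, `|f w| <= C) ->
  P.-integrable setT (EFin \o f).
Proof.
move=> mf fC; apply: measurable_bounded_integrable => //.
  by rewrite (le_lt_trans (probability_le1 P measurableT))// ltry.
exists C; split; first exact: num_real.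
by move=> M CM w _ /=; apply: le_trans (fC w) _; exact: ltW.
Qed.

Lemma Rint_indic (A : set T) : measurable A -> \int[P]_w (\1_A w) = fine (P A).
Proof. by move=> mA; rewrite /Rintegral integral_indic// setIT. Qed.

Lemma Rint_dct_bdd (f_ : nat -> T -> R) f C :
  (forall n, measurable_fun setT (f_ n)) -> measurable_fun setT f ->
  (forall w, f_ ^~ w @ \oo --> f w) ->
  (forall n w, `|f_ n w| <= C) ->
  (fun n => \int[P]_w f_ n w) @ \oo --> \int[P]_w f w.
Proof.
move=> mf_ mf cv le; apply: (Rint_dct (g := fun=> C)) => //.
by apply: (@bdd_integrable (fun=> C) `|C|); [exact: measurable_cst|].
Qed.

End ProbInt.

(** * Random sequences whose conditional laws are given by a kernel *)

Section TreeLaw.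
Context {d : measure_display} {T : measurableType d} {R : realType}.
Variables (P : probability T R) (K : kern R) (L : nat) (X : nat -> T -> nat).

Fixpoint pathX (k : nat) (w : T) : seq nat :=
  if k is k'.+1 then X k' w :: pathX k' w else [::].

Lemma size_pathX k w : size (pathX k w) = k.
Proof. by elim: k => //= k ->. Qed.

Hypothesis mX : forall k n, (k < L)%N -> measurable [set w | X k w = n].

Lemma measurable_pathX k s : (k <= L)%N -> measurable [set w | pathX k w = s].
Proof.
elim: k s => [|k IH] [|x s] kL.
- rewrite (_ : [set _ | _] = setT)//; exact/seteqP.
- by rewrite (_ : [set _ | _] = set0)//; apply/seteqP; split.
- by rewrite (_ : [set _ | _] = set0)//; apply/seteqP; split.
- rewrite (_ : [set _ | _] = [set w | X k w = x] `&` [set w | pathX k w = s]).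
    by apply: measurableI; [exact: mX|apply: IH; exact: ltnW].
  by apply/seteqP; split => w /= [-> ->].
Qed.

(** Histories are countable, so every function of the history is measurable; [unpickle] enumerates
    them. *)
Lemma measurable_fun_pathX (phi : seq nat -> R) k : (k <= L)%N ->
  measurable_fun setT (fun w => phi (pathX k w)).
Proof.
move=> kL _ B mB; rewrite setTI.
pose F (o : option (seq nat)) : set T := if o is Some s then
  (if `[< B (phi s) >] then [set w | pathX k w = s] else set0) else set0.
rewrite (_ : _ @^-1` _ = \bigcup_(n : nat) F (unpickle n)).
  apply: bigcupT_measurable => n; rewrite /F; move: (unpickle n) => o.
  case: o => [s|]; last exact: measurable0.
  by case: ifP => _; [exact: (measurable_pathX s kL)|exact: measurable0].
apply/seteqP; split => w.
  move=> Bw; exists (pickle (pathX k w)); first exact: I.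
  by rewrite pickleK /F; case: asboolP.
move=> [n _]; rewrite /F; move: (unpickle n) => o; case: o => // s.
by case: asboolP => //= Bs ->.
Qed.

Hypothesis Xbd : forall k w, (k < L)%N -> (X k w <= kbd K (pathX k w))%N.
Hypothesis Xlaw : forall k s x, (k < L)%N -> size s = k ->
  fine (P [set w | pathX k w = s /\ X k w = x])
  = fine (P [set w | pathX k w = s]) * K s (fun y => (y == x)%:R).

Lemma valid_pathX k w : (k <= L)%N -> valid K (pathX k w).
Proof.
elim: k => [//|k IH] kL /=; rewrite Xbd//= IH//; exact: ltnW.
Qed.

Lemma kop_sum s g : K s g = \sum_(x < (kbd K s).+1) g x * K s (fun y => (y == x)%:R).
Proof.
transitivity (K s (fun y => \sum_(x < (kbd K s).+1) g x * (y == x)%:R)).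
  apply: eq_kop => x xs.
  rewrite (bigD1 (Ordinal (xs : (x < (kbd K s).+1)%N)))//= eqxx mulr1 big1 ?addr0//.
  move=> i ix; rewrite (_ : (x == i) = false) ?mulr0//.
  by apply: contra_neqF ix => /eqP e; exact/val_inj.
rewrite -(big_mkord xpredT (fun x => g x * K s (fun y => (y == x)%:R))).
under eq_kop => x _ do rewrite -(big_mkord xpredT (fun z => g z * (x == z)%:R)).
elim: (kbd K s).+1 => [|n IH].
  by rewrite big_geq// -[RHS](kop_cst K s); apply: eq_kop => x _; rewrite big_geq.
rewrite big_nat_recr//= -IH -kopZ -kopD; apply: eq_kop => x _.
by rewrite big_nat_recr.
Qed.

(** Induction on the number n of steps left: the event that the history is s splits according to the
    next entry, whose conditional masses are given by [Xlaw]. *)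
Lemma tree_law_from phi C n k s : (forall l, `|phi l| <= C) -> (n + k = L)%N ->
  size s = k -> \int[P]_w (\1_[set w | pathX k w = s] w * phi (pathX L w))
    = fine (P [set w | pathX k w = s]) * EE K n s phi.
Proof.
move=> phiC.
have mfp k' l : (k' <= L)%N -> measurable_fun setT
    (fun w => \1_[set w | pathX k' w = l] w * phi (pathX L w)).
  move=> kL; apply: measurable_funM; last exact: measurable_fun_pathX.
  exact/measurable_indic/measurable_pathX.
have bdd k' l w : `|\1_[set w | pathX k' w = l] w * phi (pathX L w)| <= C.
  rewrite normrM -[leRHS]mul1r ler_pM//.
  by rewrite indicE; case: (_ \in _); rewrite ?normr0 ?normr1.
elim: n k s => [|n IH] k s nk sk.
  move: nk; rewrite add0n => ->.
  have mA : measurable [set w | pathX L w = s] by exact: measurable_pathX.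
  rewrite /= -Rint_indic// -RintegralZr//.
    apply: eq_Rintegral => w _; rewrite indicE; case: (boolP (_ \in _)).
      by rewrite inE /= => ->.
    by rewrite !mul0r.
  apply: (@bdd_integrable _ _ _ P _ 1); first exact/measurable_indic.
  by move=> w; rewrite indicE; case: (_ \in _); rewrite ?normr0 ?normr1.
have kL : (k < L)%N by lia.
transitivity (\int[P]_w (\sum_(x < (kbd K s).+1)
   \1_[set w | pathX k.+1 w = (x : nat) :: s] w * phi (pathX L w))).
  apply: eq_Rintegral => w _; rewrite -mulr_suml; congr (_ * _).
  have E (x : nat) : (\1_[set w | pathX k.+1 w = x :: s] w : R)
     = \1_[set w | pathX k w = s] w * (X k w == x)%:R.
    rewrite !indicE -natrM mulnb; congr (_%:R); congr nat_of_bool.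
    apply/idP/andP; rewrite !inE /=.
      by move=> [-> ->].
    by move=> [-> /eqP ->].
  under eq_bigr do rewrite E.
  rewrite -mulr_sumr indicE; case: (boolP (w \in _)); last by rewrite !mul0r.
  rewrite inE /= => ws; rewrite mul1r.
  have := Xbd w kL; rewrite ws => Xs.
  rewrite (bigD1 (Ordinal (Xs : (X k w < (kbd K s).+1)%N)))//= eqxx big1 ?addr0//.
  move=> i ix; rewrite (_ : (X k w == i) = false)//.
  by apply: contra_neqF ix => /eqP e; exact/val_inj.
rewrite (_ : \int[P]_w _ = \sum_(x < (kbd K s).+1) \int[P]_w
    (\1_[set w | pathX k.+1 w = (x : nat) :: s] w * phi (pathX L w))).
  rewrite /= (kop_sum s) mulr_sumr; apply: eq_bigr => x _.
  rewrite (IH k.+1) ?addnS//=; last by rewrite sk.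
  rewrite [RHS]mulrCA [RHS]mulrC; congr (_ * _).
  rewrite -Xlaw//; congr (fine (P _)).
  by apply/seteqP; split => w /= [-> ->].
rewrite /Rintegral (eq_integral (fun w => \sum_(x < (kbd K s).+1)
   (\1_[set w | pathX k.+1 w = (x : nat) :: s] w * phi (pathX L w))%:E)%E); last first.
  by move=> w _; rewrite sumEFin.
have it (x : nat) : P.-integrable setT (EFin \o (fun w =>
    \1_[set w | pathX k.+1 w = x :: s] w * phi (pathX L w))).
  by apply: bdd_integrable (bdd _ _); exact: mfp.
rewrite integral_sum//=; last by move=> i; exact: it.
rewrite -sum_fine// => i _; apply: integrable_fin_num => //; exact: it.
Qed.

Lemma tree_law phi C : (forall l, `|phi l| <= C) ->
  \int[P]_w phi (pathX L w) = EE K L [::] phi.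
Proof.
move=> phiC; have := tree_law_from phiC (addn0 L) (erefl : size [::] = 0%N).
have -> : [set w | pathX 0 w = [::]] = setT by apply/seteqP.
rewrite probability_setT mul1r => <-.
by apply: eq_Rintegral => w _; rewrite indicT mul1r.
Qed.

End TreeLaw.

Section ExponentialValues.
Context {R : realType} (rate : R).
Hypothesis rate0 : 0 < rate.

Let pdf_meas (D : set R) : measurable_fun D (EFin \o exponential_pdf rate).
Proof. by apply/measurable_EFinP/measurable_funTS; exact: measurable_exponential_pdf. Qed.

Let pdf_ge0 (x : R) : (0 <= (exponential_pdf rate x)%:E)%E.
Proof. by rewrite lee_fin exponential_pdf_ge0// ltW. Qed.

Lemma exponential_prob_le1 : exponential_prob rate `]-oo, 1]%classic = (1 - expR (- rate))%:E.
Proof.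
rewrite EFinB -[X in expR X]mulr1 -exponential_prob_itv0c//.
rewrite /exponential_prob (_ : `]-oo, 1]%classic = `]-oo, 0[ `|` `[0, 1]); last first.
  apply/seteqP; split => x /=; rewrite !in_itv /=.
    by move=> x1; have [x0|x0] := ltP x 0; [left|right; rewrite x1].
  by move=> [/ltW x0|/andP[]//]; apply: le_trans x0 _.
rewrite ge0_integral_setU//=.
  rewrite [X in (X + _)%E]integral0_eq ?add0e// => x; rewrite /= in_itv /= => x0.
  by rewrite lt0_exponential_pdf.
  exact: pdf_meas.
apply/disj_setPS => x [] /=; rewrite !in_itv /= => x0 /andP[x0' _].
by move: x0; rewrite ltNge x0'.
Qed.

Lemma exponential_prob_gt1 :
  exponential_prob rate (~` `]-oo, 1]%classic) = (expR (- rate))%:E.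
Proof.
have := integral_exponential_pdf rate0.
rewrite -(setUv `]-oo, 1]%classic) ge0_integral_setU//=; last 3 first.
- exact: measurableC.
- exact: pdf_meas.
- exact/disj_setPCl.
rewrite -!/(exponential_prob rate _) exponential_prob_le1.
by case: (exponential_prob rate (~` _)) => // r [h]; congr (_%:E); lra.
Qed.

End ExponentialValues.

(** * The number of independent events that occur is binomial *)

Section CountLaw.
Context {d : measure_display} {T : measurableType d} {R : realType}.

Lemma measurable_count (ev : nat -> T -> bool) (pr : pred nat) a n :
  (forall j, measurable [set w | ev j w]) ->
  measurable [set w | pr (count (fun j => ev j w) (iota a n))].
Proof.
move=> mev; elim: n a pr => [|n IH] a pr /=.
  case: (pr 0%N).
    by rewrite (_ : [set _ | _] = setT)//; apply/seteqP; split.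
  by rewrite (_ : [set _ | _] = set0)//; apply/seteqP; split.
rewrite (_ : [set _ | _] =
   ([set w | ev a w] `&` [set w | pr (count (fun j => ev j w) (iota a.+1 n)).+1])
   `|` (~` [set w | ev a w] `&` [set w | pr (count (fun j => ev j w) (iota a.+1 n))])).
  have H1 := IH a.+1 (fun x => pr x.+1); have H2 := IH a.+1 pr.
  apply: measurableU; first exact: measurableI.
  by apply: measurableI => //; exact: measurableC.
apply/seteqP; split => w /=; case: (ev a w) => /=; rewrite ?add0n ?add1n.
- by left.
- by right.
- by case=> [[]|[]].
- by case=> [[]|[]].
Qed.

Variables (P : probability T R) (B : set T) (e : nat -> T -> R) (q : set R -> R).
Variables (I : set R) (p : R) (n : nat).
Hypothesis mB : measurable B.
Hypothesis me : forall j, measurable_fun setT (e j).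
Hypothesis mI : measurable I.
Hypothesis qI : q I = p.
Hypothesis qIC : q (~` I) = 1 - p.
Hypothesis indep : forall A : nat -> set R,
  (forall j, [\/ A j = setT, A j = I | A j = ~` I]) ->
  fine (P (B `&` [set w | forall j, (1 <= j <= n)%N -> A j (e j w)]))
  = fine (P B) * \prod_(1 <= j < n.+1) q (A j).

(** The first m variables are constrained by A and the last r are counted. Deciding whether variable
    m + 1 lies in I moves it from the counted to the constrained ones, which reproduces the
    recursion of [binE]. *)
Lemma count_law_from r m (A : nat -> set R) (pr : pred nat) : (m + r = n)%N ->
  (forall j, [\/ A j = setT, A j = I | A j = ~` I]) ->
  (forall j, (m < j)%N -> A j = setT) ->
  fine (P (B `&` [set w | forall j, (1 <= j <= n)%N -> A j (e j w)]
     `&` [set w | pr (count (fun j => `[< I (e j w) >]) (iota m.+1 r))]))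
  = fine (P B) * \prod_(1 <= j < m.+1) q (A j) * binE p r (fun x => (pr x)%:R).
Proof.
have mA (A' : nat -> set R) : (forall j, [\/ A' j = setT, A' j = I | A' j = ~` I]) ->
    measurable [set w | forall j, (1 <= j <= n)%N -> A' j (e j w)].
  move=> hA; rewrite (_ : [set _ | _] = \bigcap_j
      (if (1 <= j <= n)%N then e j @^-1` A' j else setT)).
    apply: bigcapT_measurable => j; case: ifP => _; last exact: measurableT.
    rewrite -[X in measurable X]setTI; apply: me => //.
    by case: (hA j) => ->//; exact: measurableC.
  apply/seteqP; split => w /= h j hj; first by case: ifP => //; exact: h.
  by have := h j Logic.I; rewrite hj.
have mc (pr' : pred nat) a k : measurable [set w | pr' (count (fun j => `[< I (e j w) >]) (iota a k))].
  apply: (@measurable_count (fun j w => `[< I (e j w) >])) => j.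
  rewrite (_ : [set _ | _] = e j @^-1` I); first by rewrite -[X in measurable X]setTI; exact: me.
  by apply/seteqP; split => w /= /asboolP.
elim: r m A pr => [|r IH] m A pr mn hA hT.
  have {mn} mn : m = n by rewrite -mn addn0.
  rewrite mn -indep//= ; case: (pr 0%N) => /=.
    by rewrite mulr1 (_ : [set _ | true] = setT) ?setIT//; apply/seteqP; split.
  by rewrite mulr0 (_ : [set _ | false] = set0) ?setI0 ?measure0//; apply/seteqP; split.
have nm : (m < n)%N by rewrite -mn addnS ltnS leq_addr.
pose A1 j := if j == m.+1 then I else A j.
pose A0 j := if j == m.+1 then ~` I else A j.
have hA1 j : [\/ A1 j = setT, A1 j = I | A1 j = ~` I].
  by rewrite /A1; case: eqP => _ //; constructor 2.
have hA0 j : [\/ A0 j = setT, A0 j = I | A0 j = ~` I].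
  by rewrite /A0; case: eqP => _ //; constructor 3.
have hT1 j : (m.+1 < j)%N -> A1 j = setT.
  by move=> h; rewrite /A1 gtn_eqF// hT// ltnW.
have hT0 j : (m.+1 < j)%N -> A0 j = setT.
  by move=> h; rewrite /A0 gtn_eqF// hT// ltnW.
have mrn : (m.+1 + r = n)%N by rewrite addSn -addnS.
have E1 := IH m.+1 A1 (fun x => pr x.+1) mrn hA1 hT1.
have E0 := IH m.+1 A0 pr mrn hA0 hT0.
have Apart A' w : (forall j, j != m.+1 -> A' j = A j) ->
    (forall j, (1 <= j <= n)%N -> A' j (e j w)) <->
    (forall j, (1 <= j <= n)%N -> A j (e j w)) /\ A' m.+1 (e m.+1 w).
  move=> AA; split=> [h|[h1 h2] j jn].
    split=> [j jn|]; last by apply: h; rewrite ltnS leq0n.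
    have [->|jm] := eqVneq j m.+1; first by rewrite hT// .
    by rewrite -AA//; exact: h.
  have [->//|jm] := eqVneq j m.+1.
  by rewrite AA//; exact: h1.
have AA1 j : j != m.+1 -> A1 j = A j by rewrite /A1 => /negbTE->.
have AA0 j : j != m.+1 -> A0 j = A j by rewrite /A0 => /negbTE->.
set S := _ `&` _.
have SE : S = (B `&` [set w | forall j, (1 <= j <= n)%N -> A1 j (e j w)]
     `&` [set w | pr (count (fun j => `[< I (e j w) >]) (iota m.+2 r)).+1])
   `|` (B `&` [set w | forall j, (1 <= j <= n)%N -> A0 j (e j w)]
     `&` [set w | pr (count (fun j => `[< I (e j w) >]) (iota m.+2 r))]).
  apply/seteqP; split => w /=.
    move=> [[Bw Aw]] /=; have [Iw|Iw] := pselect (I (e m.+1 w)).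
      rewrite asboolT// add1n => pw; left; split=> //; split=> //.
      by apply/(Apart A1) => //; split => //; rewrite /A1 eqxx.
    rewrite asboolF// add0n => pw; right; split=> //; split=> //.
    by apply/(Apart A0) => //; split => //; rewrite /A0 eqxx.
  move=> [|] [[Bw /Apart Aw] pw].
    have [h1 h2] := Aw AA1; split=> //.
    by move: h2; rewrite /A1 eqxx => h2 /=; rewrite asboolT// add1n.
  have [h1 h2] := Aw AA0; split=> //.
  by move: h2; rewrite /A0 eqxx => h2 /=; rewrite asboolF// add0n.
rewrite {}SE measureU; last 3 first.
- by apply: measurableI; [apply: measurableI => //; exact: mA|exact: (mc (fun x => pr x.+1))].
- by apply: measurableI; [apply: measurableI => //; exact: mA|exact: mc].
- apply/seteqP; split => w //= -[[[_ /Apart Aw1] _] [[_ /Apart Aw0] _]].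
  have [_] := Aw1 AA1; have [_] := Aw0 AA0.
  by rewrite /A1 /A0 eqxx.
rewrite fineD ?fin_num_measure//; last 2 first.
- by apply: measurableI; [apply: measurableI => //; exact: mA|exact: (mc (fun x => pr x.+1))].
- by apply: measurableI; [apply: measurableI => //; exact: mA|exact: mc].
have a1 : A1 m.+1 = I by rewrite /A1 eqxx.
have a0 : A0 m.+1 = ~` I by rewrite /A0 eqxx.
rewrite E1 E0 /= !(big_nat_recr m.+1)//= a1 a0 qI qIC.
have -> : \prod_(1 <= i < m.+1) q (A1 i) = \prod_(1 <= i < m.+1) q (A i).
  by apply: eq_big_nat => i /andP[_ im]; rewrite AA1// ltn_eqF.
have -> : \prod_(1 <= i < m.+1) q (A0 i) = \prod_(1 <= i < m.+1) q (A i).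
  by apply: eq_big_nat => i /andP[_ im]; rewrite AA0// ltn_eqF.
ring.
Qed.

Lemma count_law (pr : pred nat) :
  fine (P (B `&` [set w | pr (count (fun j => `[< I (e j w) >]) (iota 1 n))]))
  = fine (P B) * binE p n (fun x => (pr x)%:R).
Proof.
have := @count_law_from n 0 (fun=> setT) pr (add0n n).
rewrite big_geq// mulr1 => <- //; last by move=> j; constructor 1.
congr (fine (P (_ `&` _))).
by apply/seteqP; split => w //= [].
Qed.

End CountLaw.

Lemma big_min_rcons (f : nat -> int) r a :
  \big[Num.min/0]_(j <- rcons r a) f j = Num.min (\big[Num.min/0]_(j <- r) f j) (f a).
Proof.
elim: r => [|b r IH]; first by rewrite /= big_cons !big_nil minC.
by rewrite /= !big_cons IH minA.
Qed.

(** * The conditional law of the numbers of children *)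

Section WalkLaw.
Context {R : realType} {d : measure_display} {T : measurableType d}.
Variables (P : probability T R) (beta : nat -> R) (N : nat).
Variables (M : T -> {set 'I_N} -> nat) (E : T -> nat -> nat -> R).
Hypothesis interp : exp_interpolation P beta M E.
Hypothesis lam0 : forall m, (m < N)%N -> 0 < lambda2 beta N m.

Definition childX (k : nat) (w : T) : nat := bfw_C (hasM (M w)) k.+1.

Local Notation path := (pathX childX).

Lemma bfw_Z_path i w : bfw_Z (hasM (M w)) i = Zlist (path i w).
Proof.
rewrite /bfw_Z /Zlist size_pathX; congr (_ - _).
elim: i => [|i IH]; first by rewrite big_geq.
by rewrite big_nat_recr//= IH PoszD addrC.
Qed.

Lemma bfw_P_path i w : bfw_P (hasM (M w)) i = 1 - Zmin (path i w).
Proof.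
rewrite /bfw_P; congr (_ - _).
rewrite -(big_mkord xpredT (bfw_Z (hasM (M w)))).
elim: i => [|i IH]; first by rewrite /index_iota /= big_cons big_nil /bfw_Z big_geq//= minxx.
rewrite /index_iota subn0 -addn1 iotaD cats1 big_min_rcons add0n.
rewrite -[X in \big[_/_]_(_ <- iota 0 X) _](subn0 i.+1) -/(index_iota 0 i.+1) IH.
by rewrite bfw_Z_path.
Qed.

Lemma bfw_navail_path i w : bfw_navail (hasM (M w)) i.+1 = navail N (path i w).
Proof.
by rewrite /bfw_navail /navail /= bfw_Z_path bfw_P_path size_pathX.
Qed.

Lemma childX_count k w : (k < N)%N ->
  childX k w = count (fun j => E w k.+1 j <= 1) (iota 1 (navail N (path k w))).
Proof.
move=> kN; have [_ H _] := interp.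
by rewrite /childX H// bfw_navail_path.
Qed.

(** Given the history s, the next number of children counts the variables at most 1 in a row of
    known length [navail N s]. Hence the history is a function of the earlier rows alone, which puts
    it in the past on which [exp_interpolation] conditions. *)
Lemma past_path k s : (k <= N)%N -> <<s past_gen E k.+1 >> [set w | path k w = s].
Proof.
elim: k s => [|k IH] s kN.
  rewrite (_ : [set w | _] = if s is [::] then setT else set0).
    have := @measurableT _ (g_sigma_algebraType (past_gen E 1)).
    have := @measurable0 _ (g_sigma_algebraType (past_gen E 1)).
    by case: s.
  by case: s => [|x s]; apply/seteqP; split.
pose G := g_sigma_algebraType (past_gen E k.+2).
have mp s' : @measurable _ G [set w | path k w = s'].
  move: (IH s' (ltnW kN)); apply: sub_sigma_algebra2 => A [m [j [A' [mk mA' ->]]]].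
  by exists m, j, A'; split=> //; case/andP: mk => -> /= h; rewrite ltnS ltnW.
case: s => [|x s].
  rewrite (_ : [set _ | _] = set0); first exact: (@measurable0 _ G).
  by apply/seteqP; split.
rewrite (_ : [set _ | _] = [set w | path k w = s] `&`
   [set w | count (fun j => E w k.+1 j <= 1) (iota 1 (navail N s)) == x]).
  apply: (@measurableI _ G); first exact: mp.
  apply: (@measurable_count _ G (fun j w => E w k.+1 j <= 1) (fun y => y == x)) => j.
  apply: sub_sigma_algebra; exists k.+1, j, `]-oo, 1]%classic; split.
  - by rewrite /= ltnSn.
  - exact: measurable_itv.
  - by apply/seteqP; split => w /=; rewrite in_itv.
apply/seteqP; split => w /=.
  by move=> [<- <-]; rewrite childX_count.
by move=> [<- /eqP <-]; rewrite childX_count.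
Qed.

Lemma measurable_past k A : <<s past_gen E k >> A -> measurable A.
Proof.
have [mE _ _] := interp.
apply: smallest_sub; first exact: sigma_algebra_measurable.
move=> S [m [j [B [_ mB ->]]]]; rewrite -[X in measurable X]setTI.
exact: mE.
Qed.

Lemma measurable_childX k n : (k < N)%N -> measurable [set w | childX k w = n].
Proof.
move=> kN.
pose F (o : option (seq nat)) : set T :=
  if o is Some s then [set w | path k.+1 w = n :: s] else set0.
rewrite (_ : [set _ | _] = \bigcup_(i : nat) F (unpickle i)).
  apply: bigcupT_measurable => i; rewrite /F; move: (unpickle i) => o.
  case: o => [s|]; last exact: measurable0.
  by apply: (@measurable_past k.+2); exact: past_path.
apply/seteqP; split => w.
  move=> wn; exists (pickle (path k w)); first exact: Logic.I.
  by rewrite pickleK /F; move: wn => /= ->.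
by move=> [i _]; rewrite /F; move: (unpickle i) => o; case: o => // s /= [].
Qed.

(** The event that the history is s lies in the past and fixes the number of variables, so
    [exp_interpolation] applies to it; [count_law] with success set ]-oo, 1] then gives the binomial
    law. *)
Lemma childX_law k s x : (k < N)%N -> size s = k ->
  fine (P [set w | path k w = s /\ childX k w = x])
  = fine (P [set w | path k w = s])
    * binE (pm (lambda2 beta N) (size s)) (navail N s) (fun y => (y == x)%:R).
Proof.
move=> kN ks; have [mE _ H] := interp.
set B := [set w | path k w = s].
have pB : <<s past_gen E k.+1 >> B by exact: past_path (ltnW kN).
have mB : measurable B := measurable_past pB.
have l0 := lam0 kN.
pose q (A : set R) : R := fine (exponential_prob (lambda2 beta N k) A).
pose I : set R := `]-oo, 1]%classic.
have mI : measurable I by exact: measurable_itv.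
have qI : q I = pm (lambda2 beta N) k by rewrite /q exponential_prob_le1.
have qIC : q (~` I) = 1 - pm (lambda2 beta N) k.
  by rewrite /q exponential_prob_gt1// /pm /=; lra.
have indep (A : nat -> set R) : (forall j, [\/ A j = setT, A j = I | A j = ~` I]) ->
    fine (P (B `&` [set w | forall j, (1 <= j <= navail N s)%N -> A j (E w k.+1 j)]))
    = fine (P B) * \prod_(1 <= j < (navail N s).+1) q (A j).
  move=> hA.
  rewrite (H k.+1 _ _ B A pB); last 3 first.
  - by rewrite kN.
  - by move=> w /= <-; rewrite bfw_navail_path.
  - by move=> j; case: (hA j) => -> //; exact: measurableC.
  rewrite fineM ?fin_num_measure//; last first.
    rewrite (_ : (\prod_(_ <= _ < _) _)%E = (\prod_(1 <= j < (navail N s).+1) q (A j))%:E)//.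
    rewrite -prodEFin; apply: eq_bigr => j _ /=; rewrite /q fineK//.
    case: (hA j) => ->; rewrite ?exponential_prob_le1// ?exponential_prob_gt1//.
    by rewrite /exponential_prob integral_exponential_pdf.
  congr (_ * _).
  rewrite (_ : (\prod_(_ <= _ < _) _)%E = (\prod_(1 <= j < (navail N s).+1) q (A j))%:E)//.
  rewrite -prodEFin; apply: eq_bigr => j _ /=; rewrite /q fineK//.
  case: (hA j) => ->; rewrite ?exponential_prob_le1// ?exponential_prob_gt1//.
  by rewrite /exponential_prob integral_exponential_pdf.
have := count_law (e := fun j w => E w k.+1 j) mB (mE k.+1) mI qI qIC indep (fun y => y == x).
rewrite ks => <-.
congr (fine (P _)); apply/seteqP; split => w /=.
  move=> [ws]; rewrite childX_count// ws => <-; split=> //; apply/eqP/eq_count => j.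
  by apply/asboolP/idP; rewrite /I /= in_itv.
move=> [ws /eqP <-]; split=> //; rewrite childX_count// ws; apply/eq_count => j.
by apply/idP/asboolP; rewrite /I /= in_itv.
Qed.

End WalkLaw.

(** * Gaussian increments *)

Section ExpTaylor.
Context {R : realType}.

(** Mean value theorem for exp(-x) (1 + x + x^2/2), whose derivative -exp(-x) x^2/2 is a single
    term. *)
Lemma expR_taylor2 (y : R) :
  `|expR y - (1 + y + y ^+ 2 / 2)| <= `|y| ^+ 3 * expR (2 * `|y|).
Proof.
pose f (x : R) := expR (- x) * (1 + x + 2^-1 * x ^+ 2).
pose df (x : R) := - expR (- x) * (2^-1 * x ^+ 2).
have dff (x : R) : is_derive x 1 f (df x).
  rewrite /f /df; apply: is_derive_eq.
  by rewrite /GRing.scale /=; field.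
have cf (a b : R) : {within `[a, b], continuous f}.
  by apply: derivable_within_continuous => x _; case: (dff x).
have f0 : f 0 = 1 by rewrite /f oppr0 expR0 expr0n /= mulr0 !addr0 mulr1.
have key : exists c, `|c| <= `|y| /\ f y - 1 = df c * y.
  have [y0|y0] := leP 0 y.
    have [c] := MVT_segment y0 (fun x _ => dff x) (cf 0 y).
    rewrite in_itv /= f0 subr0 => /andP[c0 cy] e; exists c; split => //.
    by rewrite !ger0_norm.
  have [c] := MVT_segment (ltW y0) (fun x _ => dff x) (cf y 0).
  rewrite in_itv /= f0 sub0r => /andP[c0 cy] e; exists c; split.
    by rewrite !ler0_norm ?lerN2// ltW.
  by rewrite -opprB e mulrN opprK.
have [c [cy e]] := key.
have -> : expR y - (1 + y + y ^+ 2 / 2) = - (expR y * (f y - 1)).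
  by rewrite mulrBr /f mulrA -expRD subrr expR0; field.
have dfn : `|df c| = expR (- c) * (2^-1 * c ^+ 2).
  by rewrite /df mulNr normrN ger0_norm// mulr_ge0 ?expR_ge0// mulr_ge0 ?sqr_ge0// invr_ge0.
rewrite e normrN normrM (ger0_norm (expR_ge0 y)) normrM dfn.
have h1 : 2^-1 * c ^+ 2 <= `|y| ^+ 2.
  rewrite -(real_normK (num_real c)).
  have : `|c| ^+ 2 <= `|y| ^+ 2 by rewrite lerXn2r ?nnegrE.
  by have := sqr_ge0 `|c|; lra.
have h2 : expR y * expR (- c) <= expR (2 * `|y|).
  rewrite -expRD ler_expR; have := ler_norm y; have := ler_norm (- c).
  by rewrite normrN; lra.
have -> : expR y * (expR (- c) * (2^-1 * c ^+ 2) * `|y|)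
  = (2^-1 * c ^+ 2 * `|y|) * (expR y * expR (- c)) by ring.
have c20 : 0 <= 2^-1 * c ^+ 2 by rewrite mulr_ge0 ?sqr_ge0// invr_ge0.
apply: ler_pM h2; [exact: mulr_ge0|by rewrite mulr_ge0 ?expR_ge0|].
by rewrite (exprSr `|y| 2) ler_wpM2r.
Qed.

End ExpTaylor.

(** * Moments of the centred normal law, drawn from its moment generating function *)

Section NormalMoments.
Context {R : realType} (s : R).
Hypothesis s0 : 0 < s.
Local Notation mu := (@lebesgue_measure R).
Local Notation pdf := (normal_pdf 0 s).

Let sn0 : s != 0. Proof. by rewrite gt_eqF. Qed.

(** Completing the square: exponential tilting shifts the mean to th s^2. *)
Lemma normal_tilt (th x : R) :
  expR (th * x) * pdf x = expR (th ^+ 2 * s ^+ 2 / 2) * normal_pdf (th * s ^+ 2) s x.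
Proof.
rewrite !normal_pdfE// /normal_fun mulrCA [RHS]mulrCA; congr (_ * _).
rewrite -!expRD; congr expR; rewrite subr0 -mulr_natr; field.
exact: sn0.
Qed.

Lemma integrable_mgf th : mu.-integrable setT (fun x => (expR (th * x) * pdf x)%:E).
Proof.
under eq_fun do rewrite normal_tilt EFinM.
by apply: integrableZl => //; exact: integrable_normal_pdf.
Qed.

Lemma normal_mgf th : \int[mu]_x (expR (th * x) * pdf x) = expR (th ^+ 2 * s ^+ 2 / 2).
Proof.
under eq_Rintegral do rewrite normal_tilt.
rewrite RintegralZl//; last exact: integrable_normal_pdf.
by rewrite /Rintegral integral_normal_pdf /= mulr1.
Qed.

(** A common integrable majorant, up to constants, of exp(a x) for |a| <= 3, of the first three
    powers and of the Taylor remainder. *)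
Definition expdom (x : R) : R := expR (3 * x) + expR (- 3 * x).

Lemma expdom_ge (a x : R) : `|a| <= 3 -> expR (a * x) <= expdom x.
Proof.
move=> a3; apply: (@le_trans _ _ (expR (3 * `|x|))).
  rewrite ler_expR; apply: le_trans (ler_norm _) _.
  by rewrite normrM ler_wpM2r.
rewrite /expdom; have [x0|x0] := lerP 0 x; first by rewrite (ger0_norm x0) lerDl expR_ge0.
by rewrite (ltr0_norm x0) mulrN -mulNr lerDr expR_ge0.
Qed.

Lemma integrable_dom (f : R -> R) (C : R) : measurable_fun setT f ->
  (forall x, `|f x| <= C * expdom x) ->
  mu.-integrable setT (fun x => (f x * pdf x)%:E).
Proof.
move=> mf fC.
apply: (@le_integrable _ _ _ mu setT measurableT _
   (fun x => (C * (expR (3 * x) * pdf x + expR (- 3 * x) * pdf x))%:E)) => //.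
- apply/measurable_EFinP; apply: measurable_funM => //.
  exact: measurable_normal_pdf.
- move=> x _; rewrite -mulrDl mulrA !abse_EFin lee_fin normrM [leRHS]normrM.
  rewrite ler_wpM2r//; apply: le_trans (fC x) _; exact: ler_norm.
- under eq_fun do rewrite EFinM EFinD.
  by apply: integrableZl => //; apply: integrableD => //; exact: integrable_mgf.
Qed.

Lemma normal_dom_bound : \int[mu]_x (expdom x * pdf x) = 2 * expR (9 * s ^+ 2 / 2).
Proof.
under eq_Rintegral do rewrite mulrDl.
rewrite RintegralD//; [|exact: integrable_mgf|exact: integrable_mgf].
rewrite !normal_mgf sqrrN (_ : 3 ^+ 2 = 9 :> R); last by ring.
ring.
Qed.

Lemma norm_le_expdom (x : R) : `|x| <= 1 * expdom x.
Proof.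
rewrite mul1r; apply: (@le_trans _ _ (expR `|x|)).
  by apply: le_trans (expR_ge1Dx _); rewrite lerDr.
have [x0|x0] := lerP 0 x.
  by rewrite (ger0_norm x0) -[X in expR X]mul1r; apply: expdom_ge; rewrite normr1; lra.
by rewrite (ltr0_norm x0) -mulN1r; apply: expdom_ge; rewrite normrN normr1; lra.
Qed.

Lemma cube_expdom (x : R) : `|x| ^+ 3 * expR (2 * `|x|) <= 432 * expdom x.
Proof.
have [e1 e2] : expR (x / 2) * expR (2 * `|x|) <= expdom x /\
    expR (- (x / 2)) * expR (2 * `|x|) <= expdom x.
  rewrite -!expRD; have [x0|x0] := lerP 0 x.
    rewrite (ger0_norm x0) (_ : x / 2 + 2 * x = 5 / 2 * x); last by field.
    rewrite (_ : - (x / 2) + 2 * x = 3 / 2 * x); last by field.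
    by split; apply: expdom_ge; rewrite ger0_norm; lra.
  rewrite (ltr0_norm x0) (_ : x / 2 + 2 * - x = - (3 / 2) * x); last by field.
  rewrite (_ : - (x / 2) + 2 * - x = - (5 / 2) * x); last by field.
  by split; apply: expdom_ge; rewrite normrN ger0_norm; lra.
have h := ler_wpM2r (expR_ge0 (2 * `|x|)) (cube_le_expR x).
apply: le_trans h _; rewrite -mulrA mulrDl; lra.
Qed.

Lemma sq_le_expdom (x : R) : x ^+ 2 <= 864 * expdom x.
Proof.
have d1 : 1 <= expdom x by rewrite -expR0 -[X in expR X](mul0r x) expdom_ge// normr0.
have h : `|x| ^+ 3 <= 432 * expdom x.
  apply: le_trans (cube_expdom x); rewrite ler_peMr ?exprn_ge0//.
  by rewrite -expR0 ler_expR mulr_ge0.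
rewrite -(real_normK (num_real x)).
have [x1|x1] := leP `|x| 1.
  have : `|x| ^+ 2 <= 1 by rewrite exprn_ile1.
  by lra.
apply: (@le_trans _ _ (`|x| ^+ 3)); last by lra.
by rewrite ler_weXn2l// ltW.
Qed.

Lemma integrable_mean : mu.-integrable setT (fun x => (x * pdf x)%:E).
Proof. by apply: (integrable_dom (f := id)) => //; exact: norm_le_expdom. Qed.

Lemma integrable_sq : mu.-integrable setT (fun x => (x ^+ 2 * pdf x)%:E).
Proof.
apply: (integrable_dom (f := fun x => x ^+ 2)) => [|x].
  exact: measurable_funX.
by rewrite ger0_norm ?sqr_ge0//; exact: sq_le_expdom.
Qed.

(** Integrated second-order expansion of exp(th x), with the first two moments still unknown; its
    left end is the closed form of the moment generating function. *)
Lemma normal_moment12 (th : R) : 0 < th <= 1 ->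
  `|expR (th ^+ 2 * s ^+ 2 / 2)
    - (1 + th * \int[mu]_x (x * pdf x) + th ^+ 2 / 2 * \int[mu]_x (x ^+ 2 * pdf x))|
  <= th ^+ 3 * (432 * (2 * expR (9 * s ^+ 2 / 2))).
Proof.
move=> /andP[th0 th1].
have i1 : mu.-integrable setT (EFin \o pdf) by exact: integrable_normal_pdf.
have i0 : \int[mu]_x pdf x = 1 by rewrite /Rintegral integral_normal_pdf.
have ig := integrable_mgf th.
have im := integrable_mean; have iv := integrable_sq.
have im' : mu.-integrable setT (fun x => (th * (x * pdf x))%:E).
  by under eq_fun do rewrite EFinM; exact: integrableZl.
have iv' : mu.-integrable setT (fun x => (th ^+ 2 / 2 * (x ^+ 2 * pdf x))%:E).
  by under eq_fun do rewrite EFinM; exact: integrableZl.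
have im1 : mu.-integrable setT (fun x => (pdf x + th * (x * pdf x))%:E).
  by under eq_fun do rewrite EFinD; exact: integrableD.
have im2 : mu.-integrable setT (fun x => (pdf x + th * (x * pdf x)
     + th ^+ 2 / 2 * (x ^+ 2 * pdf x))%:E).
  by under eq_fun do rewrite EFinD; exact: integrableD.
rewrite -normal_mgf -{1}i0 -RintegralZl// -RintegralZl// -RintegralD// -RintegralD//.
rewrite -RintegralB//.
have id3 : mu.-integrable setT (fun x => (expdom x * pdf x)%:E).
  apply: (integrable_dom (f := expdom) (C := 1)).
    by apply: measurable_funD; apply: measurableT_comp => //; exact: measurable_funM.
  by move=> x; rewrite mul1r ger0_norm// addr_ge0 ?expR_ge0.
have ib : mu.-integrable setT (fun x => (expR (th * x) * pdf x - (pdf x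
     + th * (x * pdf x) + th ^+ 2 / 2 * (x ^+ 2 * pdf x)))%:E).
  by under eq_fun do rewrite EFinB; exact: integrableB.
have id4 : mu.-integrable setT (fun x => (432 * (expdom x * pdf x))%:E).
  by under eq_fun do rewrite EFinM; exact: integrableZl.
have id5 : mu.-integrable setT (fun x => (th ^+ 3 * (432 * (expdom x * pdf x)))%:E).
  by under eq_fun do rewrite EFinM; exact: integrableZl.
apply: le_trans (le_normr_Rintegral _ ib) _ => //.
rewrite -normal_dom_bound -(RintegralZl 432 measurableT id3) -(RintegralZl (th ^+ 3) measurableT id4).
apply: (le_Rintegral measurableT _ id5); first exact/integrable_norm.
move=> x _.
have -> : expR (th * x) * pdf x - (pdf x + th * (x * pdf x) + th ^+ 2 / 2 * (x ^+ 2 * pdf x))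
   = (expR (th * x) - (1 + th * x + (th * x) ^+ 2 / 2)) * pdf x by field.
have p0 : 0 <= pdf x by exact: normal_pdf_ge0.
rewrite normrM (ger0_norm p0) (mulrA 432) (mulrA (th ^+ 3)) ler_wpM2r//.
apply: le_trans (expR_taylor2 _) _.
rewrite normrM (gtr0_norm th0) exprMn.
have th3 : 0 <= th ^+ 3 by rewrite exprn_ge0// ltW.
have -> : th ^+ 3 * `|x| ^+ 3 * expR (2 * (th * `|x|))
  = th ^+ 3 * (`|x| ^+ 3 * expR (2 * (th * `|x|))) by ring.
apply: (ler_wpM2l th3); apply: le_trans (cube_expdom x).
by rewrite ler_wpM2l ?exprn_ge0// ler_expR ler_wpM2l// ler_piMl.
Qed.

Lemma small_poly_zero (a b C t0 : R) : 0 < t0 ->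
  (forall t, 0 < t <= t0 -> `|t * a + t ^+ 2 * b| <= C * t ^+ 3) -> a = 0 /\ b = 0.
Proof.
move=> t00 H.
have C0 : 0 <= C.
  have t0' : 0 < t0 <= t0 by rewrite t00 lexx.
  have := le_trans (normr_ge0 _) (H t0 t0'); rewrite pmulr_lge0//.
  by rewrite exprn_gt0.
have lin (x D : R) : 0 <= D -> (forall t, 0 < t <= t0 -> `|x| <= D * t) -> x = 0.
  move=> D0 Hx; apply/eqP; rewrite -normr_le0; apply/ler_addgt0Pl => e e0.
  rewrite addr0.
  pose t := Num.min t0 (e / (D + 1)).
  have D1 : 0 < D + 1 by lra.
  have tpos : 0 < t by rewrite lt_min t00 divr_gt0.
  have tt0 : t <= t0 by rewrite ge_min lexx.
  have te : t <= e / (D + 1) by rewrite ge_min lexx orbT.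
  apply: le_trans (Hx t _) _; first by rewrite tpos.
  move: te; rewrite ler_pdivlMr// => te.
  by apply: le_trans te; rewrite mulrC ler_wpM2l ?(ltW tpos)//; lra.
have a0 : a = 0.
  apply: (lin a (C * t0 + `|b|)).
    by rewrite addr_ge0// mulr_ge0// ltW.
  move=> t /andP[tp tt]; have := H t; rewrite tp tt => /(_ isT).
  have -> : t * a + t ^+ 2 * b = t * (a + t * b) by ring.
  rewrite normrM (gtr0_norm tp) (_ : C * t ^+ 3 = t * (C * t ^+ 2)); last by ring.
  rewrite ler_pM2l// => h.
  have -> : a = (a + t * b) - t * b by ring.
  apply: le_trans (ler_normB _ _) _; rewrite normrM (gtr0_norm tp).
  have : C * t ^+ 2 <= C * t0 * t.
    by rewrite -mulrA ler_wpM2l// expr2 ler_wpM2r// ltW.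
  by lra.
split=> //; apply: (lin b C) => // t /andP[tp tt].
have := H t; rewrite tp tt a0 mulr0 add0r => /(_ isT).
rewrite normrM (ger0_norm (sqr_ge0 t)) (_ : C * t ^+ 3 = t ^+ 2 * (C * t)); last by ring.
by rewrite ler_pM2l// exprn_gt0.
Qed.

(** The expansions of exp(th^2 s^2/2), one explicit and one through the moments, agree to order
    th^3, so their coefficients of th and th^2 coincide. *)
Lemma normal_mean_var : \int[mu]_x (x * pdf x) = 0 /\ \int[mu]_x (x ^+ 2 * pdf x) = s ^+ 2.
Proof.
set m1 := \int[mu]_x _; set m2 := \int[mu]_x (_ ^+ 2 * _).
pose K := 432 * (2 * expR (9 * s ^+ 2 / 2)).
pose t0 := Num.min 1 s^-1.
have t00 : 0 < t0 by rewrite lt_min ltr01 invr_gt0.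
have [] := @small_poly_zero m1 ((m2 - s ^+ 2) / 2) (K + s ^+ 4) t0 t00.
  move=> t /andP[tp]; rewrite /t0 le_min => /andP[t1 ts].
  have := @normal_moment12 t; rewrite tp t1 => /(_ isT).
  rewrite -/m1 -/m2 -/K => h.
  set u := t ^+ 2 * s ^+ 2 / 2 in h *.
  have tsq : t * s <= 1 by rewrite -ler_pdivlMr// mul1r.
  have ts0 : 0 <= t * s by rewrite mulr_ge0// ltW.
  have u0 : 0 <= u by rewrite /u divr_ge0// mulr_ge0 ?sqr_ge0.
  have u1 : u <= 1 / 2.
    rewrite /u -exprMn ler_wpM2r ?invr_ge0// exprn_ile1//.
  have e1 := expR_quad_bound u1.
  have e2 := expR_ge1Dx u.
  have hu : `|expR u - 1 - u| <= 2 * u ^+ 2.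
    by rewrite ger0_norm; lra.
  have -> : t * m1 + t ^+ 2 * ((m2 - s ^+ 2) / 2)
    = (expR u - 1 - u) - (expR u - (1 + t * m1 + t ^+ 2 / 2 * m2)).
    by rewrite /u; field.
  apply: le_trans (ler_normB _ _) _; apply: le_trans (lerD hu h) _.
  have t43 : t ^+ 4 <= t ^+ 3 by rewrite ler_wiXn2l// ltW.
  have -> : 2 * u ^+ 2 = s ^+ 4 / 2 * t ^+ 4 by rewrite /u; field.
  have s4 : 0 <= s ^+ 4 by rewrite exprn_ge0// ltW.
  have t3 : 0 <= t ^+ 3 by rewrite exprn_ge0// ltW.
  have : s ^+ 4 / 2 * t ^+ 4 <= s ^+ 4 * t ^+ 3.
    have t4 : 0 <= t ^+ 4 by rewrite exprn_ge0// ltW.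
    by have := ler_wpM2l s4 t43; have := mulr_ge0 s4 t4; lra.
  by lra.
by move=> -> h; split=> //; lra.
Qed.

(** [cube_le_expR] at x/s and the moment generating function at +1/(2s) and -1/(2s), where its value
    is exp(1/8) <= e. *)
Lemma normal_third : mu.-integrable setT (fun x => (`|x| ^+ 3 * pdf x)%:E) /\
  \int[mu]_x (`|x| ^+ 3 * pdf x) <= 432 * expR 1 * s ^+ 3.
Proof.
have m3 : measurable_fun setT (fun x : R => `|x| ^+ 3).
  by apply: measurable_funX; exact: normr_measurable.
have i3 : mu.-integrable setT (fun x => (`|x| ^+ 3 * pdf x)%:E).
  apply: (integrable_dom (f := fun x => `|x| ^+ 3) (C := 432)) => // x.
  rewrite ger0_norm ?exprn_ge0//; apply: le_trans (cube_expdom x).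
  by rewrite ler_peMr ?exprn_ge0// -expR0 ler_expR mulr_ge0.
split=> //.
have e (a : R) : a ^+ 2 = (2 * s)^-1 ^+ 2 -> \int[mu]_x (expR (a * x) * pdf x) <= expR 1.
  move=> ha; rewrite normal_mgf ha ler_expR.
  have -> : (2 * s)^-1 ^+ 2 * s ^+ 2 / 2 = 1 / 8 by field.
  by lra.
have h1 := e (2 * s)^-1 erefl.
have h2 := e (- (2 * s)^-1) (sqrrN _).
have ie (a : R) : mu.-integrable setT (fun x => (216 * s ^+ 3 * (expR (a * x) * pdf x))%:E).
  by under eq_fun do rewrite EFinM; apply: integrableZl => //; exact: integrable_mgf.
have ie2 : mu.-integrable setT (fun x => (216 * s ^+ 3 * (expR ((2 * s)^-1 * x) * pdf x)
    + 216 * s ^+ 3 * (expR (- (2 * s)^-1 * x) * pdf x))%:E).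
  by under eq_fun do rewrite EFinD; apply: integrableD.
apply: (@le_trans _ _ (\int[mu]_x (216 * s ^+ 3 * (expR ((2 * s)^-1 * x) * pdf x)
    + 216 * s ^+ 3 * (expR (- (2 * s)^-1 * x) * pdf x)))).
  apply: (le_Rintegral measurableT i3 ie2).
  move=> x _; rewrite -mulrDr -mulrDl mulrA ler_wpM2r ?normal_pdf_ge0//.
  have h := cube_le_expR (x / s).
  have -> : `|x| ^+ 3 = s ^+ 3 * `|x / s| ^+ 3.
    by rewrite normrM normfV (gtr0_norm s0) exprMn mulrCA -exprMn divff// expr1n mulr1.
  have -> : (2 * s)^-1 * x = x / s / 2 by field.
  have -> : - (2 * s)^-1 * x = - (x / s / 2) by field.
  have s3 : 0 <= s ^+ 3 by rewrite exprn_ge0// ltW.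
  by have := ler_wpM2l s3 h; lra.
have ea (a : R) : \int[mu]_x (216 * s ^+ 3 * (expR (a * x) * pdf x))
    = 216 * s ^+ 3 * \int[mu]_x (expR (a * x) * pdf x).
  exact: (RintegralZl _ measurableT (integrable_mgf a)).
rewrite (RintegralD measurableT (ie _) (ie _)) !ea.
have s3 : 0 <= s ^+ 3 by rewrite exprn_ge0// ltW.
move: (ler_wpM2l s3 h1) (ler_wpM2l s3 h2).
move: (\int[mu]_x _) (\int[mu]_x _) (expR 1) => I1 I2 e1; clear; lra.
Qed.

End NormalMoments.

Section SmoothLip.
Context {R : realFieldType}.
Variables (dir : nat -> nat -> R) (c : R).

Fixpoint vsum (ts : seq R) : nat -> R :=
  if ts is t :: ts' then vadd (vsum ts') t (dir (size ts')) else fun=> 0.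

Lemma smooth_shift f t e : smooth dir c f -> smooth dir c (fun y => f (vadd y t e)).
Proof.
move=> sf k; have [a [b ab]] := sf k.
exists (fun y => a (vadd y t e)), (fun y => b (vadd y t e)) => y.
have [h1 h2 h3] := ab (vadd y t e); split=> // u.
by rewrite vaddC.
Qed.

(** A modulus of continuity drawn from the Taylor estimate: linear, quadratic and cubic terms, each
    with constant at most c. *)
Definition lipmod (t : R) : R := c * (t + t ^+ 2 + t ^+ 3).

Lemma smooth_lipmod f : smooth dir c f -> forall y k t,
  `|f (vadd y t (dir k)) - f y| <= lipmod `|t|.
Proof.
move=> sf y k t; have [a [b /(_ y)[ay byy /(_ t)]]] := sf k.
set D := f _ - f y => T.
have -> : D = (D - a y * t - b y * t ^+ 2 / 2) + (a y * t + b y * t ^+ 2 / 2) by ring.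
apply: le_trans (ler_normD _ _) _; apply: le_trans (lerD T (ler_normD _ _)) _.
have h1 : `|a y * t| <= c * `|t| by rewrite normrM ler_wpM2r.
have h2 : `|b y * t ^+ 2 / 2| <= c * `|t| ^+ 2.
  rewrite normrM normfV (ger0_norm (ler0n _ 2)) normrM normrX.
  have : `|b y| * `|t| ^+ 2 <= c * `|t| ^+ 2 by rewrite ler_wpM2r// exprn_ge0.
  have : 0 <= `|b y| * `|t| ^+ 2 by rewrite mulr_ge0// exprn_ge0.
  by move=> ? ?; rewrite ler_pdivrMr//; lra.
by rewrite /lipmod; lra.
Qed.

Lemma vsum_lip (ts ts' : seq R) f : smooth dir c f -> size ts = size ts' ->
  `|f (vsum ts) - f (vsum ts')| <= \sum_(p <- zip ts ts') lipmod `|p.1 - p.2|.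
Proof.
elim: ts ts' f => [|t ts IH] [|t' ts'] f sf //=.
  by rewrite subrr normr0 big_nil.
move=> [ss]; rewrite big_cons /= ss.
set e := dir _.
have -> : f (vadd (vsum ts) t e) - f (vadd (vsum ts') t' e)
  = (f (vadd (vsum ts) t e) - f (vadd (vsum ts') t e))
   + (f (vadd (vsum ts') t e) - f (vadd (vsum ts') t' e)) by ring.
apply: le_trans (ler_normD _ _) _; rewrite addrC; apply: lerD.
  rewrite (_ : vadd (vsum ts') t e = vadd (vadd (vsum ts') t' e) (t - t') e).
    exact: smooth_lipmod.
  by apply/funext => r; rewrite /vadd; ring.
exact: (IH ts' (fun y => f (vadd y t e)) (smooth_shift t e sf) ss).
Qed.

End SmoothLip.

(** * Rounding of real variables to finitely many values *)

Section Rounding.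
Context {R : realType}.
Implicit Types (n i : nat) (x : R).

(** Kernels have natural numbers as entries, so Gaussian increments are rounded to mesh 1/(n+1) on
    [-n, n]. Values outside are sent to the index n (n + 1), whose [rval] is 0. *)
Definition ridx n x : nat :=
  if `|x| <= n%:R then Num.truncn ((x + n%:R) * n.+1%:R) else (n * n.+1)%N.

Definition rval n i : R := i%:R / n.+1%:R - n%:R.

Definition rmax n : nat := (n.*2 * n.+1)%N.

Lemma ridx_itv n x : `|x| <= n%:R ->
  (ridx n x)%:R <= (x + n%:R) * n.+1%:R < (ridx n x).+1%:R.
Proof.
move=> xn; rewrite /ridx xn; apply: truncn_itv.
by apply: mulr_ge0 => //; move: xn; rewrite ler_norml => /andP[]; lra.
Qed.

Lemma ridx_max n x : (ridx n x <= rmax n)%N.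
Proof.
have [xn|xn] := boolP (`|x| <= n%:R).
  have /andP[h _] := ridx_itv xn.
  rewrite -(ler_nat R); apply: le_trans h _.
  rewrite /rmax natrM ler_wpM2r// -addnn natrD.
  by move: xn; rewrite ler_norml => /andP[]; lra.
by rewrite /ridx (negbTE xn) /rmax -addnn mulnDl leq_addr.
Qed.

Lemma rval_near n x : `|x| <= n%:R -> `|rval n (ridx n x) - x| <= n.+1%:R^-1.
Proof.
move=> xn; have /andP[h1 h2] := ridx_itv xn.
have n0 : 0 < n.+1%:R :> R by rewrite ltr0n.
rewrite /rval; set i := (ridx n x)%:R in h1 *.
have {h2} h2 : (x + n%:R) * n.+1%:R < i + 1 by rewrite /i natr1.
have g1 : i / n.+1%:R <= x + n%:R by rewrite ler_pdivrMr.
have g2 : x + n%:R <= i / n.+1%:R + n.+1%:R^-1.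
  have -> : i / n.+1%:R + n.+1%:R^-1 = (i + 1) / n.+1%:R by rewrite mulrDl mul1r.
  by rewrite ler_pdivlMr// ltW.
have : 0 <= n.+1%:R^-1 :> R by rewrite invr_ge0 ltW.
move: g1 g2; rewrite ler_norml; move: (n.+1%:R^-1) (i / n.+1%:R) => v q g1 g2 v0.
by apply/andP; split; lra.
Qed.

Lemma rval_far n x : n%:R < `|x| -> rval n (ridx n x) = 0.
Proof.
by move=> xn; rewrite /rval /ridx leNgt xn /= natrM mulfK ?subrr.
Qed.

Lemma rval_le n x : `|rval n (ridx n x)| <= `|x| + 1.
Proof.
have [xn|xn] := leP `|x| n%:R; last by rewrite rval_far// normr0 addr_ge0.
have h := rval_near xn.
have -> : rval n (ridx n x) = x + (rval n (ridx n x) - x) by ring.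
apply: le_trans (ler_normD _ _) _; rewrite lerD2l; apply: le_trans h _.
by rewrite invf_le1// ?ler1n ?ltr0n.
Qed.

Lemma rval_cvg x : rval n (ridx n x) @[n --> \oo] --> x.
Proof.
apply/cvgrPdist_le => e e0; near=> n.
have xn : `|x| <= n%:R.
  near: n; exists (Num.truncn `|x|).+1 => // m /= hm.
  by apply: le_trans (ltW (truncnS_gt _)) _; rewrite ler_nat.
rewrite distrC; apply: le_trans (rval_near xn) _.
rewrite invf_ple ?posrE ?ltr0n//.
near: n; exists (Num.truncn e^-1).+1 => // m /= hm.
by apply: le_trans (ltW (truncnS_gt _)) _; rewrite ler_nat leqW.
Unshelve. all: by end_near. Qed.

Lemma measurable_ridx n i : measurable [set x | ridx n x = i].
Proof.
have n0 : 0 < n.+1%:R :> R by rewrite ltr0n.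
rewrite (_ : [set x | _] =
   (`[- n%:R, n%:R]%classic `&` `[i%:R / n.+1%:R - n%:R, i.+1%:R / n.+1%:R - n%:R[%classic)
   `|` (~` `[- n%:R, n%:R]%classic `&` (if i == (n * n.+1)%N then setT else set0))).
  apply: measurableU; apply: measurableI.
  - exact: measurable_itv.
  - exact: measurable_itv.
  - by apply: measurableC; exact: measurable_itv.
  - by case: ifP => _; [exact: measurableT|exact: measurable0].
apply/seteqP; split => x /=; rewrite !in_itv /= -ler_norml.
  move=> xi; have [xn|xn] := boolP (`|x| <= n%:R).
    left; split=> //; have := ridx_itv xn; rewrite xi => /andP[h1 h2].
    by rewrite lerBlDr ltrBrDr ler_pdivrMr// ltr_pdivlMr// h1.
  right; split; first exact/negP.
  by rewrite -xi /ridx (negbTE xn) eqxx.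
move=> [[xn]|[/negP xn]].
  rewrite lerBlDr ltrBrDr ler_pdivrMr// ltr_pdivlMr// => h.
  by rewrite /ridx xn; apply: truncn_def.
by rewrite /ridx (negbTE xn); case: eqP.
Qed.

Lemma measurable_fun_nat d (T : measurableType d) (X : T -> nat) (g : nat -> R) :
  (forall i, measurable [set w | X w = i]) -> measurable_fun setT (g \o X).
Proof.
move=> mX _ B mB; rewrite setTI.
rewrite (_ : _ @^-1` _ = \bigcup_i (if `[< B (g i) >] then [set w | X w = i] else set0)).
  by apply: bigcupT_measurable => i; case: ifP => _; [exact: mX|exact: measurable0].
apply/seteqP; split => w /=.
  by move=> Bw; exists (X w) => //; rewrite asboolT.
by move=> [i _]; case: asboolP => //= Bi ->.
Qed.

End Rounding.

Section DiscreteNormal.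
Context {R : realType} (s : R).
Hypothesis s0 : 0 < s.
Local Notation mu := (@lebesgue_measure R).
Local Notation pdf := (normal_pdf 0 s).

Definition rweight (n i : nat) : R := fine (normal_prob 0 s [set x : R | ridx n x = i]).

Lemma rweight_ge0 n i : 0 <= rweight n i.
Proof. by apply: fine_ge0; exact: measure_ge0. Qed.

Lemma sum_rweight n (g : nat -> R) :
  \sum_(i < (rmax n).+1) rweight n i * g i = \int[mu]_x (g (ridx n x) * pdf x).
Proof.
have ip i : mu.-integrable setT (fun x => (\1_[set x : R | ridx n x = i] x * pdf x)%:E).
  have mi : measurable_fun setT (\1_[set x : R | ridx n x = i] : R -> R).
    by apply: measurable_indic; exact: (@measurable_ridx R n i).
  apply: (le_integrable measurableT _ _ (integrable_normal_pdf (0 : R) s)).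
    by apply/measurable_EFinP/measurable_funM => //; exact: measurable_normal_pdf.
  move=> x _; rewrite !abse_EFin lee_fin normrM ler_piMl//.
  by rewrite indicE; case: (_ \in _); rewrite ?normr0 ?normr1.
have wE i : rweight n i = \int[mu]_x (\1_[set x : R | ridx n x = i] x * pdf x).
  rewrite /rweight /normal_prob integral_mkcond /Rintegral; congr fine.
  apply: eq_integral => x _; rewrite patchE indicE.
  by case: ifP => _; rewrite ?mul1r ?mul0r.
have ip' i : mu.-integrable setT
    (fun x => (g i * (\1_[set x : R | ridx n x = i] x * pdf x))%:E).
  by under eq_fun do rewrite EFinM; exact: integrableZl.
under eq_bigr do rewrite wE mulrC -(RintegralZl _ measurableT (ip _)).
transitivity (\int[mu]_x (\sum_(i < (rmax n).+1)
    g i * (\1_[set x : R | ridx n x = i :> nat] x * pdf x))).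
  rewrite sum_fine; last by move=> i _; exact: (integrable_fin_num measurableT (ip' i)).
  rewrite -integral_sum; [|exact: measurableT|by move=> i; exact: ip'].
  rewrite /Rintegral; congr fine; apply: eq_integral => x _.
  by rewrite sumEFin.
apply: eq_Rintegral => x _.
rewrite (bigD1 (Ordinal (ridx_max n x : (ridx n x < (rmax n).+1)%N)))//=.
rewrite indicE mem_set//= mul1r big1 ?addr0// => i ix.
rewrite indicE memNset ?mul0r ?mulr0//= => e.
by move: ix; rewrite -val_eqE /= e eqxx.
Qed.

Lemma sum_rweight1 n : \sum_(i < (rmax n).+1) rweight n i = 1.
Proof.
transitivity (\sum_(i < (rmax n).+1) rweight n i * (fun=> 1) i).
  by apply: eq_bigr => i _; rewrite mulr1.
rewrite (sum_rweight n (fun=> 1)); under eq_Rintegral do rewrite mul1r.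
by rewrite /Rintegral integral_normal_pdf.
Qed.

(** Dominated convergence: a rounded value is at most |x| + 1 in absolute value, and (|x| + 1)^3 is
    integrable. *)
Lemma rmoment_cvg (h : R -> R) : continuous h -> measurable_fun setT h ->
  (forall x y : R, `|y| <= `|x| + 1 -> `|h y| <= (`|x| + 1) ^+ 3) ->
  \sum_(i < (rmax n).+1) rweight n i * h (rval n i) @[n --> \oo]
    --> \int[mu]_x (h x * pdf x).
Proof.
move=> ch mh hle.
have -> : (fun n => \sum_(i < (rmax n).+1) rweight n i * h (rval n i))
    = (fun n => \int[mu]_x (h (rval n (ridx n x)) * pdf x)).
  by apply/funext => n; exact: (sum_rweight n (fun i => h (rval n i))).
have [i3 _] := normal_third s0.
have i1 := integrable_normal_pdf (0 : R) s.
apply: (@Rint_dct _ _ R mu (fun n x => h (rval n (ridx n x)) * pdf x)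
  (fun x => h x * pdf x) (fun x => 4 * (pdf x + `|x| ^+ 3 * pdf x))).
- move=> n; apply: measurable_funM; last exact: measurable_normal_pdf.
  apply: (measurable_fun_nat (X := ridx n) (fun i => h (rval n i))) => i.
  exact: measurable_ridx.
- by apply: measurable_funM => //; exact: measurable_normal_pdf.
- move=> x.
  have h1 : h (rval n (ridx n x)) @[n --> \oo] --> h x.
    by apply: continuous_cvg; [exact: ch|exact: rval_cvg].
  exact: (cvgM h1 (cvg_cst (pdf x))).
- have h1 : mu.-integrable setT (fun x => (4 * (pdf x + `|x| ^+ 3 * pdf x))%:E).
    under eq_fun do rewrite EFinM EFinD; apply: integrableZl => //.
    exact: (integrableD measurableT i1 i3).
  exact: h1.
- move=> n x; have p0 : 0 <= pdf x by exact: normal_pdf_ge0.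
  rewrite normrM (ger0_norm p0).
  rewrite (_ : 4 * _ = 4 * (1 + `|x| ^+ 3) * pdf x); last by ring.
  rewrite ler_wpM2r//.
  apply: le_trans (hle x _ (rval_le n x)) _.
  have := normr_ge0 x; set a := `|x| => a0.
  (* The claim (1 + a)^3 <= 4 (1 + a^3) has difference 3 (1 - a)^2 (1 + a). *)
  have : 0 <= (1 - a) ^+ 2 * (1 + a) by rewrite mulr_ge0 ?sqr_ge0//; lra.
  lra.
Qed.

End DiscreteNormal.

Lemma cvg_expn (R : realType) (T : Type) (F : set_system T) (FF : Filter F)
  (f : T -> R) (l : R) n : f @ F --> l -> f x ^+ n @[x --> F] --> l ^+ n.
Proof.
move=> fl; elim: n => [|n IH]; first by rewrite expr0; exact: cvg_cst.
rewrite exprS; have -> : (fun x => f x ^+ n.+1) = (fun x => f x * f x ^+ n).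
  by apply/funext => x; rewrite exprS.
exact: cvgM.
Qed.

Lemma cvg_sum0 (R : realType) (L : nat) (u : nat -> nat -> R) :
  (forall k, (k < L)%N -> u n k @[n --> \oo] --> 0) ->
  \sum_(k < L) u n k @[n --> \oo] --> 0.
Proof.
elim: L => [|L IH] H.
  by under eq_fun do rewrite big_ord0; exact: cvg_cst.
have h1 : \sum_(k < L) u n k @[n --> \oo] --> 0 by apply: IH => k kL; apply: H; exact: ltnW.
have h2 := H L (ltnSn L).
have h3 : \sum_(k < L) u n k + u n L @[n --> \oo] --> (0 + 0 : R) by exact: cvgD.
rewrite addr0 in h3.
by under eq_fun do rewrite big_ord_recr.
Qed.

Lemma scaled_error_bound (R : realFieldType) (a e r I D g : R) :
  a * (r - I) <= a * D -> a * I <= a * (432 * e * g) ->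
  a * r <= 432 * e * (a * g) + a * D.
Proof. by move=> *; lra. Qed.

Lemma lerD3_split (R : realFieldType) (x1 x2 x3 y1 y2 y3 z1 z2 z3 t : R) :
  x1 <= y1 + z1 -> x2 <= y2 + z2 -> x3 <= y3 + z3 ->
  x1 + x2 + (t + x3) <= y1 + y2 + (t + y3) + (z1 + z2 + z3).
Proof. by move=> *; lra. Qed.

(** * Replacement of the increments by those of a Brownian motion *)

Section GaussTree.
Context {R : realType} {d : measure_display} {T : measurableType d}.
Variables (P : probability T R) (B : T -> R -> R).
Variables (tau al : nat -> R) (L : nat).
Hypothesis BM : brownian P B.
Hypothesis tau0 : tau 0 = 0.
Hypothesis tauS : forall k, (k < L)%N -> tau k < tau k.+1.

Definition gincr (k : nat) (w : T) : R := B w (tau k.+1) - B w (tau k).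

Definition gsd (k : nat) : R := Num.sqrt (tau k.+1 - tau k).

Lemma gsd_gt0 k : (k < L)%N -> 0 < gsd k.
Proof. by move=> kL; rewrite sqrtr_gt0 subr_gt0 tauS. Qed.

Let gK_lin n (s : seq nat) (a : R) (g h : nat -> R) :
  \sum_(i < (rmax n).+1) rweight (gsd (size s)) n i * (a * g i + h i) =
  a * (\sum_(i < (rmax n).+1) rweight (gsd (size s)) n i * g i)
  + \sum_(i < (rmax n).+1) rweight (gsd (size s)) n i * h i.
Proof. by rewrite mulr_sumr -big_split /=; apply: eq_bigr => i _; ring. Qed.

Let gK_mono n (s : seq nat) (g h : nat -> R) :
  (forall x, (x <= rmax n)%N -> g x <= h x) ->
  \sum_(i < (rmax n).+1) rweight (gsd (size s)) n i * g i
  <= \sum_(i < (rmax n).+1) rweight (gsd (size s)) n i * h i.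
Proof.
move=> gh; apply: ler_sum => i _; apply: ler_wpM2l; first exact: rweight_ge0.
by apply: gh; rewrite -ltnS.
Qed.

Let gK_cst n (s : seq nat) (c : R) :
  \sum_(i < (rmax n).+1) rweight (gsd (size s)) n i * c = c.
Proof. by rewrite -mulr_suml sum_rweight1 mul1r. Qed.

Definition gaussK n : kern R := @Kern R
  (fun s g => \sum_(i < (rmax n).+1) rweight (gsd (size s)) n i * g i)
  (fun=> rmax n) (gK_lin n) (@gK_mono n) (gK_cst n).

Definition gxi n (s : seq nat) (i : nat) : R := al (size s) * rval n i.

Definition gX n k w : nat := ridx n (gincr k w).

Lemma measurable_gincr k : measurable_fun setT (gincr k).
Proof. by have [mB _ _ _] := BM; apply: measurable_funB; exact: mB. Qed.

Lemma measurable_gX n k i : measurable [set w | gX n k w = i].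
Proof.
have := measurable_gincr k measurableT (measurable_ridx n i).
by rewrite setTI.
Qed.

(** Independence of the Brownian increments, applied to the rounding cells; [rev] restores
    chronological order. *)
Lemma gauss_path n k s : (k <= L)%N -> size s = k ->
  fine (P [set w | pathX (gX n) k w = s])
  = \prod_(j < k) rweight (gsd j) n (nth 0%N (rev s) j).
Proof.
move=> kL sk; have [_ _ _ H] := BM.
have tS j : (j < k)%N -> tau j < tau j.+1.
  by move=> jk; apply: tauS; exact: leq_trans jk kL.
have := H k tau (fun j => [set x | ridx n x = nth 0%N (rev s) j]) tau0 tS
   (fun j => measurable_ridx n _).
rewrite (_ : [set w | forall j, _] = [set w | pathX (gX n) k w = s]); last first.
  apply/seteqP; split => w /=.
    move=> h; have {}h j : (j < k)%N -> gX n j w = nth 0%N (rev s) j by exact: h.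
    elim: k s sk h {kL tS} => [|k IH] [|x s] //= [sk] h.
    have := h k (ltnSn k).
    rewrite rev_cons nth_rcons size_rev sk ltnn eqxx => ->; congr (_ :: _).
    apply: IH => // j jk; rewrite (h j (ltnW jk)).
    by rewrite rev_cons nth_rcons size_rev sk jk.
  elim: k s sk {kL tS} => [|k IH] [|x s] //= [sk] [<- e] j.
  rewrite ltnS leq_eqVlt rev_cons nth_rcons size_rev sk => /orP[/eqP->|jk].
    by rewrite ltnn eqxx.
  by rewrite jk; exact: (IH s).
move=> ->.
have -> : (\prod_(j < k) normal_prob 0 (Num.sqrt (tau j.+1 - tau j))
      [set x | ridx n x = nth 0%N (rev s) j])%E
   = (\prod_(j < k) rweight (gsd j) n (nth 0%N (rev s) j))%:E.
  rewrite -prodEFin; apply: eq_bigr => j _; rewrite /rweight fineK//.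
  by apply: fin_num_measure; exact: measurable_ridx.
by [].
Qed.

Lemma gauss_law n k s x : (k < L)%N -> size s = k ->
  fine (P [set w | pathX (gX n) k w = s /\ gX n k w = x])
  = fine (P [set w | pathX (gX n) k w = s]) * gaussK n s (fun y => (y == x)%:R).
Proof.
move=> kL sk.
have -> : [set w | pathX (gX n) k w = s /\ gX n k w = x]
   = [set w | pathX (gX n) k.+1 w = x :: s].
  by apply/seteqP; split => w /= [-> ->].
have [xm|xm] := leqP x (rmax n); last first.
  rewrite (_ : [set _ | _] = set0) ?measure0; last first.
    apply/seteqP; split => w //= [xe _]; move: xm; rewrite -xe /gX ltnNge.
    by rewrite ridx_max.
  rewrite /= big1 ?mulr0// => i _.
  rewrite (_ : (nat_of_ord i == x) = false) ?mulr0//.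
  by apply/eqP => e; move: xm; rewrite -e ltnNge -ltnS ltn_ord.
have sxk : size (x :: s) = k.+1 by rewrite /= sk.
rewrite (gauss_path n kL sxk) (gauss_path n (ltnW kL) sk).
rewrite big_ord_recr /=; congr (_ * _).
  apply: eq_bigr => j _; congr rweight.
  by rewrite rev_cons nth_rcons size_rev sk ltn_ord.
rewrite rev_cons nth_rcons size_rev sk ltnn eqxx.
rewrite (bigD1 (Ordinal (xm : (x < (rmax n).+1)%N)))//= eqxx mulr1 big1 ?addr0//.
move=> i ix; rewrite (_ : (nat_of_ord i == x) = false) ?mulr0//.
by apply: contra_neqF ix => /eqP e; exact/val_inj.
Qed.

Variables (dir : nat -> nat -> R) (c C : R) (f : (nat -> R) -> R).
Hypothesis sf : smooth dir c f.
Hypothesis fC : forall y, `|f y| <= C.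

Fixpoint gts (k : nat) (w : T) : seq R :=
  if k is k'.+1 then al k' * gincr k' w :: gts k' w else [::].

Fixpoint rts n (k : nat) (w : T) : seq R :=
  if k is k'.+1 then al k' * rval n (gX n k' w) :: rts n k' w else [::].

Lemma size_gts k w : size (gts k w) = k. Proof. by elim: k => //= k ->. Qed.
Lemma size_rts n k w : size (rts n k w) = k. Proof. by elim: k => //= k ->. Qed.

Lemma vpath_rts n k w :
  vpath dir (gxi n) (pathX (gX n) k w) = vsum dir (rts n k w).
Proof.
elim: k => [//|k IH] /=.
by rewrite IH /gxi size_pathX size_rts.
Qed.

Lemma c_ge0 : 0 <= c.
Proof. by have [a [b /(_ (fun=> 0)) [h _ _]]] := sf 0; apply: le_trans h. Qed.

Lemma f_rts_cvg k w :
  f (vsum dir (rts n k w)) @[n --> \oo] --> f (vsum dir (gts k w)).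
Proof.
pose u n j := lipmod c `|al j * rval n (gX n j w) - al j * gincr j w|.
have le n : `|f (vsum dir (rts n k w)) - f (vsum dir (gts k w))| <= \sum_(j < k) u n j.
  apply: le_trans (vsum_lip sf _) _; first by rewrite size_rts size_gts.
  elim: k => [|k IH] /=; first by rewrite big_nil big_ord0.
  by rewrite big_cons big_ord_recr /= addrC lerD.
have u0 : \sum_(j < k) u n j @[n --> \oo] --> 0.
  apply: cvg_sum0 => j _.
  have h1 : `|al j * rval n (gX n j w) - al j * gincr j w| @[n --> \oo] --> (0 : R).
    rewrite -(normr0 R) -(subrr (al j * gincr j w)).
    apply: cvg_norm; apply: cvgB; last exact: cvg_cst.
    by apply: cvgM; [exact: cvg_cst|exact: rval_cvg].
  rewrite /u /lipmod (_ : 0 = c * (0 + 0 ^+ 2 + 0 ^+ 3)); last by rewrite !expr0n /=; ring.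
  apply: cvgM; first exact: cvg_cst.
  apply: cvgD; first by apply: cvgD => //; exact: cvg_expn.
  exact: cvg_expn.
apply/cvgrPdist_le => e e0.
move/cvgrPdist_le: u0 => /(_ e e0); apply: filterS => n; rewrite sub0r normrN => h.
rewrite distrC; apply: le_trans (le n) _; exact: le_trans (ler_norm _) h.
Qed.

Lemma measurable_f_rts n k : measurable_fun setT (fun w => f (vsum dir (rts n k w))).
Proof.
under eq_fun do rewrite -vpath_rts.
apply: (@measurable_fun_pathX _ _ _ k (gX n)
  (fun j i _ => measurable_gX n j i) (fun l => f (vpath dir (gxi n) l)) k (leqnn k)).
Qed.

Lemma measurable_f_gts k : measurable_fun setT (fun w => f (vsum dir (gts k w))).
Proof.
apply: (@measurable_fun_cvg _ _ _ setT (fun n w => f (vsum dir (rts n k w)))).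
  by move=> n; exact: measurable_f_rts.
by move=> w _; exact: f_rts_cvg.
Qed.

Lemma gauss_remaining n :
  \int[P]_w f (vsum dir (rts n L w)) = EE (gaussK n) L [::] (fun l => f (vpath dir (gxi n) l)).
Proof.
rewrite -(@tree_law _ _ _ P (gaussK n) L (gX n) (fun j i _ => measurable_gX n j i) _ _ _ C) //.
- by apply: eq_Rintegral => w _; rewrite vpath_rts.
- by move=> k w kL; exact: ridx_max.
- by move=> k s x; exact: gauss_law.
Qed.

Variables (K1 : kern R) (xi1 : seq nat -> nat -> R).

(** [swap_err] with the moments of the rounded Gaussian replaced by the exact mean 0 and variance,
    and by the bound of [normal_third] on the third moment. *)
Definition gerr_step (s : seq nat) : R :=
  c * (`|moment K1 xi1 1 s|
       + `|moment K1 xi1 2 s - al (size s) ^+ 2 * (tau (size s).+1 - tau (size s))|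
       + (absmoment3 K1 xi1 s + 432 * expR 1 * (`|al (size s)| * gsd (size s)) ^+ 3)).

Fixpoint gerr (s : seq nat) : R :=
  if s is _ :: s' then gerr s' + gerr_step s' else 0.

Definition rsum n k (h : R -> R) : R :=
  \sum_(i < (rmax n).+1) rweight (gsd k) n i * h (rval n i).

(** The part of the swap error due to rounding; it vanishes as n grows. *)
Definition rdev n k : R :=
  c * (`|al k * rsum n k id| + `|al k ^+ 2 * (rsum n k (fun x => x ^+ 2) - gsd k ^+ 2)|
   + `|al k| ^+ 3 * `|rsum n k (fun x => `|x| ^+ 3)
         - \int[lebesgue_measure]_x (`|x| ^+ 3 * normal_pdf 0 (gsd k) x)|).

Lemma rdev_cvg k : (k < L)%N -> rdev n k @[n --> \oo] --> 0.
Proof.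
move=> kL; have s0 := gsd_gt0 kL; have [m0 v0] := normal_mean_var s0.
have c1 := @rmoment_cvg _ _ s0 id.
have c2 := @rmoment_cvg _ _ s0 (fun x => x ^+ 2).
have c3 := @rmoment_cvg _ _ s0 (fun x => `|x| ^+ 3).
have ge1 (a : R) j : (j <= 3)%N -> (`|a| + 1) ^+ j <= (`|a| + 1) ^+ 3.
  by move=> j3; rewrite ler_weXn2l// lerDr.
have pw (x y : R) j : (j <= 3)%N -> `|y| <= `|x| + 1 -> `|y| ^+ j <= (`|x| + 1) ^+ 3.
  move=> j3 yx; apply: le_trans (ge1 x j j3).
  by rewrite lerXn2r ?nnegrE// addr_ge0.
have {}c1 : rsum n k id @[n --> \oo] --> 0.
  rewrite -m0; apply: c1 => [x||x y yx]; [exact: cvg_id|exact: measurable_id|].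
  by have := pw x y 1%N isT yx; rewrite expr1.
have {}c2 : rsum n k (fun x => x ^+ 2) @[n --> \oo] --> gsd k ^+ 2.
  rewrite -v0; apply: c2 => [x||x y yx].
  - by apply: cvg_expn; exact: cvg_id.
  - exact: measurable_funX.
  - by rewrite normrX; exact: pw.
have {}c3 : rsum n k (fun x => `|x| ^+ 3) @[n --> \oo] -->
    \int[lebesgue_measure]_x (`|x| ^+ 3 * normal_pdf 0 (gsd k) x).
  apply: c3 => [x||x y yx].
  - by apply: cvg_expn; exact: norm_continuous.
  - by apply: measurable_funX; exact: normr_measurable.
  - by rewrite normrX normr_id; exact: pw.
set I3 := \int[_]_x _ in c3.
have d1 : al k * rsum n k id @[n --> \oo] --> al k * 0.
  by apply: cvgM c1; exact: cvg_cst.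
have d2 : rsum n k (fun x => x ^+ 2) - gsd k ^+ 2 @[n --> \oo] --> gsd k ^+ 2 - gsd k ^+ 2.
  by apply: cvgB; [exact: c2|exact: cvg_cst].
have d2' : al k ^+ 2 * (rsum n k (fun x => x ^+ 2) - gsd k ^+ 2) @[n --> \oo]
    --> al k ^+ 2 * (gsd k ^+ 2 - gsd k ^+ 2).
  by apply: cvgM d2; exact: cvg_cst.
have d3 : rsum n k (fun x => `|x| ^+ 3) - I3 @[n --> \oo] --> I3 - I3.
  by apply: cvgB; [exact: c3|exact: cvg_cst].
have d3' : `|al k| ^+ 3 * `|rsum n k (fun x => `|x| ^+ 3) - I3| @[n --> \oo]
    --> `|al k| ^+ 3 * `|I3 - I3|.
  by apply: cvgM; [exact: cvg_cst|exact: cvg_norm d3].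
have d5 : rdev n k @[n --> \oo] --> c * (`|al k * 0|
    + `|al k ^+ 2 * (gsd k ^+ 2 - gsd k ^+ 2)| + `|al k| ^+ 3 * `|I3 - I3|).
  apply: cvgM; first exact: cvg_cst.
  apply: cvgD; last exact: d3'.
  by apply: cvgD; [exact: (cvg_norm d1)|exact: (cvg_norm d2')].
have e0 : c * (`|al k * 0| + `|al k ^+ 2 * (gsd k ^+ 2 - gsd k ^+ 2)|
   + `|al k| ^+ 3 * `|I3 - I3|) = 0.
  by rewrite !subrr !mulr0 !normr0 mulr0 !addr0 mulr0.
by rewrite -e0; exact: d5.
Qed.

Lemma gaussK_moment n j s : moment (gaussK n) (gxi n) j s
  = al (size s) ^+ j * rsum n (size s) (fun x => x ^+ j).
Proof.
rewrite /moment /= /rsum mulr_sumr; apply: eq_bigr => i _.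
by rewrite /gxi exprMn mulrCA.
Qed.

Lemma gaussK_absmoment3 n s : absmoment3 (gaussK n) (gxi n) s
  = `|al (size s)| ^+ 3 * rsum n (size s) (fun x => `|x| ^+ 3).
Proof.
rewrite /absmoment3 /= /rsum mulr_sumr; apply: eq_bigr => i _.
by rewrite /gxi normrM exprMn mulrCA.
Qed.

Lemma total_err_le n l : (size l <= L)%N ->
  total_err c K1 (gaussK n) xi1 (gxi n) l <= gerr l + \sum_(k < size l) rdev n k.
Proof.
elim: l => [|x s IH] /= sL; first by rewrite big_ord0 addr0.
rewrite big_ord_recr /= addrACA; apply: lerD; first by apply: IH; exact: ltnW.
rewrite /swap_err /gerr_step /rdev -mulrDr ler_wpM2l ?c_ge0//.
rewrite !gaussK_moment gaussK_absmoment3 expr1.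
rewrite (_ : rsum n (size s) (fun x => x ^+ 1) = rsum n (size s) id)//.
set k := size s; set r1 := rsum n k id; set r2 := rsum n k _; set r3 := rsum n k _.
set I3 := \int[_]_x _.
have g2 : gsd k ^+ 2 = tau k.+1 - tau k.
  by rewrite sqr_sqrtr// subr_ge0 ltW// tauS.
have t1 := ler_normB (moment K1 xi1 1 s) (al k * r1).
have t2 : `|moment K1 xi1 2 s - al k ^+ 2 * r2| <=
   `|moment K1 xi1 2 s - al k ^+ 2 * (tau k.+1 - tau k)|
   + `|al k ^+ 2 * (r2 - gsd k ^+ 2)|.
  rewrite -(normrN (al k ^+ 2 * (r2 - _))); apply: le_trans (ler_normD _ _).
  by rewrite g2 le_eqVlt; apply/orP; left; apply/eqP; congr (`|_|); ring.
have t3 : `|al k| ^+ 3 * r3 <= 432 * expR 1 * (`|al k| * gsd k) ^+ 3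
    + `|al k| ^+ 3 * `|r3 - I3|.
  have [_ h3] := normal_third (gsd_gt0 sL).
  have a3 : 0 <= `|al k| ^+ 3 by rewrite exprn_ge0.
  rewrite exprMn.
  by apply: (scaled_error_bound (ler_wpM2l a3 (ler_norm (r3 - I3)))); exact: ler_wpM2l.
exact: lerD3_split.
Qed.

(** [lindeberg] at rounding level n, then n to infinity with L fixed: the integrals converge by
    dominated convergence and the L rounding errors vanish. *)
Lemma lindeberg_gauss :
  `|EE K1 L [::] (fun l => f (vpath dir xi1 l)) - \int[P]_w f (vsum dir (gts L w))|
  <= EE K1 L [::] gerr.
Proof.
set a := EE _ _ _ _; set E := EE K1 L [::] gerr.
have lim1 : \int[P]_w f (vsum dir (rts n L w)) @[n --> \oo]
    --> \int[P]_w f (vsum dir (gts L w)).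
  apply: (@Rint_dct_bdd _ _ _ P (fun n w => f (vsum dir (rts n L w))) _ C) => //.
  - by move=> n; exact: measurable_f_rts.
  - exact: measurable_f_gts.
  - by move=> w; exact: f_rts_cvg.
have lim2 : `|a - \int[P]_w f (vsum dir (rts n L w))| @[n --> \oo]
   --> `|a - \int[P]_w f (vsum dir (gts L w))|.
  by apply: cvg_norm; apply: cvgB => //; exact: cvg_cst.
have lim3 : E + \sum_(k < L) rdev n k @[n --> \oo] --> E + 0.
  by apply: cvgD; [exact: cvg_cst|apply: cvg_sum0 => k; exact: rdev_cvg].
rewrite -[leRHS]addr0; apply: (ler_cvg_to lim2 lim3); apply: nearW => n.
rewrite gauss_remaining (@EE_remaining _ dir (gaussK n) (gxi n)); last 2 first.
- by move=> s s' g ss /=; rewrite ss.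
- by move=> s s' ss; apply/funext => i; rewrite /gxi ss.
have := @lindeberg _ dir c K1 (gaussK n) xi1 (gxi n) _ _ f L [::] sf.
rewrite /= subr0 => h.
apply: le_trans (h _ _) _.
- by move=> s s' g ss /=; rewrite ss.
- by move=> s s' ss; apply/funext => i; rewrite /gxi ss.
rewrite /E -[X in _ + X](EE_cst K1 L [::]) -EED; apply: EE_mono => // l _ sl.
by apply: le_trans (total_err_le n _) _; rewrite sl add0n.
Qed.

End GaussTree.

(** * Estimates on good histories *)

Section ListEstimates.
Context {R : realType} (N : nat) (lam : nat -> R).
Hypothesis lam0 : forall m, 0 <= lam m.
Hypothesis N0 : (0 < N)%N.
Variables (c0 Amax : R) (L : nat).
Hypothesis LN : (L <= N)%N.
Hypothesis lamc : forall m, (m < L)%N -> lam m <= c0 / N%:R.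
Hypothesis AmL : Am lam L <= Amax.
Hypothesis L0 : (0 < L)%N.

Local Notation A := (Am lam).
Local Notation K := (walkK N lam0).
Local Notation sN := (Num.sqrt N%:R : R).
Local Notation Q := (Ql N lam).

Lemma AmaxP i : (i <= L)%N -> A i <= Amax.
Proof. by move=> iL; apply: le_trans AmL; exact: Am_le. Qed.

Lemma valid_pre i l : valid K l -> valid K (pre i l).
Proof.
elim: l => [//|x l IH] vl.
have [il|il] := leqP i (size l); last by rewrite pre_id.
by rewrite pre_cons//; apply: IH; case/andP: vl.
Qed.

Variables (w : nat -> R) (C1 e R0 : R) (i1 : nat).
Hypothesis hw : forall i, (i <= L)%N -> `|(A i)^-1 - w i| <= C1 / N%:R.
Hypothesis e0 : 0 <= e.
Hypothesis R00 : 0 <= R0.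

Let zz i : R := 1 - i%:R / N%:R - w i.

Hypothesis hz0 : forall i, (i <= L)%N -> 0 <= zz i.
Hypothesis hz1 : forall i, (i1 < i <= L)%N -> R0 <= sN * zz i.

(** Up to i1, where z may be close to 0, the deviation must be small by itself. Afterwards [hz1]
    says that sqrt(N) z is at least R0, so deviations up to R0 create no new minimum of
    consequence. *)
Definition calm (l : seq nat) : Prop :=
  (forall i, (i <= i1)%N -> (i <= L)%N -> `|Q (pre i l)| <= e) /\
  (forall i, (i <= L)%N -> `|Q (pre i l)| <= R0).

Variable l : seq nat.
Hypothesis vl : valid K l.
Hypothesis sl : size l = L.
Hypothesis cl : calm l.

Let NR : 0 < N%:R :> R. Proof. by rewrite ltr0n. Qed.
Let sN0 : 0 < sN. Proof. exact: sqrtN0. Qed.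
Let sNN : sN * sN = N%:R. Proof. by rewrite -expr2 sqr_sqrtr. Qed.

Lemma C1_ge0 : 0 <= C1.
Proof.
by have := le_trans (normr_ge0 _) (hw (leq0n _)); rewrite pmulr_lge0 ?invr_gt0.
Qed.

Lemma invA_near i : (i <= L)%N -> N%:R * `|(A i)^-1 - w i| <= C1.
Proof. by move=> iL; rewrite mulrC -ler_pdivlMr//; exact: hw. Qed.

(** [Pl_le] with q = C1 + sqrt(N) e: the order is sqrt(N), but with the small factor e. *)
Definition Pbound : R := Amax * (1 + (C1 + sN * e)).

Lemma Pl_calm i : (i <= L)%N -> @Pl R (pre i l) <= Pbound.
Proof.
move=> iL; have [h1 h2] := cl; have c1 := C1_ge0.
have spi : size (pre i l) = i by rewrite size_pre ?sl.
rewrite /Pbound; apply: (Pl_le N0 (valid_pre i vl)).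
- by rewrite spi (leq_trans iL).
- by rewrite addr_ge0// mulr_ge0// ltW.
- by rewrite spi AmaxP.
move=> j; rewrite spi => ji; have jL := leq_trans ji iL.
rewrite (pre_pre _ ji).
have A1 := Am_ge1 lam0 j; have A0 : 0 < A j by exact: Am_gt0.
have aN := invA_near jL.
have zE : N%:R - j%:R - N%:R / A j = N%:R * zz j - N%:R * ((A j)^-1 - w j).
  by rewrite /zz; field; rewrite !gt_eqF.
have hN : N%:R * ((A j)^-1 - w j) <= C1.
  by apply: le_trans aN; rewrite ler_wpM2l ?ler_norm// ltW.
have Qabs : - (sN * Q (pre j l) / A j) <= sN * `|Q (pre j l)|.
  apply: le_trans (ler_norm _) _; rewrite normrN !normrM normfV (gtr0_norm sN0) (gtr0_norm A0).
  by rewrite ler_pdivrMr// ler_peMr// mulr_ge0// ltW.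
rewrite zE; have [ji1|ji1] := leqP j i1.
  have z0 : 0 <= N%:R * zz j by rewrite mulr_ge0 ?hz0// ltW.
  have : sN * `|Q (pre j l)| <= sN * e by rewrite ler_wpM2l ?h1// ltW.
  by lra.
have z1 : sN * R0 <= N%:R * zz j.
  rewrite (_ : N%:R * zz j = sN * (sN * zz j)); last by rewrite mulrA sNN.
  by rewrite ler_wpM2l ?hz1 ?ji1// ltW.
have : sN * `|Q (pre j l)| <= sN * R0 by rewrite ler_wpM2l ?h2// ltW.
have : 0 <= sN * e by rewrite mulr_ge0// ltW.
by lra.
Qed.

Lemma Dl_calm i : (i <= L)%N -> 0 <= Dl lam (pre i l) / A i <= Pbound.
Proof.
move=> iL; have A0 : 0 < A i by exact: Am_gt0.
have spi : size (pre i l) = i by rewrite size_pre ?sl.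
rewrite divr_ge0 ?(ltW A0) ?Dl_ge0//= ler_pdivrMr//.
apply: le_trans (Dl_le lam0 _) _; rewrite spi mulrC.
apply: ler_pM; [by have := @Pl_ge1 R (pre i l); lra| |exact: Pl_calm|].
  by rewrite subr_ge0 Am_ge1.
by rewrite gerBl.
Qed.

(** By [walk_identity], [navail] - N/A = -sqrt(N) Q/A + D/A - P. This is what makes the conditional
    variance of [xi] nearly deterministic. *)
Lemma navail_calm i : (i < L)%N ->
  `|(navail N (pre i l))%:R - N%:R / A i| <= sN * R0 + (Pbound + Pbound).
Proof.
move=> iL; have iL' := ltnW iL; have [_ h2] := cl.
have spi : size (pre i l) = i by rewrite size_pre ?sl.
have iN : (size (pre i l) < N)%N by rewrite spi (leq_trans iL).
have A0 : 0 < A i by exact: Am_gt0.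
have A1 := Am_ge1 lam0 i.
rewrite (navailR (lam0 := lam0) (valid_pre i vl) iN).
have id := walk_identity (lam0 := lam0) N0 (valid_pre i vl) (ltnW iN).
rewrite spi in id.
have -> : N%:R - (sumn (pre i l))%:R - @Pl R (pre i l) - N%:R / A i
   = - (sN * Q (pre i l) / A i) + (Dl lam (pre i l) / A i - @Pl R (pre i l)).
  apply: (mulfI (_ : A i != 0)); first by rewrite gt_eqF.
  have -> : A i * (N%:R - (sumn (pre i l))%:R - @Pl R (pre i l) - N%:R / A i)
    = - (N%:R - A i * (N%:R - (sumn (pre i l))%:R)) - A i * @Pl R (pre i l).
    by field; rewrite gt_eqF.
  by rewrite id; field; rewrite gt_eqF.
have /andP[d0 d1] := Dl_calm iL'; have p1 := Pl_calm iL'; have p0 := @Pl_ge1 R (pre i l).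
apply: le_trans (ler_normD _ _) _; apply: lerD.
  rewrite normrN !normrM normfV (gtr0_norm sN0) (gtr0_norm A0) ler_pdivrMr//.
  have q := h2 i iL'.
  apply: (@le_trans _ _ (sN * R0)); first by rewrite ler_wpM2l// ltW.
  by rewrite ler_peMr// mulr_ge0// ltW.
apply: le_trans (ler_normB _ _) _; rewrite ger0_norm// ger0_norm; last by lra.
by apply: lerD.
Qed.

Lemma Zlist_calm i : (i <= L)%N ->
  `|(Zlist (pre i l))%:~R - N%:R * zz i - sN * (Q (pre i l) * w i)|
  <= C1 + R0 * C1 + Pbound.
Proof.
move=> iL; have [_ h2] := cl; have c1 := C1_ge0.
have spi : size (pre i l) = i by rewrite size_pre ?sl.
have A0 : 0 < A i by exact: Am_gt0.
rewrite (Zlist_formula (lam0 := lam0) N0 (valid_pre i vl)); last first.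
  by rewrite spi (leq_trans iL).
rewrite spi.
have -> : N%:R - i%:R - N%:R / A i + (sN * Q (pre i l) - Dl lam (pre i l)) / A i
   - N%:R * zz i - sN * (Q (pre i l) * w i)
  = - (N%:R * ((A i)^-1 - w i)) + sN * Q (pre i l) * ((A i)^-1 - w i)
    - Dl lam (pre i l) / A i.
  by rewrite /zz; field; rewrite !gt_eqF.
have /andP[d0 d1] := Dl_calm iL.
apply: le_trans (ler_normB _ _) _; apply: lerD; last by rewrite ger0_norm.
apply: le_trans (ler_normD _ _) _; apply: lerD.
  by rewrite normrN normrM (gtr0_norm NR) invA_near.
rewrite !normrM (gtr0_norm sN0) mulrAC mulrC; apply: ler_pM; [exact: normr_ge0|by rewrite mulr_ge0// ltW|exact: h2|].
apply: le_trans (invA_near iL); rewrite ler_wpM2r//.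
have s1 : 1 <= sN by rewrite -[X in X <= _]sqrtr1 ler_wsqrtr// ler1n.
by have := ler_wpM2l (ltW sN0) s1; rewrite mulr1 sNN.
Qed.

(** The increment of Q is A (x - mean)/sqrt(N) with A >= 1, and the mean is at most c0. So small
    oscillation of Q also controls the walk inside a unit of time. *)
Lemma child_calm i x : (i < L)%N -> pre i.+1 l = x :: pre i l ->
  x%:R <= sN * `|Q (pre i.+1 l) - Q (pre i l)| + c0.
Proof.
move=> iL e1; have spi : size (pre i l) = i by rewrite size_pre ?sl// ltnW.
rewrite e1 /= addrAC subrr add0r /xi spi.
have A0 : 0 < A i.+1 by exact: Am_gt0.
have A1 := Am_ge1 lam0 i.+1.
have np : (navail N (pre i l))%:R * pm lam i <= c0.
  have := np_le N0 LN lamc (valid_pre i vl); rewrite spi; exact.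
set y := x%:R - _.
have yE : x%:R = y + (navail N (pre i l))%:R * pm lam i by rewrite /y; ring.
rewrite yE; apply: lerD => //.
rewrite !normrM normfV (gtr0_norm sN0) (gtr0_norm A0) mulrC divfK ?gt_eqF//.
by apply: le_trans (ler_norm _) _; rewrite ler_peMl.
Qed.

End ListEstimates.

(** * Oscillation of the martingale over blocks of time *)

Section BlockControl.
Context {R : realType} (N : nat) (lam : nat -> R).
Hypothesis lam0 : forall m, 0 <= lam m.
Hypothesis N0 : (0 < N)%N.
Variables (c0 Amax : R) (L : nat).
Hypothesis LN : (L <= N)%N.
Hypothesis lamc : forall m, (m < L)%N -> lam m <= c0 / N%:R.
Hypothesis AmL : Am lam L <= Amax.

Local Notation A := (Am lam).
Local Notation K := (walkK N lam0).
Local Notation sN := (Num.sqrt N%:R : R).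
Local Notation Q := (Ql N lam).

Variables (m : nat) (it : nat -> nat) (e : R).
Hypothesis it0 : it 0 = 0%N.
Hypothesis itS : forall j, (it j <= it j.+1)%N.
Hypothesis itm : L = (it m).+1.
Hypothesis m0 : (0 < m)%N.
Hypothesis e0 : 0 <= e.

(** Each window runs one step past the end of its block, so that both ends of every unit step
    starting in a block lie in one window. *)
Definition goodb (l : seq nat) : bool :=
  [forall j : 'I_m, ~~ ever (overshoot N lam (it j) (it j.+1).+1 1 e) l
     && ~~ ever (overshoot N lam (it j) (it j.+1).+1 (-1) e) l].

Lemma it_mono i j : (i <= j)%N -> (it i <= it j)%N.
Proof.
move=> ij; rewrite -(subnK ij); elim: (j - i)%N => [//|k IH].
by rewrite addSn; apply: leq_trans IH _.
Qed.

Lemma itL j : (j <= m)%N -> (it j < L)%N.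
Proof. by move=> jm; rewrite itm ltnS it_mono. Qed.

Lemma good_osc l j i : goodb l -> size l = L -> (j < m)%N ->
  (it j <= i <= (it j.+1).+1)%N -> `|Q (pre i l) - Q (pre (it j) l)| <= e.
Proof.
move=> /forallP gl sl jm /andP[ji ij].
have iL : (i <= size l)%N by rewrite sl; apply: leq_trans ij _; exact: itL.
have /andP[h1 h2] := gl (Ordinal jm).
have := ever_pre iL h1; have := ever_pre iL h2.
rewrite /overshoot /= (size_pre iL) ji ij /= pre_pre//.
rewrite -!leNgt => h2' h1'; rewrite ler_norml; apply/andP; split; lra.
Qed.

Lemma good_it l j : goodb l -> size l = L -> (j <= m)%N ->
  `|Q (pre (it j) l)| <= j%:R * e.
Proof.
move=> gl sl; elim: j => [|j IH] jm.
  by rewrite it0 pre0 /= normr0 mul0r.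
have h := @good_osc l j (it j.+1) gl sl jm.
have {}h := h ltac:(by rewrite itS leqnSn).
have -> : Q (pre (it j.+1) l) = Q (pre (it j) l) + (Q (pre (it j.+1) l) - Q (pre (it j) l)).
  by ring.
apply: le_trans (ler_normD _ _) _; rewrite -natr1 mulrDl mul1r.
by apply: lerD => //; apply: IH; exact: ltnW.
Qed.

Lemma find_block k i : (0 < k)%N -> (i <= (it k).+1)%N ->
  exists2 j, (j < k)%N & (it j <= i <= (it j.+1).+1)%N.
Proof.
elim: k => [//|k IH] _ ik.
have [ki|ki] := leqP (it k) i; first by exists k => //; rewrite ki.
case: k IH ki ik => [|k] IH ki ik; first by move: ki; rewrite it0.
have [|j jk ji] := IH isT _; first exact: leqW (ltnW ki).
by exists j => //; exact: ltnW.
Qed.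

Lemma good_calm l : goodb l -> size l = L -> calm N lam L e (m%:R * e) (it 1) l.
Proof.
move=> gl sl; split=> i.
  move=> i1 _; have := @good_osc l 0 i gl sl m0.
  by rewrite it0 pre0 /= subr0; apply; rewrite leqW.
move=> iL; have [|j jm ji] := @find_block m i m0; first by rewrite -itm.
have -> : Q (pre i l) = Q (pre (it j) l) + (Q (pre i l) - Q (pre (it j) l)) by ring.
apply: le_trans (ler_normD _ _) _.
apply: le_trans (lerD (good_it gl sl (ltnW jm)) (good_osc gl sl jm ji)) _.
rewrite -[X in _ + X]mul1r -mulrDl natr1 ler_wpM2r//.
by rewrite ler_nat.
Qed.

(* Union bound over the m blocks and the two signs. *)
Lemma prob_bad (theta D : R) : 0 <= theta -> theta * Amax <= sN / 2 -> 0 <= c0 ->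
  (forall j, (j < m)%N -> ((it j.+1).+1 - it j)%:R <= D) ->
  EE K L [::] (fun l => (~~ goodb l)%:R)
  <= m%:R * (2 * expR (- (theta * e) + 2 * c0 * Amax ^+ 2 * theta ^+ 2 / N%:R * D)).
Proof.
move=> th0 thA c00 hD.
pose bd (j : 'I_m) (sg : R) l : R :=
  (ever (overshoot N lam (it j) (it j.+1).+1 sg e) l)%:R.
apply: (@le_trans _ _ (EE K L [::] (fun l => \sum_(j < m) (bd j 1 l + bd j (-1) l)))).
  apply: EE_mono => // l _ _.
  have pos (j : 'I_m) : 0 <= bd j 1 l + bd j (-1) l by rewrite addr_ge0.
  have [gl|] := boolP (goodb l); first by apply: sumr_ge0.
  rewrite negb_forall => /existsP[j]; rewrite negb_and !negbK => hj.
  rewrite (bigD1 j)//=; apply: (@le_trans _ _ (bd j 1 l + bd j (-1) l)).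
    by rewrite /bd; case/orP: hj => ->; [rewrite lerDl|rewrite lerDr].
  by rewrite lerDl; apply: sumr_ge0 => i _.
rewrite EE_sum.
set X := 2 * expR _.
have -> : m%:R * X = \sum_(j < m) X by rewrite sumr_const card_ord mulr_natl.
apply: ler_sum => j _; rewrite EED /X mulrDl !mul1r.
have one (sg : R) : sg ^+ 2 = 1 -> EE K L [::] (bd j sg)
   <= expR (- (theta * e) + 2 * c0 * Amax ^+ 2 * theta ^+ 2 / N%:R * D).
  move=> sg1.
  have jm : (it j.+1 < L)%N by apply: itL; exact: ltn_ord.
  have ij : (it j <= (it j.+1).+1)%N by rewrite leqW.
  apply: le_trans (maximal_inequality lam0 N0 LN lamc AmL e ij jm sg1 th0 thA) _.
  rewrite ler_expR lerD2l ler_wpM2l ?hD ?ltn_ord//.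
  rewrite divr_ge0// mulr_ge0 ?sqr_ge0// mulr_ge0 ?sqr_ge0// mulr_ge0//.
by apply: lerD; apply: one; rewrite ?sqrrN expr1n.
Qed.

End BlockControl.

(** With a, a' for A_k, A_(k+1) and v for [navail], the left side is the conditional variance of
    [xi] minus the Gaussian one. The factor p remains on the right, next to terms that are small
    when v is near n/a and p is small. *)
Lemma variance_defect (F : fieldType) (a a' p v n : F) :
  a' * (1 - p) = a -> a != 0 -> n != 0 ->
  a' ^+ 2 / n * (v * p * (1 - p)) - a ^+ 2 * (p / a)
  = a * p * (a' * ((v - n / a) / n) + p * a' / a).
Proof.
move=> e a0 n0.
have -> : a' ^+ 2 / n * (v * p * (1 - p)) - a ^+ 2 * (p / a)
  = a' * (1 - p) * (a' * p * v / n) - a * p by field; rewrite ?a0 ?n0.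
have -> : a * p * (a' * ((v - n / a) / n) + p * a' / a)
  = a * p * (a' * v / n) - p * (a' * (1 - p)) by field; rewrite ?a0 ?n0.
by rewrite e; ring.
Qed.

(** * The accumulated replacement error *)

Section ErrBound.
Context {R : realType} (N : nat) (lam : nat -> R).
Hypothesis lam0 : forall m, 0 <= lam m.
Hypothesis N0 : (0 < N)%N.
Variables (c0 Amax : R) (L : nat).
Hypothesis LN : (L <= N)%N.
Hypothesis L0 : (0 < L)%N.
Hypothesis lamc : forall m, (m < L)%N -> lam m <= c0 / N%:R.
Hypothesis AmL : Am lam L <= Amax.

Local Notation A := (Am lam).
Local Notation K := (walkK N lam0).
Local Notation sN := (Num.sqrt N%:R : R).

Let NR : 0 < N%:R :> R. Proof. by rewrite ltr0n. Qed.
Let sN0 : 0 < sN. Proof. exact: sqrtN0. Qed.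
Let sNN : sN * sN = N%:R. Proof. by rewrite -expr2 sqr_sqrtr. Qed.

Definition tauw (k : nat) : R := 1 - (A k)^-1.

Lemma tauw0 : tauw 0 = 0.
Proof. by rewrite /tauw /Am /Lam big_ord0 expR0 invr1 subrr. Qed.

(** Hence A_k^2 (tau_(k+1) - tau_k) = A_k p_k. With [navail] equal to N/A_k, the conditional
    variance of [xi] is A_(k+1) p_k, the same up to the factor 1/(1 - p_k). *)
Lemma tauwS k : tauw k.+1 - tauw k = pm lam k / A k.
Proof.
have A0 : A k != 0 by rewrite gt_eqF// Am_gt0.
have A1 : A k.+1 != 0 by rewrite gt_eqF// Am_gt0.
have e := AmS lam k.
apply: (mulIf A1); apply: (mulIf A0).
rewrite /tauw (_ : (1 - (A k.+1)^-1 - (1 - (A k)^-1)) * A k.+1 * A k = A k.+1 - A k).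
  rewrite (_ : pm lam k / A k * A k.+1 * A k = A k.+1 - A k.+1 * (1 - pm lam k)); first by rewrite e.
  by field.
by field; rewrite A0 A1.
Qed.

Definition navdev (s : seq nat) : R := `|(navail N s)%:R - N%:R / A (size s)| / N%:R.

(** The summands come from the variance defect, the third moment of [xi] and the third moment of the
    Gaussian increment. *)
Definition errconst : R :=
  Amax ^+ 2 * c0 * (1 + c0) + 432 * Amax ^+ 3 * expR c0
  + 432 * expR 1 * Num.sqrt (Amax * c0) ^+ 3.

Lemma errconst_ge0 : 0 <= errconst.
Proof.
have c00 : 0 <= c0 := c0_ge0 lam0 N0 lamc L0.
have a1 : 1 <= Amax := le_trans (Am_ge1 lam0 L) AmL.
have a0 : 0 <= Amax by apply: le_trans a1.
have n0 : 0 <= 432 :> R by rewrite ler0n.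
have c1 : 0 <= 1 + c0 by apply: addr_ge0.
rewrite /errconst; apply: addr_ge0; first apply: addr_ge0.
- by apply: mulr_ge0 c1; apply: mulr_ge0 c00; exact: sqr_ge0.
- by apply: mulr_ge0 (expR_ge0 _); apply: mulr_ge0; last exact: exprn_ge0.
by apply: mulr_ge0; [apply: mulr_ge0 (expR_ge0 _)|exact: exprn_ge0 (sqrtr_ge0 _)].
Qed.

(** First moments agree exactly since [xi] is centred. The remaining terms carry a factor 1/N times
    [navdev] + 1/sqrt(N), so at most N steps leave a small total. *)
Lemma gerr_step_le (c : R) s : 0 <= c -> valid K s -> (size s < L)%N ->
  gerr_step tauw A c K (xi N lam) s <= c * errconst / N%:R * (navdev s + sN^-1).
Proof.
move=> cc vs sL; set k := size s in sL *.
have c00 : 0 <= c0 := c0_ge0 lam0 N0 lamc L0.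
have a1 : 1 <= Amax := le_trans (Am_ge1 lam0 L) AmL.
have A1 : 1 <= A k by exact: Am_ge1.
have A0 : 0 < A k by exact: Am_gt0.
have AA : A k <= Amax by apply: le_trans AmL; apply: Am_le => //; exact: ltnW.
have A1S : 0 < A k.+1 by exact: Am_gt0.
have AAS : A k.+1 <= Amax by apply: le_trans AmL; apply: Am_le.
have /andP[p0 p1] := pm01 lam0 k.
have pc : pm lam k <= c0 / N%:R by apply: le_trans (pm_le _ _) (lamc sL).
have sN1 : N%:R^-1 <= sN^-1.
  rewrite lef_pV2 ?posrE//.
  have s1 : 1 <= sN by rewrite -[X in X <= _]sqrtr1 ler_wsqrtr// ler1n.
  by have := ler_wpM2l (ltW sN0) s1; rewrite mulr1 sNN.
have d0 : 0 <= navdev s by rewrite divr_ge0// ltW.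
have iN0 : 0 <= N%:R^-1 :> R by rewrite invr_ge0 ltW.
have is0 : 0 <= sN^-1 by rewrite invr_ge0 ltW.
rewrite /gerr_step -/k.
rewrite (_ : c * errconst / N%:R * (navdev s + sN^-1)
   = c * (errconst / N%:R * (navdev s + sN^-1))); last by rewrite -!mulrA.
apply: ler_wpM2l => //.
rewrite /moment; under [X in `|X| + _ + _]eq_kop do rewrite expr1.
rewrite xi_mean normr0 add0r -/(moment K (xi N lam) 2 s) xi_var -/k tauwS.
have second : `|A k.+1 ^+ 2 / N%:R * ((navail N s)%:R * pm lam k * (1 - pm lam k))
     - A k ^+ 2 * (pm lam k / A k)|
   <= Amax ^+ 2 * c0 * (1 + c0) * (N%:R^-1 * (navdev s + sN^-1)).
  have e := AmS lam k.
  have -> : A k.+1 ^+ 2 / N%:R * ((navail N s)%:R * pm lam k * (1 - pm lam k))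
     - A k ^+ 2 * (pm lam k / A k)
    = A k * pm lam k * (A k.+1 * (((navail N s)%:R - N%:R / A k) / N%:R)
        + pm lam k * A k.+1 / A k).
    by apply: variance_defect => //; rewrite gt_eqF.
  rewrite normrM ger0_norm; last by rewrite mulr_ge0// ltW.
  have b1 : A k * pm lam k <= Amax * (c0 / N%:R) by apply: ler_pM => //; exact: ltW.
  have b2 : `|A k.+1 * (((navail N s)%:R - N%:R / A k) / N%:R) + pm lam k * A k.+1 / A k|
      <= Amax * navdev s + Amax * c0 * sN^-1.
    apply: le_trans (ler_normD _ _) _; apply: lerD.
      rewrite normrM (gtr0_norm A1S) normrM (ger0_norm iN0) -/k.
      exact: (ler_wpM2r d0 AAS).
    rewrite ger0_norm; last by rewrite divr_ge0 ?mulr_ge0 ?p0 ?(ltW A0) ?(ltW A1S).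
    rewrite ler_pdivrMr//.
    apply: (@le_trans _ _ (c0 * sN^-1 * Amax)).
      apply: ler_pM => //; first exact: ltW.
      by apply: le_trans pc _; rewrite ler_wpM2l.
    rewrite (_ : Amax * c0 / sN = c0 / sN * Amax); last by ring.
    by rewrite ler_peMr// !mulr_ge0//; lra.
  apply: le_trans (ler_pM _ _ b1 b2) _ => //.
    by rewrite mulr_ge0// ltW.
  have -> : Amax * (c0 / N%:R) * (Amax * navdev s + Amax * c0 / sN)
     = Amax ^+ 2 * c0 * (N%:R^-1 * (navdev s + c0 / sN)) by ring.
  have -> : Amax ^+ 2 * c0 * (1 + c0) * (N%:R^-1 * (navdev s + sN^-1))
     = Amax ^+ 2 * c0 * (N%:R^-1 * (navdev s + c0 / sN + (c0 * navdev s + sN^-1))) by ring.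
  apply: ler_wpM2l; first by rewrite mulr_ge0 ?sqr_ge0.
  apply: ler_wpM2l => //; rewrite lerDl; apply: addr_ge0; last exact: is0.
  exact: mulr_ge0.
have third1 := xi_third N0 LN lamc AmL vs sL.
have third2 : (`|A k| * gsd tauw k) ^+ 3 <= Num.sqrt (Amax * c0) ^+ 3 / (N%:R * sN).
  have h : `|A k| * gsd tauw k <= Num.sqrt (Amax * c0) / sN.
    rewrite (gtr0_norm A0) /gsd tauwS.
    have eA : A k = Num.sqrt (A k ^+ 2) by rewrite sqrtr_sqr gtr0_norm.
    rewrite [X in X * _]eA -sqrtrM ?sqr_ge0// ler_pdivlMr//.
    rewrite -sqrtrM; last by rewrite !mulr_ge0 ?invr_ge0 ?sqr_ge0// ltW.
    rewrite ler_wsqrtr//.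
    have -> : A k ^+ 2 * (pm lam k / A k) * N%:R = A k * (pm lam k * N%:R).
      by field; rewrite gt_eqF.
    apply: ler_pM => //; [exact: ltW|by rewrite mulr_ge0// ltW|].
    by rewrite -ler_pdivlMr.
  have e3 : (Num.sqrt (Amax * c0) / sN) ^+ 3 = Num.sqrt (Amax * c0) ^+ 3 / (N%:R * sN).
    by rewrite exprMn exprVn; congr (_ / _); rewrite exprS expr2 sNN mulrC.
  by rewrite -e3 lerXn2r ?nnegrE ?mulr_ge0 ?sqrtr_ge0 ?invr_ge0// ltW.
have iNs : (N%:R * sN)^-1 <= N%:R^-1 * (navdev s + sN^-1).
  by rewrite invfM ler_wpM2l// lerDr.
have u0 : 0 <= N%:R^-1 * (navdev s + sN^-1) by rewrite mulr_ge0// addr_ge0.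
have a0 : 0 <= Amax by apply: le_trans a1.
have n0 : 0 <= 432 :> R by rewrite ler0n.
rewrite /errconst; set e2 := 432 * _ * expR c0 in third1 *.
have e20 : 0 <= e2 by apply: mulr_ge0 (expR_ge0 _); apply: mulr_ge0; last exact: exprn_ge0.
have e40 : 0 <= 432 * expR 1 :> R by apply: mulr_ge0 (expR_ge0 _).
set e4 := 432 * expR 1 in e40 *; set q3 := Num.sqrt _ ^+ 3 in third2 *.
set e1 := Amax ^+ 2 * _ * _ in second *; set u := N%:R^-1 * _ in second iNs u0.
have q30 : 0 <= q3 by exact: exprn_ge0 (sqrtr_ge0 _).
have -> : (e1 + e2 + e4 * q3) / N%:R * (navdev s + sN^-1) = e1 * u + (e2 * u + e4 * (q3 * u)).
  by rewrite /u; ring.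
apply: lerD => //; apply: lerD.
  by apply: le_trans third1 _; exact: ler_wpM2l.
apply: ler_wpM2l => //; apply: le_trans third2 _; exact: ler_wpM2l.
Qed.

Definition gerr_mean (l : seq nat) : R :=
  N%:R^-1 * \sum_(k < size l) navdev (pre k l) + sN^-1.

Lemma gerr_le (c : R) l : 0 <= c -> valid K l -> size l = L ->
  gerr tauw A c K (xi N lam) l <= c * errconst * gerr_mean l.
Proof.
move=> cc vl sl.
have iN0 : 0 <= N%:R^-1 :> R by rewrite invr_ge0 ltW.
have is0 : 0 <= sN^-1 by rewrite invr_ge0 ltW.
have cE : 0 <= c * errconst by rewrite mulr_ge0// errconst_ge0.
have : gerr tauw A c K (xi N lam) l <= c * errconst / N%:R *
   (\sum_(k < size l) navdev (pre k l) + (size l)%:R / sN).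
  have : (size l <= L)%N by rewrite sl.
  elim: l vl {sl} => [|x s IH] vs sL.
    by rewrite /= big_ord0 mul0r addr0 mulr0.
  have [vs' xs] := andP vs.
  rewrite [gerr _ _ _ _ _ _]/= [size _]/= big_ord_recr /= -natr1 mulrDl mul1r addrACA mulrDr.
  apply: lerD; last first.
    by rewrite pre_cons// pre_id//; apply: gerr_step_le.
  apply: le_trans (IH _ _) _ => //; first exact: ltnW.
  apply: ler_wpM2l; first by rewrite mulr_ge0.
  rewrite le_eqVlt; apply/orP; left; apply/eqP; congr (_ + _); apply: eq_bigr => k _.
  by rewrite pre_cons// ltnW.
move/le_trans; apply.
rewrite (_ : c * errconst / N%:R * (_ + _)
  = c * errconst * (N%:R^-1 * \sum_(k < size l) navdev (pre k l)
     + (size l)%:R / N%:R / sN)); last by ring.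
apply: ler_wpM2l => //; apply: lerD => //.
rewrite -[leRHS]mul1r ler_wpM2r// ler_pdivrMr// mul1r ler_nat sl.
exact: LN.
Qed.

Lemma navdev_le1 s : valid K s -> (size s < N)%N -> navdev s <= 1.
Proof.
move=> vs sN'.
rewrite /navdev ler_pdivrMr// mul1r.
have A1 := Am_ge1 lam0 (size s); have A0 : 0 < A (size s) by exact: Am_gt0.
have h1 : (navail N s)%:R <= N%:R :> R by rewrite ler_nat (navail_le vs).
have h2 : N%:R / A (size s) <= N%:R by rewrite ler_pdivrMr// ler_peMr// ltW.
have h3 : 0 <= N%:R / A (size s) by apply: divr_ge0; exact: ltW.
have h4 : 0 <= (navail N s)%:R :> R by [].
by rewrite ler_norml; apply/andP; split; lra.
Qed.

(** On histories outside g the trivial bound [navdev] <= 1 is used, so they contribute their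
    probability. *)
Lemma EE_gerr_le (c V : R) (g : pred (seq nat)) : 0 <= c -> 0 <= V ->
  (forall l, valid K l -> size l = L -> g l -> forall i, (i < L)%N ->
     `|(navail N (pre i l))%:R - N%:R / A i| <= V) ->
  EE K L [::] (gerr tauw A c K (xi N lam))
  <= c * errconst * (V / N%:R + sN^-1 + EE K L [::] (fun l => (~~ g l)%:R)).
Proof.
move=> cc V0 hV.
have cE : 0 <= c * errconst by rewrite mulr_ge0// errconst_ge0.
have iN0 : 0 <= N%:R^-1 :> R by rewrite invr_ge0 ltW.
have VN : 0 <= V / N%:R by rewrite mulr_ge0.
rewrite -[X in X + EE _ _ _ _](EE_cst K L [::]) -EED -EEZ.
apply: EE_mono => // l vl; rewrite add0n => sl.
apply: le_trans (gerr_le cc vl sl) _; apply: ler_wpM2l => //.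
rewrite /gerr_mean addrAC; apply: lerD => //.
rewrite mulrC ler_pdivrMr//.
have gen (b : R) : (forall k, (k < L)%N -> navdev (pre k l) <= b) -> 0 <= b ->
    \sum_(k < size l) navdev (pre k l) <= b * N%:R.
  move=> hb b0; apply: (@le_trans _ _ (\sum_(k < size l) b)).
    by apply: ler_sum => k _; apply: hb; rewrite -sl.
  rewrite sumr_const card_ord -[leLHS]mulr_natr; apply: ler_wpM2l => //.
  by rewrite ler_nat sl.
have [gl|gl] := boolP (g l).
  rewrite /= addr0; apply: gen => // k kL; rewrite /navdev ler_wpM2r//.
  by rewrite size_pre ?hV// sl ltnW.
apply: gen => [k kL|]; last by apply: addr_ge0.
have kN : (size (pre k l) < N)%N by rewrite size_pre ?sl ?(ltnW kL)// (leq_trans kL).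
apply: le_trans (navdev_le1 (valid_pre k vl) kN) _.
by rewrite lerDr.
Qed.

End ErrBound.

(** * Riemann-Stieltjes integrals and the limit process *)

Definition modulus {R : realType} (sigma : R) (g : R -> R) : Prop :=
  forall e, 0 < e -> exists2 delta, 0 < delta &
    forall u v, 0 <= u <= sigma -> 0 <= v <= sigma -> `|u - v| <= delta -> `|g u - g v| <= e.

(** The Heine-Cantor theorem, from the covering form of compactness. *)
Lemma modulus_continuous (R : realType) (sigma : R) (g : R -> R) :
  {within `[0, sigma], continuous g} -> modulus sigma g.
Proof.
move=> cg e e0.
have e2 : 0 < e / 2 by rewrite divr_gt0.
have /compact_near_coveringP/near_covering_withinP cov := @segment_compact R 0 sigma.
have := cov R (at_right (0 : R))
  (fun delta u => forall v, 0 <= v <= sigma -> `|u - v| <= delta -> `|g u - g v| <= e) _.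
case=> [u uK|]; last first.
  move=> d /= d0 /(_ (d / 2)) h; exists (d / 2); first by rewrite divr_gt0.
  move=> u v uK vK uv; apply: h => //=.
  - by rewrite sub0r normrN ger0_norm; lra.
  - by lra.
have /cvgrPdist_le/(_ _ e2) : g x @[x --> within `[0, sigma] (nbhs u)] --> g u.
  by have := cg u; rewrite /continuous_at/= nbhs_subspace_in.
rewrite near_withinE => -[d /= d0 h].
have d2 : 0 < d / 2 by rewrite divr_gt0.
exists (ball u (d / 2), [set x | 0 < x < d / 2]).
  split; first exact: nbhsx_ballx.
  exists (d / 2) => // x /=; rewrite sub0r normrN => xd x0.
  by rewrite x0; apply: le_lt_trans (ler_norm _) xd.
move=> [x delta] /= [ux /andP[_ dd]] xK v vK xv.
have hx : `|g u - g x| <= e / 2 by apply: h => //; apply: lt_trans ux _; lra.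
have hv : `|g u - g v| <= e / 2.
  apply: h => //=.
  have -> : u - v = (u - x) + (x - v) by ring.
  by apply: le_lt_trans (ler_normD _ _) _; move: ux; rewrite /ball /= => ux; lra.
have -> : g x - g v = (g u - g v) - (g u - g x) by ring.
by apply: le_trans (ler_normB _ _) _; lra.
Qed.

Section RSIntegral.
Context {R : realType} (f g : R -> R).

Definition rs_sum (n : nat) (p : nat -> R) : R :=
  \sum_(k < n) f (p k) * (g (p k.+1) - g (p k)).

(** Summation by parts moves the increments onto the nondecreasing f, where they telescope. The
    integrator g enters only through its oscillation, as it must for a Brownian path of unbounded
    variation. *)
Lemma rs_sum_cell n p O : (forall k, (k < n)%N -> f (p k) <= f (p k.+1)) ->
  (forall k, (k <= n)%N -> `|g (p n) - g (p k)| <= O) ->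
  `|rs_sum n p - f (p 0%N) * (g (p n) - g (p 0%N))| <= (f (p n) - f (p 0%N)) * O.
Proof.
move=> fm gO.
have -> : rs_sum n p - f (p 0%N) * (g (p n) - g (p 0%N))
   = \sum_(k < n) (f (p k.+1) - f (p k)) * (g (p n) - g (p k.+1)).
  rewrite /rs_sum; elim: n {fm gO} => [|n IH]; first by rewrite !big_ord0; ring.
  have e : \sum_(k < n) (f (p k.+1) - f (p k)) * (g (p n.+1) - g (p k.+1))
     = \sum_(k < n) (f (p k.+1) - f (p k)) * (g (p n) - g (p k.+1))
       + (f (p n) - f (p 0%N)) * (g (p n.+1) - g (p n)).
    rewrite -(telescope_sumr (f \o p) (leq0n n)) big_mkord mulr_suml -big_split /=.
    by apply: eq_bigr => k _; ring.
  by rewrite !big_ord_recr /= e -IH; ring.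
apply: le_trans (ler_norm_sum _ _ _) _.
apply: (@le_trans _ _ (\sum_(k < n) (f (p k.+1) - f (p k)) * O)).
  apply: ler_sum => k _; have fk := fm k (ltn_ord k).
  rewrite normrM ger0_norm ?subr_ge0// ler_wpM2l ?subr_ge0//.
  by apply: gO; exact: ltn_ord.
by rewrite -mulr_suml -(big_mkord xpredT (fun k => f (p k.+1) - f (p k)))
  (telescope_sumr (f \o p)).
Qed.

Lemma is_RS_integral0 a I : is_RS_integral f g a a I -> I = 0.
Proof.
move=> H; apply/eqP; rewrite -normr_le0; apply/ler_addgt0Pr => e e0; rewrite add0r.
have [d d0 h] := H e e0.
(* The partition without cells is admissible when both ends are a. *)
have := h 0%N (fun=> a) (fun=> a) erefl erefl ltac:(by []).
by rewrite big_ord0 sub0r normrN => /ltW.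
Qed.

Definition upart (a b : R) (n k : nat) : R := a + (b - a) * (k%:R / n%:R).

Lemma rs_cell a s t Is It O : a <= s -> s <= t ->
  (forall u v, s <= u -> u <= v -> v <= t -> f u <= f v) ->
  (forall u v, s <= u <= t -> s <= v <= t -> `|g u - g v| <= O) ->
  is_RS_integral f g a s Is -> is_RS_integral f g a t It ->
  `|It - Is - f s * (g t - g s)| <= (f t - f s) * O.
Proof.
move=> as_ st fm gO HIs HIt; apply/ler_addgt0Pr => e e0.
have e2 : 0 < e / 2 by rewrite divr_gt0.
have [d1 d10 h1] := HIs _ e2; have [d2 d20 h2] := HIt _ e2.
pose d := Num.min d1 d2.
have d0 : 0 < d by rewrite lt_min d10.
pose n := (truncn ((t - a) / d)).+1.
have n0 : 0 < n%:R :> R by rewrite ltr0n.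
have nd : (t - a) / n%:R < d.
  by rewrite ltr_pdivrMr// mulrC -ltr_pdivrMr// truncnS_gt.
clearbody n.
have mesh x y k : 0 <= y - x <= t - a -> upart x y n k <= upart x y n k.+1 /\
    upart x y n k.+1 - upart x y n k < d.
  move=> /andP[xy0 xy].
  have E : upart x y n k.+1 - upart x y n k = (y - x) / n%:R.
    by rewrite /upart -natr1; field; rewrite gt_eqF.
  rewrite E -subr_ge0 E; split; first by rewrite divr_ge0// ltW.
  by apply: le_lt_trans nd; rewrite ler_wpM2r// invr_ge0 ltW.
have up0 x y : upart x y n 0 = x by rewrite /upart mul0r mulr0 addr0.
have upn x y : upart x y n n = y by rewrite /upart divff ?gt_eqF// mulr1; ring.
pose p k := if (k <= n)%N then upart a s n k else upart s t n (k - n).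
have pE k : p (n + k)%N = upart s t n k.
  rewrite /p addKn; case: leqP => // h.
  by move: h; rewrite -[leqRHS]addn0 leq_add2l leqn0 => /eqP ->; rewrite addn0 upn up0.
have S1 : `|rs_sum n (upart a s n) - Is| < e / 2.
  apply: h1 => // k kn; have [|m1 m2] := mesh a s k; first by lra.
  by rewrite lexx m1; split=> //; apply: lt_le_trans m2 _; rewrite ge_min lexx.
have S2 : `|rs_sum (n + n) p - It| < e / 2.
  apply: h2 => [||k kn]; first by rewrite /p /= up0.
    by rewrite pE upn.
  have [kn'|kn'] := ltnP k n.
    rewrite /p (ltnW kn') kn'; have [|m1 m2] := mesh a s k; first by lra.
    by rewrite lexx m1; split=> //; apply: lt_le_trans m2 _; rewrite ge_min lexx orbT.
  rewrite -(subnKC kn') -addnS !pE; have [|m1 m2] := mesh s t (k - n)%N; first by lra.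
  by rewrite lexx m1; split=> //; apply: lt_le_trans m2 _; rewrite ge_min lexx orbT.
have split_sum : rs_sum (n + n) p = rs_sum n (upart a s n) + rs_sum n (upart s t n).
  rewrite /rs_sum big_split_ord /=; congr (_ + _); apply: eq_bigr => k _.
    by rewrite /p ltn_ord (ltnW (ltn_ord k)).
  by rewrite -addnS !pE.
have monp k : (k <= n)%N -> s <= upart s t n k <= t.
  move=> kn; rewrite /upart lerDl mulr_ge0 ?subr_ge0 ?divr_ge0//=.
  have -> : t = s + (t - s) * 1 by ring.
  rewrite lerD2l mulr1 (_ : s + (t - s) = t); last by ring.
  by rewrite ler_piMr ?subr_ge0// ler_pdivrMr// mul1r ler_nat.
have := @rs_sum_cell n (upart s t n) O; rewrite upn up0 => cell.
have {}cell := cell _ _.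
have C : `|rs_sum n (upart s t n) - f s * (g t - g s)| <= (f t - f s) * O.
  apply: cell => k kn.
    have [|m1 _] := mesh s t k; first by lra.
    by apply: fm => //; [case/andP: (monp k (ltnW kn))|case/andP: (monp k.+1 kn)].
  by apply: gO; rewrite ?st ?lexx// monp.
have -> : It - Is - f s * (g t - g s) = (rs_sum n (upart s t n) - f s * (g t - g s))
   + (rs_sum n (upart a s n) - Is) - (rs_sum (n + n) p - It) by rewrite split_sum; ring.
apply: le_trans (ler_normB _ _) _.
by have := ler_normD (rs_sum n (upart s t n) - f s * (g t - g s))
  (rs_sum n (upart a s n) - Is); lra.
Qed.

End RSIntegral.

Lemma expRN_lip (R : realType) (x y : R) : 0 <= x -> 0 <= y ->
  `|expR (- x) - expR (- y)| <= `|x - y|.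
Proof.
wlog xy : x y / x <= y => [H x0 y0|x0 y0].
  have [/H|/ltW/H] := leP x y; first by move=> h; apply: h.
  by move=> h; rewrite distrC [leRHS]distrC; apply: h.
have e1 : expR (- y) <= expR (- x) by rewrite ler_expR lerN2.
rewrite ger0_norm ?subr_ge0// [leRHS]distrC ger0_norm ?subr_ge0//.
have h := expR_ge1Dx (- (y - x)).
have -> : expR (- x) - expR (- y) = expR (- x) * (1 - expR (- (y - x))).
  by rewrite mulrBr mulr1 -expRD; congr (_ - expR _); ring.
have x1 : expR (- x) <= 1 by rewrite expR_le1 lerNl oppr0.
have x2 := expR_gt0 (- x).
apply: (@le_trans _ _ (expR (- x) * (y - x))); first by rewrite ler_wpM2l; lra.
by rewrite ler_piMl// subr_ge0.
Qed.

Lemma dist_in_seg (R : realDomainType) (a b x y d : R) :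
  a <= x <= b -> a <= y <= b -> b - a <= d -> `|x - y| <= d.
Proof. by move=> /andP[? ?] /andP[? ?] ?; rewrite ler_norml; apply/andP; split; lra. Qed.

Lemma clamp_lip (R : realDomainType) (s x y : R) :
  `|Num.min (Num.max x 0) s - Num.min (Num.max y 0) s| <= `|x - y|.
Proof.
have min_lip (u v : R) : `|Num.min u s - Num.min v s| <= `|u - v|.
  have h1 := ler_norm (u - v); have h2 := ler_norm (v - u); rewrite distrC in h2.
  by case: (leP u s) => a; case: (leP v s) => b; rewrite ler_norml; apply/andP; split; lra.
apply: le_trans (min_lip _ _) _.
have h1 := ler_norm (x - y); have h2 := ler_norm (y - x); rewrite distrC in h2.
by case: (leP x 0) => a; case: (leP y 0) => b; rewrite ler_norml; apply/andP; split; lra.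
Qed.

Lemma split_frac (R : realFieldType) (e F : R) : 0 < F ->
  F * (e / F / 2) + F * (e / F / 2) = e.
Proof. by move=> F0; field; rewrite gt_eqF. Qed.

Lemma cell_step (R : realDomainType) (S D x y a b c e : R) :
  `|S - x| <= (b - a) * e -> `|y - x - D| <= (c - b) * e ->
  `|S + D - y| <= (c - a) * e.
Proof.
move=> h1 h2; have -> : S + D - y = (S - x) - (y - x - D) by ring.
have -> : (c - a) * e = (b - a) * e + (c - b) * e by ring.
by apply: le_trans (ler_normB _ _) _; exact: lerD.
Qed.

Section Modulus.
Context {R : realType}.
Implicit Types (sigma : R) (f g : R -> R).

Lemma modulus_lip sigma K f : 0 <= K ->
  (forall u v, 0 <= u <= sigma -> 0 <= v <= sigma -> `|f u - f v| <= K * `|u - v|) ->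
  modulus sigma f.
Proof.
move=> K0 H e e0; have K1 : 0 < K + 1 by lra.
exists (e / (K + 1)); first by rewrite divr_gt0.
move=> u v us vs uv; apply: le_trans (H u v us vs) _.
apply: (@le_trans _ _ ((K + 1) * `|u - v|)); first by rewrite ler_wpM2r//; lra.
by rewrite mulrC -ler_pdivlMr.
Qed.

Lemma modulus_comp sigma s' g h K : 0 <= K -> modulus s' g ->
  (forall u, 0 <= u <= sigma -> 0 <= h u <= s') ->
  (forall u v, 0 <= u <= sigma -> 0 <= v <= sigma -> `|h u - h v| <= K * `|u - v|) ->
  modulus sigma (g \o h).
Proof.
move=> K0 mg hs hl e /mg[d d0 H].
have [d' d'0 H'] := modulus_lip K0 hl d0.
by exists d' => // u v us vs uv; apply: H; [exact: hs|exact: hs|exact: H'].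
Qed.

Lemma modulus_bounded sigma g : 0 <= sigma -> modulus sigma g ->
  exists C, forall u, 0 <= u <= sigma -> `|g u| <= C.
Proof.
move=> s0 /(_ 1 ltr01)[d d0 H].
exists (`|g 0| + (truncn (sigma / d)).+1%:R) => u /andP[u0 us].
have : u <= (truncn (sigma / d)).+1%:R * d.
  by rewrite -ler_pdivrMr//; apply: ltW; apply: le_lt_trans (truncnS_gt _); rewrite ler_wpM2r// invr_ge0 ltW.
elim: (truncn _).+1 u u0 us => [|n IH] u u0 us un.
  rewrite mul0r in un; have -> : u = 0 by lra.
  by rewrite addr0.
pose v := Num.max 0 (u - d).
have v0 : 0 <= v by rewrite le_max lexx.
have vu : v <= u by rewrite ge_max u0; lra.
have uv : u - d <= v by rewrite le_max lexx orbT.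
have vn : v <= n%:R * d.
  by rewrite ge_max mulr_ge0 ?(ltW d0)//=; move: un; rewrite -natr1 mulrDl mul1r; lra.
have h1 := IH v v0 (le_trans vu us) vn.
have h2 : `|g u - g v| <= 1 by apply: H; [lra|lra|rewrite ger0_norm; lra].
have -> : g u = g v + (g u - g v) by ring.
by apply: le_trans (ler_normD _ _) _; rewrite -natr1; lra.
Qed.

Lemma modulusM sigma f g : 0 <= sigma -> modulus sigma f -> modulus sigma g ->
  modulus sigma (fun u => f u * g u).
Proof.
move=> s0 mf mg e e0.
have [C1 h1] := modulus_bounded s0 mf; have [C2 h2] := modulus_bounded s0 mg.
pose C := `|C1| + `|C2| + 1.
have C0 : 0 < C by rewrite /C; have := normr_ge0 C1; have := normr_ge0 C2; lra.
have e2 : 0 < e / C / 2 by rewrite !divr_gt0.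
have [d1 d10 H1] := mf _ e2; have [d2 d20 H2] := mg _ e2.
exists (Num.min d1 d2); first by rewrite lt_min d10.
move=> u v us vs; rewrite le_min => /andP[uv1 uv2].
have -> : f u * g u - f v * g v = f u * (g u - g v) + (f u - f v) * g v by ring.
have b1 : `|f u| <= C.
  by apply: le_trans (h1 u us) _; have := ler_norm C1; have := normr_ge0 C2; rewrite /C; lra.
have b2 : `|g v| <= C.
  by apply: le_trans (h2 v vs) _; have := ler_norm C2; have := normr_ge0 C1; rewrite /C; lra.
apply: le_trans (ler_normD _ _) _; rewrite !normrM.
have -> : e = C * (e / C / 2) + (e / C / 2) * C by field; rewrite gt_eqF.
by apply: lerD; apply: ler_pM => //; [exact: H2|exact: H1].
Qed.

End Modulus.

(** * Continuity and discretization of the limit integral *)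

Section LimitProcess.
Context {R : realType} (beta : nat -> R) (sigma : R) (Bw I : R -> R).
Hypothesis beta0 : forall j, (2 <= j)%N -> 0 <= beta j.
Hypothesis beta2 : beta 2%N = 1 / 2.
Hypothesis bcvg : cvg (series (betap_terms beta 1) @ \oo).
Hypothesis sigma01 : 0 < sigma < 1.
Hypothesis cB : {within `[0, +oo[, continuous Bw}.

Local Notation bp := (betap beta).
Local Notation f := (fun s => expR (bp s)).
Local Notation g := (fun s => Bw (zfun beta s + s)).

Let s0 : 0 <= sigma. Proof. by case/andP: sigma01 => /ltW. Qed.
Let s1 : sigma < 1. Proof. by case/andP: sigma01. Qed.

Let in01 u : 0 <= u <= sigma -> 0 <= u <= 1.
Proof. by case/andP=> -> h; exact: le_trans h (ltW s1). Qed.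

Definition blip : R := bp 1 / (1 - sigma).

Lemma blip_ge0 : 0 <= blip.
Proof.
by rewrite divr_ge0 ?subr_ge0 ?(ltW s1)// (betap_ge0 beta0 beta2 bcvg)// ler01 lexx.
Qed.

Lemma betap_dist u v : 0 <= u <= sigma -> 0 <= v <= sigma ->
  `|bp u - bp v| <= blip * `|u - v|.
Proof.
wlog uv : u v / u <= v => [H us vs|us vs].
  have [/H|/ltW/H] := leP u v; first by move=> h; apply: h.
  by move=> h; rewrite distrC (distrC u); apply: h.
case/andP: us => u0 us; case/andP: vs => v0 vs.
have v1 : v <= 1 := le_trans vs (ltW s1).
have h := betap_mono beta0 beta2 bcvg u0 uv v1.
rewrite distrC ger0_norm ?subr_ge0// distrC ger0_norm ?subr_ge0//.
exact: (betap_lip beta0 bcvg).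
Qed.

Lemma clockE s : zfun beta s + s = 1 - expR (- bp s).
Proof. by rewrite /zfun; ring. Qed.

Lemma clock01 s : 0 <= s <= 1 -> 0 <= zfun beta s + s <= 1.
Proof.
move=> s01; rewrite clockE; have := expR_gt0 (- bp s).
have : expR (- bp s) <= 1 by rewrite expR_le1 lerNl oppr0 (betap_ge0 beta0 beta2 bcvg).
by lra.
Qed.

Lemma expRN_betap_dist u v : 0 <= u <= sigma -> 0 <= v <= sigma ->
  `|expR (- bp u) - expR (- bp v)| <= blip * `|u - v|.
Proof.
move=> us vs; apply: le_trans (expRN_lip _ _) _; last exact: betap_dist.
  by apply: (betap_ge0 beta0 beta2 bcvg); exact: in01.
by apply: (betap_ge0 beta0 beta2 bcvg); exact: in01.
Qed.

Lemma modulus_Bw s : modulus s Bw.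
Proof.
apply: modulus_continuous; apply: continuous_subspaceW cB => x /=.
by rewrite !in_itv /= => /andP[->].
Qed.

Lemma modulus_g : modulus sigma g.
Proof.
apply: (@modulus_comp _ sigma 1 Bw (fun s => zfun beta s + s) _ blip_ge0 (modulus_Bw 1)).
  by move=> u us; apply: clock01; exact: in01.
move=> u v us vs; rewrite !clockE.
have -> : 1 - expR (- bp u) - (1 - expR (- bp v)) = expR (- bp v) - expR (- bp u) by ring.
by rewrite (distrC u) expRN_betap_dist.
Qed.

Hypothesis HI : forall t, 0 <= t <= sigma -> is_RS_integral f g 0 t (I t).

Let fS := f sigma.

Lemma f_mono u v : 0 <= u -> u <= v -> v <= sigma -> f u <= f v.
Proof. by move=> u0 uv vs; rewrite ler_expR (betap_mono beta0 beta2 bcvg)// (le_trans vs (ltW s1)). Qed.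

Lemma I_cell s t O : 0 <= s -> s <= t -> t <= sigma ->
  (forall u v, s <= u <= t -> s <= v <= t -> `|g u - g v| <= O) ->
  `|I t - I s - f s * (g t - g s)| <= (f t - f s) * O.
Proof.
move=> s0' st ts gO; apply: (@rs_cell _ f g 0) => //.
- by move=> u v su uv vt; apply: f_mono => //; [exact: le_trans su|exact: le_trans vt ts].
- by apply: HI; rewrite s0' (le_trans st).
- by apply: HI; rewrite ts (le_trans s0').
Qed.

Lemma I0 : I 0 = 0.
Proof. by apply: is_RS_integral0; apply: HI; rewrite lexx. Qed.

(** By [I_cell] an increment of I is f times an increment of g, up to the oscillation of g times the
    increment of f. *)
Lemma modulus_I : modulus sigma I.
Proof.
move=> e e0; have F0 : 0 < fS by exact: expR_gt0.
have e2 : 0 < e / fS / 2 by rewrite !divr_gt0.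
have [d d0 H] := modulus_g e2; exists d => // u v us vs.
wlog uv : u v us vs / v <= u => [W|].
  have [/W|/ltW/W] := leP v u; first by move=> h; apply: h.
  by rewrite distrC => h ?; rewrite distrC; apply: h.
rewrite ger0_norm ?subr_ge0// => uvd.
have /andP[u0 us'] := us; have /andP[v0 vs'] := vs.
have osc x y : v <= x <= u -> v <= y <= u -> `|g x - g y| <= e / fS / 2.
  move=> vxu vyu; have [/andP[vx xu] /andP[vy yu]] := (vxu, vyu); apply: H.
  - by rewrite (le_trans v0 vx) (le_trans xu).
  - by rewrite (le_trans v0 vy) (le_trans yu).
  - exact: dist_in_seg uvd.
have cell := I_cell v0 uv us' osc.
have fu : f u <= fS := f_mono u0 us' (lexx _).
have fv : f v <= fS := f_mono v0 vs' (lexx _).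
have fv0 : 0 < f v by exact: expR_gt0.
have -> : I u - I v = (I u - I v - f v * (g u - g v)) + f v * (g u - g v) by ring.
apply: le_trans (ler_normD _ _) _.
have t1 : (f u - f v) * (e / fS / 2) <= fS * (e / fS / 2).
  by rewrite ler_wpM2r ?(ltW e2)// lerBlDr (le_trans fu)// lerDl ltW.
have t2 : `|f v * (g u - g v)| <= fS * (e / fS / 2).
  rewrite normrM (gtr0_norm fv0); apply: (ler_pM (ltW fv0) (normr_ge0 _) fv).
  by apply: osc; rewrite lexx uv.
rewrite -[leRHS](split_frac e F0).
by apply: lerD t2; apply: le_trans cell t1.
Qed.

Lemma modulus_X : modulus sigma (fun t => expR (- bp t) * I t).
Proof.
apply: modulusM modulus_I => //.
exact: modulus_lip blip_ge0 expRN_betap_dist.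
Qed.

Lemma betap_onto y : 0 <= y <= bp sigma -> exists2 s, 0 <= s <= sigma & bp s = y.
Proof.
(* The Lipschitz bound on beta' holds on [0, sigma] only; clamping extends it to the whole line. *)
pose cl x := Num.min (Num.max x 0) sigma : R.
have cls x : 0 <= cl x <= sigma by rewrite le_min s0 le_max lexx orbT ge_min lexx orbT.
have cl_lip x x' : `|cl x - cl x'| <= `|x - x'|.
  exact: clamp_lip.
have cont : {within `[0, sigma], continuous (bp \o cl)}.
  apply: continuous_subspaceT => x; apply/cvgrPdist_le => e e0.
  have B1 : 0 < blip + 1 by have := blip_ge0; lra.
  near=> z; rewrite /=; apply: le_trans (betap_dist (cls _) (cls _)) _.
  apply: (@le_trans _ _ ((blip + 1) * `|x - z|)).
    by apply: ler_pM => //; [exact: blip_ge0|lra].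
  rewrite mulrC -ler_pdivlMr//; near: z.
  have := @cvgr_dist_le _ _ _ (nbhs x) _ id x (@cvg_id _ (nbhs x)) (e / (blip + 1)) (divr_gt0 e0 B1).
  exact.
have [clo cls'] : cl 0 = 0 /\ cl sigma = sigma.
  by rewrite /cl maxxx min_l// max_l// minxx.
have bs0 : 0 <= bp sigma by apply: (betap_ge0 beta0 beta2 bcvg); rewrite s0 ltW.
move=> yb; have [|c cs <-] := @IVT _ (bp \o cl) 0 sigma y s0 cont.
  by rewrite /= clo cls' (betap0 beta) min_l// max_r.
by exists (cl c).
Unshelve. all: by end_near.
Qed.

(* The points s_k = beta'^-1 (La k) turn the sum into a Riemann-Stieltjes sum. *)
Lemma discrete_integral e : 0 < e -> exists2 delta, 0 < delta &
  forall (La : nat -> R) i t, La 0%N = 0 -> (forall k, La k <= La k.+1) -> La i <= bp sigma ->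
   (forall k, (k < i)%N -> La k.+1 - La k <= delta) -> 0 <= t <= sigma ->
   `|La i - bp t| <= delta ->
   `|\sum_(k < i) expR (La k) * (Bw (1 - expR (- La k.+1)) - Bw (1 - expR (- La k))) - I t| <= e.
Proof.
move=> e0; have e2 : 0 < e / 2 by rewrite divr_gt0.
have F0 : 0 < fS by exact: expR_gt0.
have eF : 0 < e / 2 / fS by rewrite !divr_gt0.
have [d1 d10 H1] := modulus_I e2; have [d2 d20 H2] := modulus_g eF.
exists (Num.min d1 d2) => [|La i t La0 Lam Lai]; first by rewrite lt_min d10.
have Lmono j k : (j <= k)%N -> La j <= La k.
  move=> jk; rewrite -(subnK jk); elim: (k - j)%N => [//|n IH].
  by rewrite addSn; apply: le_trans IH _.
have ex k : exists s, (k <= i)%N -> 0 <= s <= sigma /\ bp s = La k.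
  have [ki|ki] := leqP k i; last by exists 0.
  have [|s' ss bs] := @betap_onto (La k); last by exists s'.
  by rewrite (le_trans (Lmono _ _ ki) Lai) andbT -La0 Lmono.
have [s hs] := choice ex => steps ts; rewrite le_min => /andP[it1 it2].
(* As beta' is expanding, distances between the points s_k are at most those between the values
   La_k. *)
have expand u v : 0 <= u <= sigma -> 0 <= v <= sigma -> `|u - v| <= `|bp u - bp v|.
  wlog uv : u v / u <= v => [W us vs|us vs].
    have [/W|/ltW/W] := leP u v; first by move=> h; apply: h.
    by move=> h; rewrite distrC (distrC (bp u)); apply: h.
  case/andP: us => u0 _; case/andP: vs => _ vs.
  rewrite distrC ger0_norm ?subr_ge0// distrC; apply: le_trans (ler_norm _).
  exact: (betap_expand beta0 beta2 bcvg u0 uv (le_trans vs (ltW s1))).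
have smono k : (k < i)%N -> s k <= s k.+1.
  move=> ki; have [a1 b1] := hs k (ltnW ki); have [a2 b2] := hs k.+1 ki.
  rewrite leNgt; apply/negP => sk.
  have /andP[q0 _] := a2; have /andP[_ q1] := a1.
  have := betap_expand beta0 beta2 bcvg q0 (ltW sk) (le_trans q1 (ltW s1)).
  rewrite b1 b2 => h; have : s k - s k.+1 <= 0 by apply: le_trans h _; rewrite subr_le0 Lam.
  by rewrite subr_le0 leNgt sk.
have [si bi] := hs i (leqnn i).
have s00 : s 0%N = 0.
  have [a b] := hs 0%N (leq0n _); have := expand (s 0%N) 0 a.
  rewrite b La0 (betap0 beta) subrr normr0 subr0 => h.
  by apply/eqP; rewrite -normr_le0 h// lexx.
have last : `|I (s i) - I t| <= e / 2.
  by apply: H1 => //; apply: le_trans (expand _ _ si ts) _; rewrite bi.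
have cells : `|\sum_(k < i) expR (La k) * (Bw (1 - expR (- La k.+1)) - Bw (1 - expR (- La k)))
    - I (s i)| <= (f (s i) - f (s 0%N)) * (e / 2 / fS).
  have gE k : (k <= i)%N -> g (s k) = Bw (1 - expR (- La k)).
    by move=> ki; have [_ b] := hs k ki; rewrite clockE b.
  have main n : (n <= i)%N ->
    `|\sum_(k < n) expR (La k) * (Bw (1 - expR (- La k.+1)) - Bw (1 - expR (- La k)))
      - I (s n)| <= (f (s n) - f (s 0%N)) * (e / 2 / fS).
    elim: n => [|n IH] ni; first by rewrite big_ord0 s00 I0 !subrr normr0 mul0r.
    have ni' := ltnW ni; have [an bn] := hs n ni'; have [an1 bn1] := hs n.+1 ni.
    have osc u v : s n <= u <= s n.+1 -> s n <= v <= s n.+1 -> `|g u - g v| <= e / 2 / fS.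
      have /andP[q0 _] := an; have /andP[_ q1] := an1.
      move=> us vs; have [/andP[r1 r2] /andP[r3 r4]] := (us, vs); apply: H2.
      - by rewrite (le_trans q0 r1) (le_trans r2 q1).
      - by rewrite (le_trans q0 r3) (le_trans r4 q1).
      apply: (dist_in_seg us vs).
      apply: le_trans (ler_norm _) _; apply: le_trans (expand _ _ an1 an) _.
      rewrite bn bn1 ger0_norm ?subr_ge0//; apply: le_trans (steps n ni) _.
      by rewrite ge_min lexx orbT.
    have := @I_cell (s n) (s n.+1) (e / 2 / fS) (proj1 (andP an)) (smono n ni)
      (proj2 (andP an1)) osc.
    rewrite -/(f (s n)) (gE n ni') (gE n.+1 ni) bn bn1.
    have {}IH := IH ni'; rewrite bn in IH.
    rewrite big_ord_recr /=; exact: cell_step.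
  exact: main.
have fsi : f (s i) <= fS by apply: f_mono; lra.
have fs0 : 0 < f (s 0%N) by exact: expR_gt0.
have c2 : (f (s i) - f (s 0%N)) * (e / 2 / fS) <= e / 2.
  apply: (@le_trans _ _ (fS * (e / 2 / fS))); first by rewrite ler_wpM2r; lra.
  by rewrite mulrC divfK ?gt_eqF.
set S := \sum_(k < i) _ in cells *.
have -> : S - I t = (S - I (s i)) + (I (s i) - I t) by ring.
apply: le_trans (ler_normD _ _) _; rewrite [leRHS](splitr e); apply: lerD last.
exact: le_trans cells c2.
Qed.

End LimitProcess.

(** * Cadlag paths and the Lipschitz envelope *)

Section Cadlag.
Context {R : realType}.
Implicit Types (sigma t a : R) (f g : R -> R).

Lemma modulus_cadlag sigma g : modulus sigma g -> cadlag_on sigma g.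
Proof.
move=> mg; split=> t /andP[t1 t2].
  apply/cvgrPdist_le => e e0; have [d d0 H] := mg e e0.
  near=> s.
  have ts : t < s by near: s; exact: nbhs_right_gt.
  have ss : s < sigma by near: s; exact: nbhs_right_lt.
  have sd : s < t + d by near: s; apply: nbhs_right_lt; rewrite ltrDl.
  apply: H; [by rewrite t1 ltW|by rewrite (le_trans t1 (ltW ts)) ltW|].
  by rewrite distrC ger0_norm ?subr_ge0 ?ltW// ltrBlDl.
apply/cvg_ex; exists (g t); apply/cvgrPdist_le => e e0; have [d d0 H] := mg e e0.
near=> s.
have ts : s < t by near: s; exact: nbhs_left_lt.
have ss : 0 < s by near: s; exact: nbhs_left_gt.
have sd : t - d < s by near: s; apply: nbhs_left_gt; rewrite gtrBl.
apply: H; [by rewrite t2 ltW|by rewrite ltW// ltW// (lt_le_trans ts)|].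
by rewrite ger0_norm ?subr_ge0 ?ltW// ltrBlDr addrC -ltrBlDr.
Unshelve. all: by end_near.
Qed.

Lemma cadlagB sigma f g : cadlag_on sigma f -> cadlag_on sigma g ->
  cadlag_on sigma (fun t => f t - g t).
Proof.
move=> [f1 f2] [g1 g2]; split=> t tt.
  by apply: cvgB; [exact: f1|exact: g1].
have /cvg_ex[lf hf] := f2 t tt; have /cvg_ex[lg hg] := g2 t tt.
by apply/cvg_ex; exists (lf - lg); exact: cvgB.
Qed.

Lemma cadlagMr sigma f c : cadlag_on sigma f -> cadlag_on sigma (fun t => f t * c).
Proof.
move=> [f1 f2]; split=> t tt.
  by apply: cvgM; [exact: f1|exact: cvg_cst].
have /cvg_ex[lf hf] := f2 t tt.
by apply/cvg_ex; exists (lf * c); apply: cvgM => //; exact: cvg_cst.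
Qed.

Lemma truncn_right a t : 0 < a -> 0 <= t ->
  \forall s \near t^'+, truncn (a * s) = truncn (a * t).
Proof.
move=> a0 t0; have at0 : 0 <= a * t by rewrite mulr_ge0// ltW.
have /andP[h1 h2] := truncn_itv at0; near=> s.
have ts : t < s by near: s; exact: nbhs_right_gt.
apply: truncn_def; rewrite (le_trans h1) ?ler_pM2l ?(ltW ts)//=.
rewrite mulrC -ltr_pdivlMr//; near: s; apply: nbhs_right_lt.
by rewrite ltr_pdivlMr// mulrC.
Unshelve. all: by end_near.
Qed.

Lemma truncn_left a t : 0 < a -> 0 < t ->
  exists q, \forall s \near t^'-, truncn (a * s) = q.
Proof.
move=> a0 t0; have at0 : 0 < a * t by rewrite mulr_gt0.
have /andP[h1 h2] := truncn_itv (ltW at0).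
have main (q : nat) : q%:R < a * t <= q.+1%:R -> \forall s \near t^'-, truncn (a * s) = q.
  move=> /andP[q1 q2]; near=> s.
  have ts : s < t by near: s; exact: nbhs_left_lt.
  apply: truncn_def; apply/andP; split; last first.
    by apply: lt_le_trans q2; rewrite ltr_pM2l.
  rewrite mulrC -ler_pdivrMr//; apply: ltW; near: s; apply: nbhs_left_gt.
  by rewrite ltr_pdivrMr// mulrC.
have [e|ne] := eqVneq (truncn (a * t))%:R (a * t).
  case: (truncn _) e => [|q] e; first by rewrite -e ltxx in at0.
  by exists q; apply: main; rewrite -e lexx ltr_nat ltnSn.
by exists (truncn (a * t)); apply: main; rewrite lt_neqAle ne h1 (ltW h2).
Unshelve. all: by end_near.
Qed.

Lemma count_right (e : nat -> R) (L : seq nat) a q t : 0 < a ->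
  \forall s \near t^'+, count (fun j => e j <= a * s - q) L = count (fun j => e j <= a * t - q) L.
Proof.
move=> a0; elim: L => [|j L IH]; first by near=> s.
have h : \forall s \near t^'+, (e j <= a * s - q) = (e j <= a * t - q).
  have [le|gt] := leP (e j) (a * t - q).
    near=> s; have ts : t < s by near: s; exact: nbhs_right_gt.
    by apply: (le_trans le); rewrite lerD2r ler_pM2l// ltW.
  near=> s; have ss : s < (e j + q) / a.
    by near: s; apply: nbhs_right_lt; rewrite ltr_pdivlMr// mulrC -ltrBlDr.
  by apply: negbTE; rewrite -ltNge ltrBlDr mulrC -ltr_pdivlMr.
by near=> s => /=; congr (_ + _)%N; [congr nat_of_bool|]; near: s.
Unshelve. all: by end_near.
Qed.

Lemma count_left (e : nat -> R) (L : seq nat) a q t : 0 < a ->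
  exists c, \forall s \near t^'-, count (fun j => e j <= a * s - q) L = c.
Proof.
move=> a0; elim: L => [|j L [c IH]]; first by exists 0%N; near=> s.
suff [b h] : exists b : bool, \forall s \near t^'-, (e j <= a * s - q) = b.
  by exists (b + c)%N; near=> s => /=; congr (_ + _)%N; [congr nat_of_bool|]; near: s.
have [lt|ge] := ltP (e j) (a * t - q).
  exists true; near=> s; have ss : (e j + q) / a < s.
    by near: s; apply: nbhs_left_gt; rewrite ltr_pdivrMr// mulrC -ltrBrDr.
  by rewrite lerBrDr mulrC -ler_pdivrMr// ltW.
exists false; near=> s; have ts : s < t by near: s; exact: nbhs_left_lt.
by apply: negbTE; rewrite -ltNge; apply: lt_le_trans ge; rewrite ltrD2r ltr_pM2l.
Unshelve. all: by end_near.
Qed.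

(** On either side of t the integer part of N s and the count are eventually constant, so the path
    is locally affine there. *)
Lemma cadlag_interp sigma N (has : pred {set 'I_N}) (E : nat -> nat -> R) : (0 < N)%N ->
  cadlag_on sigma (fun t => bfw_interp has E (N%:R * t)).
Proof.
move=> N0; have NR : 0 < N%:R :> R by rewrite ltr0n.
pose phi (q c : nat) s : R := (bfw_Z has q)%:~R - (N%:R * s - q%:R) + c%:R.
have lin t (F : set_system R) (FF : Filter F) q c : s @[s --> F] --> t -> phi q c s @[s --> F] --> phi q c t.
  move=> h; apply: cvgD (cvg_cst _); apply: cvgB; first exact: cvg_cst.
  by apply: cvgB (cvg_cst _); apply: cvgM h; exact: cvg_cst.
have iE s q : 0 <= s -> truncn (N%:R * s) = q -> bfw_interp has E (N%:R * s)
   = phi q (count (fun j => E q.+1 j <= N%:R * s - q%:R) (iota 1 (bfw_navail has q.+1))) s.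
  move=> s0 <-; have Ns : 0 <= N%:R * s by rewrite mulr_ge0.
  by rewrite truncn_floor Ns.
split=> t /andP[t1 t2].
  set q := truncn (N%:R * t); rewrite (iE t q t1 erefl); set c := count _ _.
  have := lin t _ (at_right_proper_filter t) q c (cvg_at_right_filter (@cvg_id _ _)).
  apply: cvg_trans; apply: near_eq_cvg; near=> s.
  have ts : t < s by near: s; exact: nbhs_right_gt.
  rewrite (iE s q) ?(le_trans t1 (ltW ts))//; last by near: s; exact: truncn_right.
  by congr phi; apply/esym; near: s; exact: count_right.
have [q hq] := @truncn_left _ t NR t1.
have [c hc] := @count_left (E q.+1) (iota 1 (bfw_navail has q.+1)) _ q%:R t NR.
apply/cvg_ex; exists (phi q c t).
have := lin t _ (at_left_proper_filter t) q c (cvg_at_left_filter (@cvg_id _ _)).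
apply: cvg_trans; apply: near_eq_cvg; near=> s.
have ss : 0 < s by near: s; exact: nbhs_left_gt.
rewrite (iE s q) ?(ltW ss)//; last by near: s.
by congr phi; apply/esym; near: s.
Unshelve. all: by end_near.
Qed.

End Cadlag.

(** * Lipschitz envelopes of a Skorokhod-continuous functional *)

Section Envelope.
Context {R : realType} (sigma : R) (F : (R -> R) -> R) (C : R).
Hypothesis FC : forall x, cadlag_on sigma x -> `|F x| <= C.
Hypothesis Fcont : skorokhod_continuous sigma F.

Definition near_unif (x y : R -> R) (r : R) : Prop :=
  forall t, 0 <= t <= sigma -> `|x t - y t| <= r.

(** The radius r ranges over all upper bounds of the uniform distance from g to x, which gives the
    same supremum as the distance itself when c >= 0. *)
Definition envset (c : R) (x : R -> R) : set R :=
  [set v | exists g r, [/\ cadlag_on sigma g, 0 <= r, near_unif g x r & v = F g - c * r]].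

(* The smallest majorant of F that is c-Lipschitz in the uniform norm; it
   decreases to F as c tends to infinity, because Skorokhod continuity at a path
   entails continuity there in the uniform norm. *)
Definition env (c : R) (x : R -> R) : R := sup (envset c x).

Lemma envset_ub c x v : 0 <= c -> envset c x v -> v <= C.
Proof.
move=> c0 [g [r [gc r0 _ ->]]].
have := le_trans (ler_norm _) (FC gc); have : 0 <= c * r by rewrite mulr_ge0.
by lra.
Qed.

Lemma env_ge c x g r : 0 <= c -> cadlag_on sigma g -> 0 <= r -> near_unif g x r ->
  F g - c * r <= env c x.
Proof.
move=> c0 gc r0 gx.
have hub : has_ubound (envset c x) by exists C => v; exact: envset_ub.
by apply: (ub_le_sup hub); exists g, r.
Qed.

Lemma env_le c x M : cadlag_on sigma x ->
  (forall g r, cadlag_on sigma g -> 0 <= r -> near_unif g x r -> F g - c * r <= M) ->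
  env c x <= M.
Proof.
move=> xc H; apply: ge_sup.
  by exists (F x - c * 0), x, 0; split=> // t _; rewrite subrr normr0.
by move=> v [g [r [gc r0 gx ->]]]; exact: H.
Qed.

Lemma env_self c x : 0 <= c -> cadlag_on sigma x -> F x <= env c x.
Proof.
move=> c0 xc; rewrite -[leLHS]subr0 -[X in _ - X](mulr0 c).
by apply: env_ge => // t _; rewrite subrr normr0.
Qed.

Lemma env_bound c x : 0 <= c -> cadlag_on sigma x -> `|env c x| <= C.
Proof.
move=> c0 xc; rewrite ler_norml; apply/andP; split.
  apply: le_trans (env_self c0 xc); rewrite lerNl.
  by apply: le_trans (FC xc); rewrite -normrN ler_norm.
by apply: env_le => // g r gc r0 gx; apply: (@envset_ub c x) => //; exists g, r.
Qed.

Lemma env_lip c x y e : 0 <= c -> 0 <= e -> cadlag_on sigma x -> near_unif x y e ->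
  env c x <= env c y + c * e.
Proof.
move=> c0 e0 xc xy; apply: env_le => // g r gc r0 gx.
have -> : F g - c * r = F g - c * (r + e) + c * e by ring.
rewrite lerD2r; apply: env_ge => //; first exact: addr_ge0.
move=> t ts; have -> : g t - y t = (g t - x t) + (x t - y t) by ring.
by apply: le_trans (ler_normD _ _) _; apply: lerD; [exact: gx|exact: xy].
Qed.

(** Competitors at distance below d have F within e of F x; farther ones pay a penalty n d >= 2 C,
    which no value of F can offset. *)
Lemma env_cvg x : cadlag_on sigma x -> env n%:R x @[n --> \oo] --> F x.
Proof.
move=> xc; apply/cvgrPdist_le => e e0; have [d d0 H] := Fcont xc e0.
have C0 : 0 <= C by apply: le_trans (FC xc).
exists (truncn ((C + C) / d)).+1 => // n /= nn.
have lo : F x <= env n%:R x by exact: env_self.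
rewrite distrC ger0_norm ?subr_ge0// lerBlDr; apply: env_le => // g r gc r0 gx.
have [rd|dr] := ltP r d.
  have : `|F x - F g| < e.
    (* With the identity as time change, uniform closeness is Skorokhod closeness. *)
    apply: H => //; exists id; split.
      by split=> //; apply: continuous_subspaceT => z; exact: cvg_id.
    move=> t ts; rewrite subrr normr0; split=> //.
    by rewrite distrC; apply: le_lt_trans (gx t ts) rd.
  rewrite ltr_norml => /andP[h _]; have : 0 <= n%:R * r by rewrite mulr_ge0.
  by lra.
have nd : C + C <= n%:R * d.
  rewrite -ler_pdivrMr//; apply/ltW; apply: lt_le_trans (truncnS_gt _) _.
  by rewrite ler_nat.
have h1 : n%:R * d <= n%:R * r by rewrite ler_wpM2l.
have h2 := le_trans (ler_norm _) (FC gc).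
have h3 : - F x <= C by apply: le_trans (FC xc); rewrite -normrN ler_norm.
by lra.
Qed.

End Envelope.

(** * Step paths built from block increments *)

Section StepPath.
Context {R : realType} (sigma : R) (m : nat) (w : R -> R).
Hypothesis sigma0 : 0 < sigma.
Hypothesis m0 : (0 < m)%N.
Hypothesis w1 : forall t, 0 <= t <= sigma -> 0 <= w t <= 1.

Definition gridt (j : nat) : R := sigma * (j%:R / m%:R).

(** Capped at m - 1, so that t = sigma belongs to the last block. *)
Definition bidx (t : R) : nat := minn (truncn (m%:R / sigma * t)) m.-1.

(** Evaluated at the start of the block of t: only complete earlier blocks are summed, so the path
    depends on the first m - 1 coordinates. *)
Definition step_path (y : nat -> R) (t : R) : R :=
  w (gridt (bidx t)) * \sum_(r < bidx t) y r.

Let mR : 0 < m%:R :> R. Proof. by rewrite ltr0n. Qed.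
Let ms : 0 < m%:R / sigma. Proof. by rewrite divr_gt0. Qed.

Lemma bidx_lt t : (bidx t < m)%N.
Proof. by rewrite /bidx (leq_ltn_trans (geq_minr _ _))// prednK. Qed.

Lemma gridt_in j : (j <= m)%N -> 0 <= gridt j <= sigma.
Proof.
move=> jm; rewrite /gridt mulr_ge0 ?divr_ge0 ?(ltW sigma0)//=.
by rewrite ler_piMr ?(ltW sigma0)// ler_pdivrMr// mul1r ler_nat.
Qed.

Lemma bidx_near t : 0 <= t <= sigma -> gridt (bidx t) <= t <= gridt (bidx t) + sigma / m%:R.
Proof.
move=> /andP[t0 ts]; have mt0 : 0 <= m%:R / sigma * t by rewrite mulr_ge0// ltW.
have /andP[h1 h2] := truncn_itv mt0.
have gE j : gridt j = j%:R * (m%:R / sigma)^-1.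
  by rewrite /gridt; field; rewrite !gt_eqF.
have tE : t = (m%:R / sigma * t) * (m%:R / sigma)^-1 by rewrite mulrC mulKf ?gt_eqF.
have hs : sigma / m%:R = (m%:R / sigma)^-1 by rewrite invf_div.
have i0 : 0 <= (m%:R / sigma)^-1 by rewrite invr_ge0 ltW.
apply/andP; split.
  rewrite gE [leRHS]tE ler_wpM2r//; apply: le_trans h1.
  by rewrite ler_nat geq_minl.
rewrite gE hs -[X in _ + X]mul1r -mulrDl natr1.
rewrite /bidx minnE; have [le|gt] := leqP (truncn (m%:R / sigma * t)) m.-1.
  by rewrite -minnE (minn_idPl le) [leLHS]tE ler_wpM2r// ltW.
rewrite -minnE (minn_idPr (ltnW gt)) prednK// -hs mulrC divfK//.
by rewrite gt_eqF.
Qed.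

Lemma cadlag_step y : cadlag_on sigma (step_path y).
Proof.
split=> t /andP[t1 t2].
  apply: cvg_near_cst; near=> s; rewrite /step_path.
  suff -> : bidx s = bidx t by [].
  by congr minn; near: s; exact: truncn_right.
have [q hq] := truncn_left ms t1.
apply/cvg_ex; exists (w (gridt (minn q m.-1)) * \sum_(r < minn q m.-1) y r).
apply: cvg_near_cst; near=> s; rewrite /step_path.
suff -> : bidx s = minn q m.-1 by [].
by congr minn; near: s.
Unshelve. all: by end_near.
Qed.

Lemma step_path_lip y y' e : 0 <= e -> (forall r, (r < m.-1)%N -> `|y r - y' r| <= e) ->
  near_unif sigma (step_path y) (step_path y') (m%:R * e).
Proof.
move=> e0 H t ts; rewrite /step_path -mulrBr -sumrB normrM.
have /w1/andP[w0 w1'] : 0 <= gridt (bidx t) <= sigma by apply: gridt_in; exact: ltnW (bidx_lt _).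
rewrite (ger0_norm w0) -[leRHS]mul1r; apply: ler_pM => //.
apply: le_trans (ler_norm_sum _ _ _) _.
apply: (@le_trans _ _ (\sum_(r < bidx t) e)).
  by apply: ler_sum => r _; apply: H; apply: leq_trans (ltn_ord r) _; exact: geq_minr.
rewrite sumr_const card_ord -[leLHS]mulr_natl ler_wpM2r// ler_nat ltnW//.
exact: bidx_lt.
Qed.

End StepPath.

(** * Asymptotics in N *)

Lemma near_natmul (R : realType) (a C : R) : 0 < a -> \forall N \near \oo, C <= a * N%:R.
Proof.
move=> a0; exists (truncn (C / a)).+1 => // N /= hN.
rewrite mulrC -ler_pdivrMr//; apply/ltW; apply: lt_le_trans (truncnS_gt _) _.
by rewrite ler_nat.
Qed.

Lemma near_sqrtmul (R : realType) (a C : R) : 0 < a ->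
  \forall N \near \oo, C <= a * Num.sqrt N%:R.
Proof.
move=> a0; near=> N.
have h : (C / a) ^+ 2 <= 1 * N%:R by near: N; exact: near_natmul.
rewrite mulrC -ler_pdivrMr//; apply: le_trans (ler_norm _) _.
by rewrite -sqrtr_sqr ler_wsqrtr// -[leRHS]mul1r.
Unshelve. all: by end_near.
Qed.

(** Cube y/3 <= exp(y/3). With y = sqrt(m) e this decay of order m^(-3/2) beats the m blocks of the
    union bound in [bad_small]. *)
Lemma expRN_cube (R : realType) (y : R) : 0 < y -> expR (- y) <= 27 / y ^+ 3.
Proof.
move=> y0; have h := expR_ge1Dx (y / 3).
have h3 : y / 3 <= expR (y / 3) by lra.
have e3 : expR y = expR (y / 3) ^+ 3.
  by rewrite -expRM_natr; congr expR; rewrite -mulrA mulVf ?mulr1// pnatr_eq0.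
have y3 : 0 < y ^+ 3 by rewrite exprn_gt0.
have y3' : 0 <= y / 3 by rewrite divr_ge0// ltW.
rewrite expRN e3 -(invf_div (y ^+ 3)) lef_pV2 ?posrE ?exprn_gt0 ?expR_gt0 ?divr_gt0//.
have -> : y ^+ 3 / 27 = (y / 3) ^+ 3 by field.
by rewrite lerXn2r ?nnegrE ?expR_ge0.
Qed.

(** * Estimates valid for all large N *)

Section Regular.
Context {R : realType} (beta : nat -> R) (sigma sigma' : R).
Hypothesis beta0 : forall j, (2 <= j)%N -> 0 <= beta j.
Hypothesis beta2 : beta 2%N = 1 / 2.
Hypothesis bcvg : cvg (series (betap_terms beta 1) @ \oo).
Hypothesis sigma0 : 0 < sigma.
Hypothesis ss' : sigma < sigma'.
Hypothesis s'1 : sigma' < 1.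

Local Notation bp := (betap beta).
Local Notation lam N := (lambda2 beta N).

Lemma lambda2_ge0 N m : 0 <= lam N m.
Proof.
rewrite /lambda2 mulr_ge0// sumr_ge0// => j _.
by rewrite divr_ge0// mulr_ge0// beta0// addn2.
Qed.

Lemma lambda2_gt0 N m : (1 < N)%N -> 0 < lam N m.
Proof.
move=> N1; rewrite /lambda2 mulr_gt0 ?ltr0n ?(ltnW N1)// big_ord_recl /=.
apply: ltr_wpDr.
  rewrite sumr_ge0// => j _.
  by rewrite divr_ge0// mulr_ge0// beta0// addn2.
by rewrite beta2 bin0 mulr1 !divr_gt0// ltr0n bin_gt0.
Qed.

Definition blk (m N j : nat) : nat := truncn (N%:R * gridt sigma m j).

(** One step beyond the integer part of N sigma, because the interpolation at sigma reads the
    children of the following step. *)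
Definition horizon (N : nat) : nat := (truncn (N%:R * sigma)).+1.

Lemma gridt_max m : (0 < m)%N -> gridt sigma m m = sigma.
Proof. by move=> m0; rewrite /gridt divff ?mulr1// pnatr_eq0 -lt0n. Qed.

Lemma gridt0 m : gridt sigma m 0 = 0.
Proof. by rewrite /gridt mul0r mulr0. Qed.

Lemma gridt_mono m i j : (i <= j)%N -> gridt sigma m i <= gridt sigma m j.
Proof.
by move=> ij; rewrite ler_wpM2l ?(ltW sigma0)// ler_wpM2r ?invr_ge0// ler_nat.
Qed.

Lemma gridtS m j : gridt sigma m j.+1 = gridt sigma m j + sigma / m%:R.
Proof. by rewrite /gridt -natr1; ring. Qed.

Lemma blk0 m N : blk m N 0 = 0%N.
Proof. by rewrite /blk gridt0 mulr0 truncn0. Qed.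

Lemma blkS m N j : (blk m N j <= blk m N j.+1)%N.
Proof. by apply: le_truncn; rewrite ler_wpM2l// gridt_mono. Qed.

Lemma horizon_blk m N : (0 < m)%N -> horizon N = (blk m N m).+1.
Proof. by move=> m0; rewrite /blk gridt_max. Qed.

Lemma blk_itv m N j : (blk m N j)%:R <= N%:R * gridt sigma m j < (blk m N j).+1%:R.
Proof. by apply: truncn_itv; rewrite mulr_ge0// -(gridt0 m) gridt_mono. Qed.

Lemma blk_width m N j : (0 < m)%N ->
  ((blk m N j.+1).+1 - blk m N j)%:R <= N%:R * (sigma / m%:R) + 2 :> R.
Proof.
move=> m0; have /andP[_ h1] := blk_itv m N j; have /andP[h2 _] := blk_itv m N j.+1.
rewrite natrB ?leqW ?blkS//; move: h1 h2; rewrite gridtS -!natr1 mulrDr; lra.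
Qed.

Record regular (C1 c0 Amax : R) (N : nat) : Prop := Regular {
  reg_gt1 : (1 < N)%N;
  reg_hor : (horizon N)%:R <= sigma' * N%:R;
  reg_lam : forall m, (m < horizon N)%N -> lam N m <= c0 / N%:R;
  reg_Amax : Am (lam N) (horizon N) <= Amax;
  reg_Lam : forall i, (i <= horizon N)%N -> `|Lam (lam N) i - bp (i%:R / N%:R)| <= C1 / N%:R;
  reg_w : forall i, (i <= horizon N)%N ->
    `|(Am (lam N) i)^-1 - expR (- bp (i%:R / N%:R))| <= C1 / N%:R }.

Lemma reg_frac C1 c0 Amax N i : regular C1 c0 Amax N -> (i <= horizon N)%N ->
  0 <= (i%:R / N%:R : R) <= sigma'.
Proof.
move=> rg iL; have N0 : 0 < N%:R :> R by rewrite ltr0n ltnW// (reg_gt1 rg).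
rewrite divr_ge0 ?(ltW N0)//= ler_pdivrMr//; apply: le_trans (reg_hor rg).
by rewrite ler_nat.
Qed.

Lemma reg_horN C1 c0 Amax N : regular C1 c0 Amax N -> (horizon N <= N)%N.
Proof.
move=> rg; have := reg_hor rg => h.
rewrite -(ler_nat R); apply: le_trans h _.
by rewrite ler_piMl// ltW.
Qed.

Let s'01 : 0 < sigma' < 1. Proof. by rewrite s'1 (lt_trans sigma0). Qed.

(** A single rate is a difference of two sums, each within C/N of beta', which is Lipschitz on
    [0, sigma']; whence c0 = [blip] + 2 C. *)
Lemma ex_regular : exists C1 c0 Amax : R, [/\ 0 <= C1, 0 <= c0, 1 <= Amax &
  \forall N \near \oo, regular C1 c0 Amax N].
Proof.
have [C [N0 [C0 H]]] := Lam_near beta0 beta2 bcvg s'01.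
have b1 : 0 <= bp 1 by apply: (betap_ge0 beta0 beta2 bcvg); rewrite ler01 lexx.
have bl0 : 0 <= blip beta sigma' := blip_ge0 beta0 beta2 bcvg s'01.
exists C, (blip beta sigma' + (C + C)), (expR (bp 1 + C)); split=> //.
- by rewrite !addr_ge0.
- by rewrite -[leLHS](expR0 R) ler_expR addr_ge0.
near=> N.
have N1 : (1 < N)%N by near: N; exact: nbhs_infty_ge.
have NN0 : (N0 <= N)%N by near: N; exact: nbhs_infty_ge.
have NR : 0 < N%:R :> R by rewrite ltr0n ltnW.
have hor : (horizon N)%:R <= sigma' * N%:R.
  have h1 : 1 <= (sigma' - sigma) * N%:R by near: N; apply: near_natmul; rewrite subr_gt0.
  have /andP[h2 _] : (truncn (N%:R * sigma))%:R <= N%:R * sigma < (truncn (N%:R * sigma)).+1%:R.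
    by apply: truncn_itv; rewrite mulr_ge0// ltW.
  by rewrite /horizon -natr1; move: h1 h2; rewrite mulrBl (mulrC N%:R); lra.
have fr i : (i <= horizon N)%N -> 0 <= (i%:R / N%:R : R) <= sigma'.
  move=> iL; rewrite divr_ge0 ?(ltW NR)//= ler_pdivrMr//; apply: le_trans hor.
  by rewrite ler_nat.
have LamH i : (i <= horizon N)%N -> `|Lam (lam N) i - bp (i%:R / N%:R)| <= C / N%:R.
  move=> iL; apply: H => //; apply: le_trans hor; by rewrite ler_nat.
have fr1 i : (i <= horizon N)%N -> 0 <= (i%:R / N%:R : R) <= 1.
  by move=> /fr/andP[-> h]; rewrite (le_trans h)// ltW.
have CN1 : C / N%:R <= C by rewrite ler_pdivrMr// ler_peMr// ler1n ltnW.
split=> //.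
- move=> m mL; have e : lam N m = Lam (lam N) m.+1 - Lam (lam N) m.
    by rewrite /Lam big_ord_recr /= addrAC subrr add0r.
  have /andP[_ a1] : - (C / N%:R) <= Lam (lam N) m.+1 - bp (m.+1%:R / N%:R) <= C / N%:R.
    by rewrite -ler_norml LamH.
  have /andP[a2 _] : - (C / N%:R) <= Lam (lam N) m - bp (m%:R / N%:R) <= C / N%:R.
    by rewrite -ler_norml LamH// ltnW.
  have := betap_dist beta0 beta2 bcvg s'01 (fr m.+1 mL) (fr m (ltnW mL)).
  have -> : m.+1%:R / N%:R - m%:R / N%:R = N%:R^-1 :> R.
    by rewrite -natr1; field; rewrite gt_eqF.
  rewrite (ger0_norm (_ : 0 <= N%:R^-1)) ?invr_ge0 ?(ltW NR)//.
  move=> /(le_trans (ler_norm _)) a3; rewrite e !mulrDl.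
  by move: a1 a2 a3; lra.
- rewrite ler_expR; have /andP[_ a1] : - (C / N%:R) <= Lam (lam N) (horizon N)
     - bp ((horizon N)%:R / N%:R) <= C / N%:R by rewrite -ler_norml LamH.
  have /andP[f0 f1] := fr1 _ (leqnn (horizon N)).
  have a2 : bp ((horizon N)%:R / N%:R) <= bp 1 by apply: (betap_mono beta0 beta2 bcvg).
  by move: a1 a2 CN1; lra.
- move=> i iL; rewrite -expRN; apply: le_trans (LamH i iL); apply: expRN_lip.
    by rewrite /Lam sumr_ge0// => l _; exact: lambda2_ge0.
  by apply: (betap_ge0 beta0 beta2 bcvg); exact: fr1.
Unshelve. all: by end_near.
Qed.

Variables (C1 c0 Amax : R).
Hypothesis C10 : 0 <= C1.
Hypothesis c00 : 0 <= c0.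
Hypothesis Amax1 : 1 <= Amax.
Hypothesis reg : \forall N \near \oo, regular C1 c0 Amax N.

Local Notation K N := (walkK N (lambda2_ge0 N)).
Local Notation good m e N := (goodb N (lam N) m (blk m N) e).

(** Take theta = sqrt(m) in [prob_bad]. A block has about N sigma/m steps, so the variance term in
    the exponent stays bounded, while exp(-sqrt(m) e) outweighs the factor m. *)
Lemma bad_small (e eta : R) : 0 < e -> 0 < eta ->
  \forall m \near \oo, \forall N \near \oo,
    EE (K N) (horizon N) [::] (fun l => (~~ good m e N l)%:R) <= eta.
Proof.
move=> e0 eta0; pose kap : R := 2 * c0 * Amax ^+ 2.
have kap0 : 0 <= kap by apply: (mulr_ge0 _ (sqr_ge0 _)); exact: mulr_ge0.
pose X : R := 2 * (27 * expR (kap * (sigma + 1))).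
have e3 : 0 < e ^+ 3 * eta by rewrite mulr_gt0// exprn_gt0.
near=> m.
have m0 : (0 < m)%N by near: m; exact: nbhs_infty_ge.
have mR : 0 < m%:R :> R by rewrite ltr0n.
have Xm : X <= e ^+ 3 * eta * Num.sqrt m%:R by near: m; exact: near_sqrtmul.
near=> N.
have rg : regular C1 c0 Amax N by near: N; exact: reg.
have N2 : 2 * m%:R <= 1 * N%:R :> R by near: N; exact: near_natmul.
have N3 : Num.sqrt m%:R * Amax <= 1 / 2 * Num.sqrt N%:R by near: N; exact: near_sqrtmul.
have N1 : (0 < N)%N by exact: ltnW (reg_gt1 rg).
have NR : 0 < N%:R :> R by rewrite ltr0n.
have sm0 : 0 < Num.sqrt m%:R :> R by rewrite sqrtr_gt0.
have smm : Num.sqrt m%:R ^+ 2 = m%:R :> R by rewrite sqr_sqrtr// ltW.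
have thA : Num.sqrt m%:R * Amax <= Num.sqrt N%:R / 2 by apply: le_trans N3 _; rewrite mulrC mul1r.
have pb := prob_bad (lambda2_ge0 N) N1 (reg_horN rg) (reg_lam rg) (reg_Amax rg) e
  (blkS m N) (horizon_blk N m0) (sqrtr_ge0 _) thA c00 (fun j _ => blk_width N j m0).
apply: le_trans pb _.
rewrite expRD.
have h1 : expR (- (Num.sqrt m%:R * e)) <= 27 / (Num.sqrt m%:R * e) ^+ 3.
  by apply: expRN_cube; rewrite mulr_gt0.
have h2 : expR (2 * c0 * Amax ^+ 2 * Num.sqrt m%:R ^+ 2 / N%:R * (N%:R * (sigma / m%:R) + 2))
    <= expR (kap * (sigma + 1)).
  rewrite ler_expR smm -/kap.
  have -> : kap * m%:R / N%:R * (N%:R * (sigma / m%:R) + 2) = kap * (sigma + 2 * m%:R / N%:R).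
    by field; rewrite !gt_eqF.
  by rewrite ler_wpM2l// lerD2l ler_pdivrMr.
apply: (@le_trans _ _ (m%:R * (2 * (27 / (Num.sqrt m%:R * e) ^+ 3 * expR (kap * (sigma + 1)))))).
  rewrite ler_pM2l// ler_pM2l//; apply: ler_pM => //; exact: expR_ge0.
have -> : m%:R * (2 * (27 / (Num.sqrt m%:R * e) ^+ 3 * expR (kap * (sigma + 1))))
   = X / (e ^+ 3 * Num.sqrt m%:R).
  rewrite /X -[X in X * (2 * _)]smm; field.
  by rewrite !gt_eqF.
rewrite ler_pdivrMr ?mulr_gt0 ?exprn_gt0//; apply: le_trans Xm _.
by rewrite le_eqVlt; apply/orP; left; apply/eqP; ring.
Unshelve. all: by end_near.
Qed.

Hypothesis z0 : forall t, 0 <= t <= sigma' -> 0 <= zfun beta t.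
Hypothesis zpos : forall t, 0 < t <= sigma' -> 0 < zfun beta t.

Lemma zfun_lip u v : 0 <= u <= sigma' -> 0 <= v <= sigma' ->
  `|zfun beta u - zfun beta v| <= (1 + blip beta sigma') * `|u - v|.
Proof.
move=> us vs; have -> : zfun beta u - zfun beta v =
   - (u - v) - (expR (- bp u) - expR (- bp v)) by rewrite /zfun; ring.
apply: le_trans (ler_normB _ _) _; rewrite normrN mulrDl mul1r lerD2l.
exact: (expRN_betap_dist beta0 beta2 bcvg s'01).
Qed.

Lemma zfun_min dl : 0 < dl -> dl <= sigma' -> exists2 kap, 0 < kap &
  forall t, dl <= t <= sigma' -> kap <= zfun beta t.
Proof.
move=> dl0 dls; pose cl (x : R) := Num.min (Num.max x 0) sigma'.
have s'0 : 0 < sigma' by case/andP: s'01.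
have cls x : 0 <= cl x <= sigma'.
  by rewrite le_min (ltW s'0) le_max lexx orbT ge_min lexx orbT.
have clE t : dl <= t <= sigma' -> cl t = t.
  move=> /andP[t1 t2]; rewrite /cl max_l ?min_l//.
  by apply: le_trans t1; exact: ltW.
have B1 : 0 < 1 + blip beta sigma'.
  by have := blip_ge0 beta0 beta2 bcvg s'01; lra.
have cont : {within `[dl, sigma'], continuous (zfun beta \o cl)}.
  apply: continuous_subspaceT => x; apply/cvgrPdist_le => e e0.
  near=> z; rewrite /=; apply: le_trans (zfun_lip (cls _) (cls _)) _.
  apply: (@le_trans _ _ ((1 + blip beta sigma') * `|x - z|)).
    by rewrite ler_pM2l// clamp_lip.
  rewrite mulrC -ler_pdivlMr//; near: z.
  have := @cvgr_dist_le _ _ _ (nbhs x) _ id x (@cvg_id _ (nbhs x))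
    (e / (1 + blip beta sigma')) (divr_gt0 e0 B1).
  exact.
have [c cI cmin] := EVT_min dls cont.
move: cI; rewrite in_itv /= => cI.
exists (zfun beta c).
  by apply: zpos; case/andP: cI => c1 ->; rewrite (lt_le_trans dl0).
move=> t tI; have := cmin t; rewrite in_itv /= tI => /(_ isT).
by rewrite !clE.
Unshelve. all: by end_near.
Qed.

Section GoodPaths.
Variables (e : R) (m : nat).
Hypothesis e0 : 0 < e.
Hypothesis m0 : (0 < m)%N.

(** After the first block sqrt(N) z is at least m e, the bound on Q accumulated over m blocks; this
    is the hypothesis [hz1] behind [calm]. *)
Definition sepN (N : nat) : Prop := forall i, (blk m N 1 < i <= horizon N)%N ->
  m%:R * e <= Num.sqrt N%:R * (1 - i%:R / N%:R - expR (- bp (i%:R / N%:R))).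

Lemma near_sepN : \forall N \near \oo, sepN N.
Proof.
have [|ge] := ltP (sigma / m%:R) sigma'; last first.
  have : sigma / m%:R <= sigma by rewrite ler_pdivrMr ?ltr0n// ler_peMr ?ler1n// ltW.
  by move=> /(le_trans ge); rewrite leNgt ss'.
move=> sm; have [|kap k0 hk] := @zfun_min (sigma / m%:R) _ (ltW sm).
  by rewrite divr_gt0// ltr0n.
near=> N; have rg : regular C1 c0 Amax N by near: N; exact: reg.
have NR : 0 < N%:R :> R by rewrite ltr0n ltnW// (reg_gt1 rg).
move=> i /andP[i1 iL]; apply: (@le_trans _ _ (kap * Num.sqrt N%:R)).
  by near: N; exact: near_sqrtmul.
rewrite mulrC ler_wpM2l ?sqrtr_ge0// -/(zfun beta (i%:R / N%:R)); apply: hk.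
have /andP[_ ->] := reg_frac rg iL; rewrite andbT ler_pdivlMr//.
have /andP[_ h] := blk_itv m N 1; apply: ltW.
have -> : sigma / m%:R * N%:R = N%:R * gridt sigma m 1 by rewrite gridtS gridt0; ring.
by apply: lt_le_trans h _; rewrite ler_nat.
Unshelve. all: by end_near.
Qed.

Lemma good_calm_blk N l : size l = horizon N ->
  good m e N l -> calm N (lam N) (horizon N) e (m%:R * e) (blk m N 1) l.
Proof.
by move=> sl gl; apply: (good_calm (blk0 m N) (blkS m N) (horizon_blk N m0) m0 (ltW e0)).
Qed.

End GoodPaths.

(** Oscillation 1 per block is good enough here: it leaves [navail] within order sqrt(N) of N/A, and
    this is divided by N. The number of blocks only serves to make bad histories rare. *)
Lemma gerr_small (c eta : R) : 0 <= c -> 0 < eta ->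
  \forall N \near \oo,
  EE (K N) (horizon N) [::] (gerr (tauw (lam N)) (Am (lam N)) c (K N) (xi N (lam N))) <= eta.
Proof.
move=> cc eta0.
pose ec : R := errconst c0 Amax.
have ec0 : 0 <= ec.
  have [N [rg]] : exists N, regular C1 c0 Amax N /\ True.
    by case: reg => n _ h; exists n; split=> //; apply: h => /=.
  have N1 : (0 < N)%N by exact: ltnW (reg_gt1 rg).
  by move=> _; exact: (errconst_ge0 (lambda2_ge0 N) N1 (isT : (0 < horizon N)%N) (reg_lam rg) (reg_Amax rg)).
have cE : 0 < c * ec + 1 by rewrite ltr_wpDl// mulr_ge0.
pose eta1 : R := eta / (c * ec + 1) / 2.
have eta10 : 0 < eta1 by rewrite !divr_gt0.
have [m [m0 hm]] : exists m, (0 < m)%N /\ \forall N \near \oo,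
    EE (K N) (horizon N) [::] (fun l => (~~ good m 1 N l)%:R) <= eta1.
  have h : \forall m \near \oo, (0 < m)%N /\ \forall N \near \oo,
      EE (K N) (horizon N) [::] (fun l => (~~ good m 1 N l)%:R) <= eta1.
    near=> m; split; near: m; first exact: nbhs_infty_ge.
    exact: bad_small.
  by case: h => n _ h; exists n; apply: h => /=.
near=> N.
have rg : regular C1 c0 Amax N by near: N; exact: reg.
have bad : EE (K N) (horizon N) [::] (fun l => (~~ good m 1 N l)%:R) <= eta1.
  by near: N; exact: hm.
have sp : sepN 1 m N by near: N; exact: near_sepN.
have N1 : (0 < N)%N by exact: ltnW (reg_gt1 rg).
have NR : 0 < N%:R :> R by rewrite ltr0n.
pose W : R := m%:R * 1 + (Amax * (1 + (C1 + 1)) + Amax * (1 + (C1 + 1))).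
have big : W + 1 <= eta1 * Num.sqrt N%:R by near: N; exact: near_sqrtmul.
have sN1 : 1 <= Num.sqrt N%:R :> R by rewrite -[leLHS]sqrtr1 ler_wsqrtr// ler1n.
have sN0 : 0 < Num.sqrt N%:R :> R by exact: lt_le_trans sN1.
have sNN : Num.sqrt N%:R * Num.sqrt N%:R = N%:R :> R by rewrite -expr2 sqr_sqrtr// ltW.
have a0 : 0 <= Amax by exact: le_trans Amax1.
pose V : R := Num.sqrt N%:R * (m%:R * 1) + (Pbound N Amax C1 1 + Pbound N Amax C1 1).
have Pb : Pbound N Amax C1 1 <= Num.sqrt N%:R * (Amax * (1 + (C1 + 1))).
  rewrite /Pbound mulrCA; apply: ler_wpM2l => //; rewrite !mulrDr !mulr1.
  by apply: lerD => //; apply: lerD => //; rewrite ler_peMl.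
have Pb0 : 0 <= Pbound N Amax C1 1.
  by rewrite /Pbound mulr_ge0// !addr_ge0// mulr_ge0// ltW.
have V0 : 0 <= V by rewrite /V !addr_ge0// mulr_ge0 ?ltW// mulr1 ltr0n.
have VW : V / N%:R <= W / Num.sqrt N%:R.
  rewrite ler_pdivrMr// (_ : W / Num.sqrt N%:R * N%:R = Num.sqrt N%:R * W).
    rewrite /V /W [leRHS]mulrDr [X in _ <= _ + X]mulrDr.
    by apply: lerD; [exact: lexx|exact: lerD].
  by rewrite -[X in _ * X = _]sNN mulrA divfK ?gt_eqF// mulrC.
apply: le_trans (EE_gerr_le (lam0 := lambda2_ge0 N) (g := good m 1 N) N1 (reg_horN rg) isT
  (reg_lam rg) (reg_Amax rg) cc V0 _) _.
  move=> l vl sl gl i iL.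
  apply: (navail_calm N1 (reg_horN rg) (reg_Amax rg) (reg_w rg) ler01 _ _ sp vl sl
    (good_calm_blk ltr01 m0 sl gl)) => //.
  by move=> j jL; apply: z0; exact: reg_frac rg jL.
have h1 : V / N%:R + (Num.sqrt N%:R)^-1 <= eta1.
  apply: (@le_trans _ _ ((W + 1) / Num.sqrt N%:R)); first by rewrite [leRHS]mulrDl mul1r lerD2r.
  by rewrite ler_pdivrMr.
apply: (@le_trans _ _ (c * ec * (eta1 + eta1))).
  by apply: ler_wpM2l; [exact: mulr_ge0|exact: lerD].
apply: (@le_trans _ _ ((c * ec + 1) * (eta1 + eta1))).
  by rewrite ler_wpM2r ?lerDl// addr_ge0// ltW.
by rewrite le_eqVlt; apply/orP; left; apply/eqP; rewrite /eta1; field; rewrite gt_eqF.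
Unshelve. all: by end_near.
Qed.

End Regular.

(** * Block sums as coordinates *)

Section Blocks.
Variables (m : nat) (it : nat -> nat).
Hypothesis it0 : it 0 = 0%N.
Hypothesis itS : forall j, (it j <= it j.+1)%N.

(** Equals m when step k lies beyond all blocks, so that such a step touches no coordinate below
    m. *)
Definition blkidx (k : nat) : nat := find (fun r => (k < it r.+1)%N) (iota 0 m).

Lemma blkidx_eq k r : (r < m)%N -> (r == blkidx k) = (it r <= k < it r.+1)%N.
Proof.
move=> rm; have nthE i : (i < m)%N -> nth 0%N (iota 0 m) i = i by move=> im; rewrite nth_iota.
apply/eqP/idP => [re|/andP[h1 h2]].
  have hs : has (fun r => (k < it r.+1)%N) (iota 0 m) by rewrite has_find size_iota -/(blkidx k) -re.
  have := nth_find 0%N hs; rewrite -/(blkidx k) -re nthE// => ->; rewrite andbT.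
  case: r rm re {hs} => [|r] rm re; first by rewrite it0.
  have := @before_find _ 0%N (fun r => (k < it r.+1)%N) (iota 0 m) r.
  rewrite -/(blkidx k) -re ltnSn (nthE r (ltnW rm)) => /(_ isT)/negbT.
  by rewrite -leqNgt.
have hs : has (fun r => (k < it r.+1)%N) (iota 0 m).
  by apply/hasP; exists r => //; rewrite mem_iota.
have bm : (blkidx k < m)%N by move: hs; rewrite has_find size_iota.
have := nth_find 0%N hs; rewrite -/(blkidx k) nthE// => kb.
have [|b|//] := ltngtP r (blkidx k).
  by move=> /(before_find 0%N); rewrite nthE// h2.
have := leq_trans kb (leq_trans (it_mono itS b) h1).
by rewrite ltnn.
Qed.

Section Paths.
Context {R : realType} (N : nat) (lam : nat -> R).

Definition blkdir (k r : nat) : R := (r == blkidx k)%:R.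

Lemma vpath_block l r : (r < m)%N ->
  vpath blkdir (xi N lam) l r = Ql N lam (pre (it r.+1) l) - Ql N lam (pre (it r) l).
Proof.
move=> rm; elim: l => [|x s IH]; first by rewrite !pre_id// subrr.
rewrite /= /vadd IH /blkdir (blkidx_eq _ rm).
have [h1|h1] := leqP (it r) (size s); last first.
  have h2 : (size s < it r.+1)%N by exact: leq_trans h1 (itS r).
  rewrite (pre_id (i := it r) (s := x :: s))// (pre_id (i := it r.+1) (s := x :: s))//.
  by rewrite (pre_id (ltnW h1)) (pre_id (ltnW h2)) !subrr mulr0 addr0.
rewrite (pre_cons x h1) /=.
have [h2|h2] := ltnP (size s) (it r.+1).
  rewrite (pre_id (i := it r.+1) (s := x :: s))// (pre_id (ltnW h2)) /= mulr1.
  by ring.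
by rewrite (pre_cons x h2) mulr0 addr0.
Qed.

End Paths.

Section Gauss.
Context {R : realType} {T : Type} {d : measure_display} {Om : measurableType d}.
Variables (B : Om -> R -> R) (tau al : nat -> R) (w : Om).

Definition gpart (i : nat) : R := \sum_(j < i) al j * gincr B tau j w.

Lemma vsum_gts_block k r : (r < m)%N ->
  vsum blkdir (gts B tau al k w) r = gpart (minn k (it r.+1)) - gpart (minn k (it r)).
Proof.
move=> rm; elim: k => [|k IH]; first by rewrite !min0n subrr.
rewrite /= /vadd IH size_gts /blkdir (blkidx_eq _ rm).
have minS i : (k < i)%N -> minn k.+1 i = k.+1 by move=> ?; apply/minn_idPl.
have minS' i : (k < i)%N -> minn k i = k by move=> ?; apply/minn_idPl; exact: ltnW.
have minT i : (i <= k)%N -> minn k.+1 i = minn k i.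
  by move=> ik; rewrite (minn_idPr (leqW ik)) (minn_idPr ik).
have gS : gpart k.+1 = gpart k + al k * gincr B tau k w by rewrite /gpart big_ord_recr.
have [h1|] := boolP (it r <= k)%N; last first.
  rewrite -ltnNge => h1; have h2 : (k < it r.+1)%N by exact: leq_trans h1 (itS r).
  by rewrite (minS _ h1) (minS _ h2) (minS' _ h1) (minS' _ h2) !subrr mulr0 addr0.
rewrite (minT _ h1) /=.
have [h2|] := boolP (k < it r.+1)%N.
  by rewrite (minS _ h2) (minS' _ h2) gS mulr1; ring.
by rewrite -leqNgt => h2; rewrite (minT _ h2) mulr0 addr0.
Qed.

End Gauss.
End Blocks.

Lemma walk_error (R : realFieldType) (s Z n1 n2 Q w0 Q0 W u cnt e1 e2 e3 e4 : R) :
  `|Z - n1 - s * (Q * w0)| <= e1 -> `|n1 - n2| <= e2 -> 0 <= u <= 1 -> 0 <= cnt <= e3 ->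
  `|Q * w0 - W * Q0| <= e4 -> 0 < s ->
  `|(Z - u + cnt - n2) / s - W * Q0| <= (e1 + e2 + 1 + e3) / s + e4.
Proof.
move=> h1 h2 /andP[u0 u1] /andP[c0 c1] h4 s0.
have -> : (Z - u + cnt - n2) / s - W * Q0
  = ((Z - n1 - s * (Q * w0)) + (n1 - n2) - u + cnt) / s + (Q * w0 - W * Q0).
  by field; rewrite gt_eqF.
apply: le_trans (ler_normD _ _) _; apply: lerD => //.
rewrite normrM (gtr0_norm (_ : 0 < s^-1)) ?invr_gt0// ler_wpM2r ?invr_ge0 ?(ltW s0)//.
have := ler_normD (Z - n1 - s * (Q * w0)) (n1 - n2).
have := ler_normB ((Z - n1 - s * (Q * w0)) + (n1 - n2)) u.
have := ler_normD ((Z - n1 - s * (Q * w0)) + (n1 - n2) - u) cnt.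
by rewrite (ger0_norm u0) (ger0_norm c0); lra.
Qed.

(** * Uniform closeness of the scaled walk to a step path *)

Section WalkApprox.
Context {R : realType} (beta : nat -> R) (sigma sigma' : R).
Hypothesis beta0 : forall j, (2 <= j)%N -> 0 <= beta j.
Hypothesis beta2 : beta 2%N = 1 / 2.
Hypothesis bcvg : cvg (series (betap_terms beta 1) @ \oo).
Hypothesis sigma0 : 0 < sigma.
Hypothesis ss' : sigma < sigma'.
Hypothesis s'1 : sigma' < 1.
Hypothesis z0 : forall t, 0 <= t <= sigma' -> 0 <= zfun beta t.

Local Notation bp := (betap beta).
Local Notation lam N := (lambda2 beta N).
Local Notation K N := (walkK N (lambda2_ge0 beta0 N)).

Let s'01 : 0 < sigma' < 1. Proof. by rewrite s'1 (lt_trans sigma0). Qed.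

Variables (C1 c0 Amax e : R) (m N : nat).
Hypothesis C10 : 0 <= C1.
Hypothesis Amax1 : 1 <= Amax.
Hypothesis rg : regular beta sigma sigma' C1 c0 Amax N.
Hypothesis e0 : 0 < e.
Hypothesis m0 : (0 < m)%N.
Hypothesis sp : sepN beta sigma e m N.
Hypothesis mN : (m <= N)%N.
Hypothesis NL : C1 + m%:R * e * C1 + Amax * (1 + C1) + (1 + blip beta sigma') + 1 + c0
  <= e * Num.sqrt N%:R.

Context {d : measure_display} {T : measurableType d} (P : probability T R).
Variables (M : T -> {set 'I_N} -> nat) (E : T -> nat -> nat -> R).
Hypothesis interp : exp_interpolation P beta M E.

Local Notation path := (pathX (childX M)).
Local Notation it := (blk sigma m N).
Local Notation W := (fun t => expR (- bp t)).
Local Notation Q := (Ql N (lam N)).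

(** Amax comes from the patches, 2 from the children counted inside a unit step, 1 from the bounded
    errors divided by sqrt(N), and 1 + 2 [blip] from moving Q and the weight to the start of the
    block. *)
Definition closeness : R := Amax + 4 + 2 * blip beta sigma'.

Lemma pre_pathX k L w : (k <= L)%N -> pre k (path L w) = path k w.
Proof.
move=> kL; elim: L kL => [|L IH]; first by rewrite leqn0 => /eqP->.
rewrite leq_eqVlt => /orP[/eqP->|kL]; first by rewrite pre_id// size_pathX.
by rewrite /= pre_cons ?size_pathX// IH.
Qed.

Lemma childX_bound k w : (k < N)%N -> (childX M k w <= kbd (K N) (path k w))%N.
Proof.
move=> kN; rewrite (childX_count interp)//=.
by apply: leq_trans (count_size _ _) _; rewrite size_iota.
Qed.

Lemma walk_close w : goodb N (lam N) m it e (path (horizon sigma N) w) ->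
  near_unif sigma (scaled_walk beta (M w) (E w))
    (step_path sigma m W (vpath (blkdir m it) (xi N (lam N)) (path (horizon sigma N) w)))
    (closeness * e).
Proof.
move=> gl t /andP[t0 ts]; set L := horizon sigma N in gl *; set l := path L w in gl *.
have N1 : (0 < N)%N by exact: ltnW (reg_gt1 rg).
have NR : 0 < N%:R :> R by rewrite ltr0n.
have sN0 : 0 < Num.sqrt N%:R :> R by rewrite sqrtr_gt0.
have mR : 0 < m%:R :> R by rewrite ltr0n.
have LN := reg_horN s'1 rg.
have sl : size l = L by rewrite size_pathX.
have vl : valid (K N) l.
  by apply: (@valid_pathX _ _ R (K N) L) => // k w' kL; apply: childX_bound; exact: leq_trans kL LN.
have bl0 : 0 <= blip beta sigma' := blip_ge0 beta0 beta2 bcvg s'01.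
have cl := good_calm_blk sigma0 e0 m0 sl gl.
pose q := truncn (N%:R * t); pose j := bidx sigma m t.
have Nt0 : 0 <= N%:R * t by rewrite mulr_ge0// ltW.
have /andP[q1 q2] := truncn_itv Nt0; rewrite -/q in q1 q2.
have qL : (q < L)%N by rewrite ltnS le_truncn// ler_pM2l.
have qL' := ltnW qL.
have jm : (j < m)%N by exact: bidx_lt.
have /andP[j1 j2] : gridt sigma m j <= t <= gridt sigma m j + sigma / m%:R.
  by apply: bidx_near => //; rewrite t0.
have jq : (it j <= q <= it j.+1)%N.
  by rewrite !le_truncn// ler_pM2l// gridtS.
have /andP[jq1 jq2] := jq.
have spre k : (k <= L)%N -> size (pre k l) = k by move=> kL; rewrite size_pre ?sl.
have Wt u : 0 <= u <= sigma' -> 0 <= W u <= 1.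
  move=> /andP[u0 us]; rewrite expR_ge0 /= expR_le1 lerNl oppr0.
  by apply: (betap_ge0 beta0 beta2 bcvg); rewrite u0 (le_trans us)// ltW.
have fq : 0 <= (q%:R / N%:R : R) <= sigma' by exact: reg_frac rg qL'.
have tsig' : 0 <= t <= sigma' by rewrite t0 (le_trans ts)// ltW.
have fj : 0 <= gridt sigma m j <= sigma'.
  by have /andP[-> h] := gridt_in sigma0 m0 (ltnW jm); rewrite (le_trans h)// ltW.
have qt1 : q%:R / N%:R <= t by rewrite ler_pdivrMr// mulrC.
have qt2 : t <= q%:R / N%:R + N%:R^-1.
  rewrite -[X in _ + X]mul1r -mulrDl ler_pdivlMr// mulrC natr1; exact: ltW.
have stepE : step_path sigma m W (vpath (blkdir m it) (xi N (lam N)) l) t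
    = W (gridt sigma m j) * Q (pre (it j) l).
  rewrite /step_path -/j; congr (_ * _).
  rewrite (eq_bigr (fun r : 'I_j => Q (pre (it r.+1) l) - Q (pre (it r) l))); last first.
    move=> r _; apply: vpath_block; [exact: blk0|exact: blkS|].
    exact: ltn_trans (ltn_ord r) jm.
  rewrite -(big_mkord xpredT (fun r => Q (pre (it r.+1) l) - Q (pre (it r) l))).
  by rewrite (telescope_sumr (fun r => Q (pre (it r) l)))// blk0 pre0 /= subr0.
rewrite stepE.
have nE : absz (Num.floor (N%:R * t)) = q by rewrite /q truncn_floor Nt0.
rewrite /scaled_walk /bfw_interp nE bfw_Z_path -(pre_pathX w qL') -/l.
set cnt := count _ _.
have osc i : (it j <= i <= (it j.+1).+1)%N -> `|Q (pre i l) - Q (pre (it j) l)| <= e.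
  exact: (good_osc (blkS sigma0 m N) (horizon_blk sigma N m0) gl sl jm).
have oq : `|Q (pre q l) - Q (pre (it j) l)| <= e by apply: osc; rewrite jq1 leqW.
have oq1 : `|Q (pre q.+1 l) - Q (pre (it j) l)| <= e.
  by apply: osc; rewrite ltnS jq2 leqW.
have cnt_le : 0 <= (cnt%:R : R) <= Num.sqrt N%:R * (e + e) + c0.
  rewrite ler0n /=.
  have qN : (q < N)%N by exact: leq_trans qL LN.
  have pS : pre q.+1 l = childX M q w :: pre q l by rewrite !pre_pathX.
  have hc := child_calm N1 LN (reg_lam rg) vl sl qL pS.
  (* Variables at most u, with u <= 1, are among those at most 1, which are the children of this
     step. *)
  apply: (@le_trans _ _ (childX M q w)%:R).
    rewrite ler_nat (childX_count interp)// /cnt bfw_navail_path.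
    apply: sub_count => i /=; move=> /le_trans; apply.
    by rewrite lerBlDr addrC natr1 ltW.
  apply: le_trans hc _; rewrite lerD2r ler_wpM2l ?(ltW sN0)//.
  have -> : Q (pre q.+1 l) - Q (pre q l)
    = (Q (pre q.+1 l) - Q (pre (it j) l)) - (Q (pre q l) - Q (pre (it j) l)) by ring.
  by apply: le_trans (ler_normB _ _) _; exact: lerD.
have zq := Zlist_calm N1 LN (reg_Amax rg) (reg_w rg) (ltW e0)
  (fun i iL => z0 (reg_frac rg iL)) sp vl sl cl qL'.
rewrite /= in zq.
have nn : `|N%:R * (1 - q%:R / N%:R - expR (- bp (q%:R / N%:R))) - N%:R * zfun beta t|
    <= 1 + blip beta sigma'.
  rewrite -/(zfun beta (q%:R / N%:R)) -mulrBr normrM (gtr0_norm NR) mulrC -ler_pdivlMr//.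
  apply: le_trans (zfun_lip beta0 beta2 bcvg sigma0 ss' s'1 fq tsig') _.
  rewrite ler_wpM2l ?addr_ge0// distrC ger0_norm ?subr_ge0// lerBlDl.
  exact: qt2.
have uu : 0 <= N%:R * t - q%:R <= 1.
  by rewrite subr_ge0 q1 /= lerBlDr addrC natr1 ltW.
have Qj : `|Q (pre (it j) l)| <= m%:R * e.
  apply: le_trans (good_it (blk0 sigma m N) (blkS sigma0 m N) (horizon_blk sigma N m0) gl sl (ltnW jm)) _.
  by rewrite ler_pM2r// ler_nat ltnW.
have diff : `|Q (pre q l) * W (q%:R / N%:R) - W (gridt sigma m j) * Q (pre (it j) l)|
   <= e + 2 * blip beta sigma' * e.
  have -> : Q (pre q l) * W (q%:R / N%:R) - W (gridt sigma m j) * Q (pre (it j) l)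
   = (Q (pre q l) - Q (pre (it j) l)) * W (q%:R / N%:R)
     + Q (pre (it j) l) * (W (q%:R / N%:R) - W (gridt sigma m j)) by ring.
  apply: le_trans (ler_normD _ _) _; rewrite !normrM; apply: lerD.
    have /andP[w0 w1] := Wt _ fq.
    by rewrite (ger0_norm w0) -[leRHS]mulr1; apply: ler_pM.
  (* Q itself may be as large as m e, but over a block the weight moves only by order 1/m, and the
     two factors m cancel. *)
  have hw : `|W (q%:R / N%:R) - W (gridt sigma m j)| <= blip beta sigma' * (2 / m%:R).
    apply: le_trans (expRN_betap_dist beta0 beta2 bcvg s'01 fq fj) _.
    apply: ler_wpM2l => //.
    have iNm : N%:R^-1 <= m%:R^-1 :> R by rewrite lef_pV2 ?posrE// ler_nat.
    have sm : sigma / m%:R <= m%:R^-1.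
      by rewrite -[leRHS]mul1r ler_wpM2r ?invr_ge0 ?ler0n// ltW// (lt_trans ss').
    have im0 : 0 <= m%:R^-1 :> R by rewrite invr_ge0.
    rewrite (_ : 2 / m%:R = m%:R^-1 + m%:R^-1); last by ring.
    rewrite ler_norml; move: qt1 qt2 j1 j2 iNm sm im0.
    set a := q%:R / N%:R; set b := gridt sigma m j; clearbody a b => *.
    by apply/andP; split; lra.
  apply: (@le_trans _ _ (m%:R * e * (blip beta sigma' * (2 / m%:R)))).
    by apply: ler_pM.
  rewrite le_eqVlt; apply/orP; left; apply/eqP; field.
  by rewrite gt_eqF.
apply: le_trans (walk_error zq nn uu cnt_le diff sN0) _.
rewrite /closeness /Pbound.
have b1 : (C1 + m%:R * e * C1 + Amax * (1 + (C1 + Num.sqrt N%:R * e)) + (1 + blip beta sigma')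
    + 1 + (Num.sqrt N%:R * (e + e) + c0)) / Num.sqrt N%:R <= Amax * e + (e + e) + e.
  rewrite ler_pdivrMr//; move: NL; set s := Num.sqrt N%:R; clearbody s => NL'.
  have -> : (Amax * e + (e + e) + e) * s = Amax * (s * e) + s * (e + e) + e * s by ring.
  have -> : C1 + m%:R * e * C1 + Amax * (1 + (C1 + s * e)) + (1 + blip beta sigma') + 1
      + (s * (e + e) + c0)
    = C1 + m%:R * e * C1 + Amax * (1 + C1) + (1 + blip beta sigma') + 1 + c0
      + (Amax * (s * e) + s * (e + e)) by ring.
  by rewrite addrC lerD2l.
rewrite (_ : (Amax + 4 + 2 * blip beta sigma') * e =
  (Amax * e + (e + e) + e) + (e + 2 * blip beta sigma' * e)); last by ring.
by apply: lerD b1 _.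
Qed.

End WalkApprox.

Section GridCont.
Context {R : realType} (d : nat) (H : (nat -> R) -> R) (n : nat).

Lemma grid_approx_ext y y' : (forall r, (r < d)%N -> y r = y' r) ->
  grid_approx d H n y = grid_approx d H n y'.
Proof.
move=> e; apply: eq_bigr => z _; congr (_ * _); apply: eq_bigr => i _.
by rewrite e.
Qed.

Let dirid (k r : nat) : R := (r == k)%:R.

(** Writes y as a path with one step per coordinate, so that [vsum_lip] yields continuity in all
    coordinates jointly. *)
Fixpoint prefix_seq (y : nat -> R) (k : nat) : seq R :=
  if k is k'.+1 then y k' :: prefix_seq y k' else [::].

Let size_prefix y k : size (prefix_seq y k) = k.
Proof. by elim: k => //= k ->. Qed.

Let vsum_prefix y k r : vsum dirid (prefix_seq y k) r = if (r < k)%N then y r else 0.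
Proof.
elim: k => [//|k IH] /=; rewrite /vadd IH size_prefix /dirid ltnS.
case: (ltngtP r k) => [||->]; rewrite ?mulr0 ?addr0// ?mulr1 ?add0r//.
Qed.

Lemma grid_approx_cont (yn : nat -> nat -> R) y :
  (forall r, (r < d)%N -> yn k r @[k --> \oo] --> y r) ->
  grid_approx d H n (yn k) @[k --> \oo] --> grid_approx d H n y.
Proof.
move=> hy; have [c sm] := grid_approx_smooth d H n.
have sf : smooth dirid c (grid_approx d H n) := sm id.
have E z : grid_approx d H n z = grid_approx d H n (vsum dirid (prefix_seq z d)).
  by apply: grid_approx_ext => r rd; rewrite vsum_prefix rd.
pose u k j := lipmod c `|yn k j - y j|.
have le k : `|grid_approx d H n (yn k) - grid_approx d H n y| <= \sum_(j < d) u k j.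
  rewrite E (E y); apply: le_trans (vsum_lip sf _) _; first by rewrite !size_prefix.
  elim: d => [|j IH] /=; first by rewrite big_nil big_ord0.
  by rewrite big_cons big_ord_recr /= addrC lerD.
have u0 : \sum_(j < d) u k j @[k --> \oo] --> 0.
  apply: cvg_sum0 => j jd.
  have h1 : `|yn k j - y j| @[k --> \oo] --> (0 : R).
    rewrite -(normr0 R) -(subrr (y j)).
    by apply: cvg_norm; apply: cvgB; [exact: hy|exact: cvg_cst].
  rewrite /u /lipmod (_ : 0 = c * (0 + 0 ^+ 2 + 0 ^+ 3)); last by rewrite !expr0n /=; ring.
  apply: cvgM; first exact: cvg_cst.
  apply: cvgD; first by apply: cvgD => //; exact: cvg_expn.
  exact: cvg_expn.
apply/cvgrPdist_le => e e0.
move/cvgrPdist_le: u0 => /(_ e e0); apply: filterS => k; rewrite sub0r normrN => h.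
by rewrite distrC; apply: le_trans (le k) _; exact: le_trans (ler_norm _) h.
Qed.

End GridCont.

(** * Pathwise limits of the Gaussian block sums *)

Section GaussLimit.
Context {R : realType} (beta : nat -> R) (sigma sigma' : R).
Hypothesis beta0 : forall j, (2 <= j)%N -> 0 <= beta j.
Hypothesis beta2 : beta 2%N = 1 / 2.
Hypothesis bcvg : cvg (series (betap_terms beta 1) @ \oo).
Hypothesis sigma0 : 0 < sigma.
Hypothesis ss' : sigma < sigma'.
Hypothesis s'1 : sigma' < 1.

Local Notation bp := (betap beta).
Local Notation lam N := (lambda2 beta N).

Let s'01 : 0 < sigma' < 1. Proof. by rewrite s'1 (lt_trans sigma0). Qed.
Let s1 : sigma < 1. Proof. exact: lt_trans s'1. Qed.
Let s01 : 0 < sigma < 1. Proof. by rewrite sigma0. Qed.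

Variables (C1 c0 Amax : R).
Hypothesis reg : \forall N \near \oo, regular beta sigma sigma' C1 c0 Amax N.

Context {d : measure_display} {Om : measurableType d}.
Variables (B I : Om -> R -> R) (w : Om).
Hypothesis cB : {within `[0, +oo[, continuous (B w)}.
Hypothesis HI : forall t, 0 <= t <= sigma ->
  is_RS_integral (fun s => expR (bp s)) (fun s => B w (zfun beta s + s)) 0 t (I w t).

(** For each path this is [discrete_integral] with La the summed rates: the weights are exp(La_k)
    and the clock is tau_k = 1 - exp(-La_k). *)
Lemma gpart_cvg m j : (j < m)%N ->
  gpart B (tauw (lam N)) (Am (lam N)) w (blk sigma m N j) @[N --> \oo]
  --> I w (gridt sigma m j).
Proof.
move=> jm; have m0 : (0 < m)%N by exact: leq_ltn_trans jm.
apply/cvgrPdist_le => e e0.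
have [dl dl0 H] := discrete_integral beta0 beta2 bcvg s01 cB HI e0.
set t := gridt sigma m j.
have ts : t < sigma.
  by rewrite /t /gridt gtr_pMr// ltr_pdivrMr ?ltr0n// mul1r ltr_nat.
have t0 : 0 <= t by case/andP: (gridt_in sigma0 m0 (ltnW jm)).
near=> N.
have rg : regular beta sigma sigma' C1 c0 Amax N by near: N; exact: reg.
have N1 : (0 < N)%N by exact: ltnW (reg_gt1 rg).
have NR : 0 < N%:R :> R by rewrite ltr0n.
(* The margin between t and sigma, positive since j < m, keeps the summed rates below
   beta'(sigma). *)
have hs : C1 <= (sigma - t) * N%:R by near: N; apply: near_natmul; rewrite subr_gt0.
have hd : C1 + blip beta sigma' <= dl * N%:R by near: N; exact: near_natmul.
have hc : c0 <= dl * N%:R by near: N; exact: near_natmul.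
set i := blk sigma m N j.
have iL : (i < horizon sigma N)%N.
  by rewrite (horizon_blk _ N m0) ltnS; apply: (it_mono (blkS sigma0 m N)); exact: ltnW.
have /andP[b1 b2] := blk_itv sigma0 m N j; rewrite -/i -/t in b1 b2.
have fr := reg_frac rg (ltnW iL); have /andP[f0 f1] := fr.
have it1 : i%:R / N%:R <= t by rewrite ler_pdivrMr// mulrC.
have it2 : t - i%:R / N%:R <= N%:R^-1.
  by rewrite lerBlDl -[X in _ + X]mul1r -mulrDl ler_pdivlMr// mulrC natr1 ltW.
have /andP[l1 l2] : - (C1 / N%:R) <= Lam (lam N) i - bp (i%:R / N%:R) <= C1 / N%:R.
  by rewrite -ler_norml (reg_Lam rg)// ltnW.
have tI : 0 <= t <= sigma by rewrite t0 ltW.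
have tI' : 0 <= t <= sigma' by rewrite t0 (le_trans (ltW ts))// ltW.
have La_i : Lam (lam N) i <= bp sigma.
  have h1 : bp (i%:R / N%:R) <= bp t.
    by apply: (betap_mono beta0 beta2 bcvg) => //; rewrite (le_trans (ltW ts))// ltW.
  have h2 : sigma - t <= bp sigma - bp t.
    by apply: (betap_expand beta0 beta2 bcvg) => //; exact: ltW.
  have h3 : C1 / N%:R <= sigma - t by rewrite ler_pdivrMr.
  have -> : Lam (lam N) i = (Lam (lam N) i - bp (i%:R / N%:R)) + bp (i%:R / N%:R) by ring.
  apply: le_trans (lerD l2 h1) _; rewrite -lerBrDr.
  exact: le_trans h3 h2.
have close : `|Lam (lam N) i - bp t| <= dl.
  have -> : Lam (lam N) i - bp t
    = (Lam (lam N) i - bp (i%:R / N%:R)) + (bp (i%:R / N%:R) - bp t) by ring.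
  apply: le_trans (ler_normD _ _) _.
  apply: (@le_trans _ _ (C1 / N%:R + blip beta sigma' / N%:R)).
    apply: lerD; first by rewrite (reg_Lam rg)// ltnW.
    apply: le_trans (betap_dist beta0 beta2 bcvg s'01 fr tI') _.
    rewrite ler_wpM2l ?(blip_ge0 beta0 beta2 bcvg s'01)//.
    by rewrite distrC ger0_norm// subr_ge0.
  by rewrite -mulrDl ler_pdivrMr.
have LS k : Lam (lam N) k.+1 - Lam (lam N) k = lam N k.
  by rewrite /Lam big_ord_recr /= addrAC subrr add0r.
rewrite distrC.
have -> : gpart B (tauw (lam N)) (Am (lam N)) w i = \sum_(k < i) expR (Lam (lam N) k) *
   (B w (1 - expR (- Lam (lam N) k.+1)) - B w (1 - expR (- Lam (lam N) k))).
  by apply: eq_bigr => k _; rewrite /gincr /tauw /Am !expRN.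
apply: H => //.
- by rewrite /Lam big_ord0.
- by move=> k; rewrite -subr_ge0 LS (lambda2_ge0 beta0).
- move=> k ki; rewrite LS; apply: le_trans (reg_lam rg (ltn_trans ki iL)) _.
  by rewrite ler_pdivrMr.
Unshelve. all: by end_near.
Qed.

Definition increments (m r : nat) : R := I w (gridt sigma m r.+1) - I w (gridt sigma m r).

Lemma gauss_coord m r : (r < m.-1)%N ->
  vsum (blkdir m (blk sigma m N)) (gts B (tauw (lam N)) (Am (lam N)) (horizon sigma N) w) r
    @[N --> \oo] --> increments m r.
Proof.
move=> rm; have m0 : (0 < m)%N by case: m rm.
have rm1 : (r.+1 < m)%N by rewrite -(prednK m0) ltnS.
rewrite (_ : (fun N => _) = (fun N => gpart B (tauw (lam N)) (Am (lam N)) w (blk sigma m N r.+1)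
   - gpart B (tauw (lam N)) (Am (lam N)) w (blk sigma m N r))); last first.
  apply/funext => N; rewrite vsum_gts_block ?blk0//; last 2 first.
  - exact: blkS.
  - exact: ltnW.
  have mE j : (j <= m)%N -> minn (horizon sigma N) (blk sigma m N j) = blk sigma m N j.
    move=> jm; apply/minn_idPr; rewrite (horizon_blk _ N m0) leqW//.
    exact: (it_mono (blkS sigma0 m N)).
  by rewrite !mE// ltnW// ltnW.
by apply: cvgB; apply: gpart_cvg => //; exact: ltnW.
Qed.

Lemma step_increments m t : (0 < m)%N -> 0 <= t <= sigma ->
  step_path sigma m (fun t => expR (- bp t)) (increments m) t
  = expR (- bp (gridt sigma m (bidx sigma m t))) * I w (gridt sigma m (bidx sigma m t)).
Proof.
move=> m0 ts; rewrite /step_path; congr (_ * _).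
rewrite -(big_mkord xpredT (increments m)) (telescope_sumr (fun r => I w (gridt sigma m r)))//.
rewrite gridt0 (_ : I w 0 = 0) ?subr0//.
by apply: (@is_RS_integral0 _ (fun s => expR (bp s)) (fun s => B w (zfun beta s + s)) 0); apply: HI; rewrite lexx ltW.
Qed.

Lemma step_close e : 0 < e -> \forall m \near \oo, near_unif sigma
  (step_path sigma m.+1 (fun t => expR (- bp t)) (increments m.+1))
  (fun t => expR (- bp t) * I w t) e.
Proof.
move=> e0; have [dl dl0 H] := modulus_X beta0 beta2 bcvg s01 cB HI e0.
near=> m; have hm : sigma <= dl * m.+1%:R.
  apply: (@le_trans _ _ (dl * m%:R)); first by near: m; exact: near_natmul.
  by rewrite ler_pM2l// ler_nat.
move=> t ts; rewrite step_increments//.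
have /andP[h1 h2] := @bidx_near _ _ m.+1 sigma0 isT t ts.
apply: H => //; first by apply: (gridt_in sigma0) => //; exact: ltnW (bidx_lt _ _ _).
rewrite distrC ger0_norm ?subr_ge0// lerBlDl; apply: le_trans h2 _.
by rewrite lerD2l ler_pdivrMr ?ltr0n.
Unshelve. all: by end_near.
Qed.

End GaussLimit.

(** * Convergence *)

Lemma cvg_le_near (R : realType) (u : nat -> R) l e : 0 < e -> u @ \oo --> l ->
  \forall n \near \oo, u n <= l + e.
Proof.
move=> e0 /cvgrPdist_le/(_ e e0); apply: filterS => n; rewrite distrC => h.
by rewrite -lerBlDl; apply: le_trans (ler_norm _) h.
Qed.

Lemma near_ex (Q : nat -> Prop) : (\forall n \near \oo, Q n) -> exists n, Q n.
Proof. by case=> n _ h; exists n; apply: h => /=. Qed.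

(** * The one-sided limit inequality *)

Section OneSided.
Context {R : realType} (beta : nat -> R) (sigma sigma' : R).
Hypothesis beta0 : forall j, (2 <= j)%N -> 0 <= beta j.
Hypothesis beta2 : beta 2%N = 1 / 2.
Hypothesis bcvg : cvg (series (betap_terms beta 1) @ \oo).
Hypothesis sigma0 : 0 < sigma.
Hypothesis ss' : sigma < sigma'.
Hypothesis s'1 : sigma' < 1.
Hypothesis z0 : forall t, 0 <= t <= sigma' -> 0 <= zfun beta t.
Hypothesis zpos : forall t, 0 < t <= sigma' -> 0 < zfun beta t.

Local Notation bp := (betap beta).
Local Notation lam N := (lambda2 beta N).
Local Notation K N := (walkK N (lambda2_ge0 beta0 N)).
Local Notation W := (fun t => expR (- bp t)).

Let s1 : sigma < 1. Proof. exact: lt_trans s'1. Qed.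
Let s01 : 0 < sigma < 1. Proof. by rewrite sigma0. Qed.
Let s'01 : 0 < sigma' < 1. Proof. by rewrite s'1 (lt_trans sigma0). Qed.

Variables (C1 c0 Amax : R).
Hypothesis C10 : 0 <= C1.
Hypothesis c00 : 0 <= c0.
Hypothesis Amax1 : 1 <= Amax.
Hypothesis reg : \forall N \near \oo, regular beta sigma sigma' C1 c0 Amax N.

Variables (dN : nat -> measure_display) (Omega : forall N, measurableType (dN N)).
Variables (P : forall N, probability (Omega N) R).
Variables (M : forall N, Omega N -> {set 'I_N} -> nat).
Variables (E : forall N, Omega N -> nat -> nat -> R).
Hypothesis interp : forall N, exp_interpolation (P N) beta (@M N) (@E N).

Context {d' : measure_display} {Omega' : measurableType d'} (P' : probability Omega' R).
Variables (B X I : Omega' -> R -> R).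
Hypothesis BM : brownian P' B.
Hypothesis HI : forall w t, 0 <= t <= sigma ->
  is_RS_integral (fun s => expR (bp s)) (fun s => B w (zfun beta s + s)) 0 t (I w t).
Hypothesis XI : forall w t, 0 <= t <= sigma -> X w t = expR (- bp t) * I w t.

Variables (F : (R -> R) -> R) (C : R).
Hypothesis FC : forall x, cadlag_on sigma x -> `|F x| <= C.
Hypothesis Fcont : skorokhod_continuous sigma F.
Hypothesis mFX : measurable_fun setT (fun w => F (X w)).

Let cB w : {within `[0, +oo[, continuous (B w)}.
Proof. by have [_ _ h _] := BM; exact: h. Qed.

Let W01 t : 0 <= t <= sigma -> 0 <= W t <= 1.
Proof.
move=> /andP[t0 ts]; rewrite expR_ge0 /= expR_le1 lerNl oppr0.
by apply: (betap_ge0 beta0 beta2 bcvg); rewrite t0 (le_trans ts)// ltW.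
Qed.

Lemma cadlag_X w : cadlag_on sigma (X w).
Proof.
apply: modulus_cadlag => e e0.
have [dl dl0 H] := modulus_X beta0 beta2 bcvg s01 (@cB w) (HI w) e0.
by exists dl => // u v us vs uv; rewrite !XI//; exact: H.
Qed.

(** With m + 1 blocks the step path reads the first m coordinates only, which is the dimension of
    the spline approximation. *)
Definition envstep (c m : nat) (y : nat -> R) : R :=
  env sigma F c%:R (step_path sigma m.+1 W y).

Let cs m y : cadlag_on sigma (step_path sigma m.+1 W y).
Proof. exact: cadlag_step. Qed.

Lemma envstep_bound c m y : `|envstep c m y| <= C.
Proof. by apply: env_bound. Qed.

Lemma envstep_lip c m y y' e : 0 <= e -> (forall r, (r < m)%N -> `|y r - y' r| <= e) ->
  `|envstep c m y - envstep c m y'| <= c%:R * m.+1%:R * e.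
Proof.
move=> e0 h; have me : 0 <= m.+1%:R * e by rewrite mulr_ge0.
have h1 := step_path_lip sigma0 (ltn0Sn m) W01 e0 h.
have h2 : near_unif sigma (step_path sigma m.+1 W y') (step_path sigma m.+1 W y) (m.+1%:R * e).
  by move=> t ts; rewrite distrC; exact: h1.
have a1 := env_lip FC (ler0n R c) me (cs m y) h1.
have a2 := env_lip FC (ler0n R c) me (cs m y') h2.
rewrite -mulrA ler_norml /envstep; apply/andP; split.
  by rewrite lerBrDr addrC lerBlDr.
by rewrite lerBlDr addrC.
Qed.

Definition envgrid c m n := grid_approx m (envstep c m) n.

Lemma envgrid_bound c m n y : `|envgrid c m n y| <= C.
Proof. by apply: grid_approx_bound; exact: envstep_bound. Qed.

Definition gpath m N w : nat -> R :=
  vsum (blkdir m.+1 (blk sigma m.+1 N)) (gts B (tauw (lam N)) (Am (lam N)) (horizon sigma N) w).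

Lemma envgrid_cvgN c m n w :
  envgrid c m n (gpath m N w) @[N --> \oo] --> envgrid c m n (increments sigma I w m.+1).
Proof.
apply: grid_approx_cont => r rm.
exact: (gauss_coord beta0 beta2 bcvg sigma0 ss' s'1 reg (@cB w) (HI w)).
Qed.

Lemma measurable_gpath c m n N : measurable_fun setT (fun w => envgrid c m n (gpath m N w)).
Proof.
have [cc sf] := grid_approx_smooth m (envstep c m) n.
exact: (measurable_f_gts (tauw (lam N)) (Am (lam N)) BM (sf (blkidx m.+1 (blk sigma m.+1 N)))).
Qed.

Lemma measurable_envgrid c m n :
  measurable_fun setT (fun w => envgrid c m n (increments sigma I w m.+1)).
Proof.
apply: (@measurable_fun_cvg _ _ _ setT (fun N w => envgrid c m n (gpath m N w))).
  by move=> N; exact: measurable_gpath.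
by move=> w _; exact: envgrid_cvgN.
Qed.

Lemma envgrid_near c m n y : (forall r, (r < m)%N -> `|y r| <= n%:R) ->
  `|envgrid c m n y - envstep c m y| <= c%:R * m.+1%:R * (2 / n.+1%:R).
Proof. by move=> yn; apply: grid_approx_near yn => *; exact: envstep_lip. Qed.

Lemma near_gridsize c m (e : R) : 0 < e ->
  \forall n \near \oo, c%:R * m.+1%:R * (2 / n.+1%:R) <= e.
Proof.
move=> e0; near=> n.
have h : c%:R * m.+1%:R * 2 <= e * n%:R by near: n; exact: near_natmul.
rewrite mulrA ler_pdivrMr ?ltr0n//; apply: le_trans h _.
by rewrite ler_pM2l// ler_nat.
Unshelve. all: by end_near.
Qed.

Lemma envgrid_cvgn c m y : envgrid c m n y @[n --> \oo] --> envstep c m y.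
Proof.
apply/cvgrPdist_le => e e0; near=> n; rewrite distrC.
apply: le_trans (envgrid_near _ _) _; last by near: n; exact: near_gridsize.
have h : \sum_(r < m) `|y r| <= 1 * n%:R by near: n; exact: near_natmul.
move=> r rm; apply: le_trans (_ : _ <= 1 * n%:R) _; last by rewrite mul1r.
by apply: le_trans h; rewrite (bigD1 (Ordinal rm))//= lerDl sumr_ge0.
Unshelve. all: by end_near.
Qed.

Lemma measurable_envstep c m :
  measurable_fun setT (fun w => envstep c m (increments sigma I w m.+1)).
Proof.
apply: (@measurable_fun_cvg _ _ _ setT
  (fun n w => envgrid c m n (increments sigma I w m.+1))).
  by move=> n; exact: measurable_envgrid.
by move=> w _; exact: envgrid_cvgn.
Qed.

Lemma envstep_cvgm c w :
  envstep c m (increments sigma I w m.+1) @[m --> \oo] --> env sigma F c%:R (X w).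
Proof.
apply/cvgrPdist_le => e e0.
have e1 : 0 < e / (c%:R + 1) by rewrite divr_gt0// ltr_wpDl.
near=> m.
have hm : near_unif sigma (step_path sigma m.+1 W (increments sigma I w m.+1))
    (fun t => W t * I w t) (e / (c%:R + 1)).
  near: m; exact: (step_close beta0 beta2 bcvg sigma0 ss' s'1 (@cB w) (HI w)).
have h1 : near_unif sigma (step_path sigma m.+1 W (increments sigma I w m.+1)) (X w)
    (e / (c%:R + 1)) by move=> t ts; rewrite XI//; exact: hm.
have h2 : near_unif sigma (X w) (step_path sigma m.+1 W (increments sigma I w m.+1))
    (e / (c%:R + 1)) by move=> t ts; rewrite distrC; exact: h1.
have a1 := env_lip FC (ler0n R c) (ltW e1) (cs _ _) h1.
have a2 := env_lip FC (ler0n R c) (ltW e1) (cadlag_X w) h2.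
have ce : c%:R * (e / (c%:R + 1)) <= e.
  by rewrite mulrCA ler_piMr ?(ltW e0)// ler_pdivrMr ?mul1r ?lerDl// ltr_wpDl.
rewrite ler_norml /envstep; apply/andP; split.
  by rewrite lerBrDr addrC lerBlDr; apply: le_trans a1 _; rewrite lerD2l.
by rewrite lerBlDr addrC; apply: le_trans a2 _; rewrite lerD2l.
Unshelve. all: by end_near.
Qed.

(** The envelope is a supremum over uncountably many paths. Its measurability along X comes from
    three successive pointwise limits, in N, n and m, of functions of Gaussian increments. *)
Lemma measurable_env c : measurable_fun setT (fun w => env sigma F c%:R (X w)).
Proof.
apply: (@measurable_fun_cvg _ _ _ setT
  (fun m w => envstep c m (increments sigma I w m.+1))).
  by move=> m; exact: measurable_envstep.
by move=> w _; exact: envstep_cvgm.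
Qed.

Local Notation EF := (\int[P']_w F (X w)).

Lemma int_envgrid_cvgN c m n :
  \int[P']_w envgrid c m n (gpath m N w) @[N --> \oo]
  --> \int[P']_w envgrid c m n (increments sigma I w m.+1).
Proof.
apply: (@Rint_dct_bdd _ _ _ P' (fun N w => envgrid c m n (gpath m N w)) _ C).
- by move=> N; exact: measurable_gpath.
- exact: measurable_envgrid.
- by move=> w; exact: envgrid_cvgN.
- by move=> N w; exact: envgrid_bound.
Qed.

Lemma int_envgrid_cvgn c m :
  \int[P']_w envgrid c m n (increments sigma I w m.+1) @[n --> \oo]
  --> \int[P']_w envstep c m (increments sigma I w m.+1).
Proof.
apply: (@Rint_dct_bdd _ _ _ P' (fun n w => envgrid c m n (increments sigma I w m.+1)) _ C).
- by move=> n; exact: measurable_envgrid.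
- exact: measurable_envstep.
- by move=> w; exact: envgrid_cvgn.
- by move=> n w; exact: envgrid_bound.
Qed.

Lemma int_envstep_cvgm c :
  \int[P']_w envstep c m (increments sigma I w m.+1) @[m --> \oo]
  --> \int[P']_w env sigma F c%:R (X w).
Proof.
apply: (@Rint_dct_bdd _ _ _ P' (fun m w => envstep c m (increments sigma I w m.+1)) _ C).
- by move=> m; exact: measurable_envstep.
- exact: measurable_env.
- by move=> w; exact: envstep_cvgm.
- by move=> m w; exact: envstep_bound.
Qed.

Lemma int_env_cvgc : \int[P']_w env sigma F c%:R (X w) @[c --> \oo] --> EF.
Proof.
apply: (@Rint_dct_bdd _ _ _ P' (fun c w => env sigma F c%:R (X w)) _ C).
- by move=> c; exact: measurable_env.
- exact: mFX.
- by move=> w; apply: (env_cvg FC Fcont); exact: cadlag_X.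
- by move=> c w; apply: env_bound => //; exact: cadlag_X.
Qed.

Local Notation Y := (fun N w => scaled_walk beta (@M N w) (@E N w)).
Hypothesis mFY : forall N, measurable_fun setT (fun w => F (Y N w)).

Lemma cadlag_Y N w : (0 < N)%N -> cadlag_on sigma (Y N w).
Proof.
move=> N0; apply: cadlagMr; apply: cadlagB; first exact: cadlag_interp.
have bl0 : 0 <= blip beta sigma' := blip_ge0 beta0 beta2 bcvg s'01.
have NR : 0 <= N%:R * (1 + blip beta sigma') by rewrite mulr_ge0// addr_ge0.
apply: modulus_cadlag; apply: (modulus_lip NR) => u v us vs.
have in' x : 0 <= x <= sigma -> 0 <= x <= sigma'.
  by move=> /andP[-> h]; rewrite (le_trans h)// ltW.
rewrite -mulrBr normrM ger0_norm// -mulrA ler_wpM2l//.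
exact: (zfun_lip beta0 beta2 bcvg sigma0 ss' s'1 (in' _ us) (in' _ vs)).
Qed.

(* Applied to F and to -F this gives the convergence. *)
Lemma upper_bound (eps : R) : 0 < eps ->
  \forall N \near \oo, \int[P N]_w F (Y N w) <= EF + eps.
Proof.
(* Eight shares: the four limits in c, m, n and N, two for the pathwise comparison, one for the
   replacement error and one for the bad histories. *)
move=> eps0; pose h := eps / 8; have h0 : 0 < h by rewrite divr_gt0.
have C0 : 0 <= C by apply: le_trans (normr_ge0 _) (FC (@cadlag_step _ sigma 1 W sigma0 isT (fun=> 0))).
(* The order of choices matters: e depends on c, m on c and e, n on c, e and m, and N comes last. *)
have [c hc] := near_ex (cvg_le_near h0 int_env_cvgc).
have bl0 : 0 <= blip beta sigma' := blip_ge0 beta0 beta2 bcvg s'01.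
have cl0 : 0 < closeness beta sigma' Amax.
  by apply: ltr_wpDr; [exact: mulr_ge0|apply: ltr_wpDl => //; exact: le_trans Amax1].
pose e := h / (c%:R * closeness beta sigma' Amax + 1).
have den0 : 0 < c%:R * closeness beta sigma' Amax + 1.
  by rewrite ltr_wpDl// mulr_ge0// ltW.
have e0 : 0 < e by rewrite divr_gt0.
have ce : c%:R * (closeness beta sigma' Amax * e) <= h.
  rewrite mulrA /e mulrCA ler_piMr ?(ltW h0)// ler_pdivrMr// mul1r lerDl//.
have eta0 : 0 < h / (C + C + 1) by rewrite divr_gt0// ltr_wpDl// addr_ge0.
have [m [hm badm]] : exists m, \int[P']_w envstep c m (increments sigma I w m.+1)
     <= \int[P']_w env sigma F c%:R (X w) + h /\
   \forall N \near \oo, EE (K N) (horizon sigma N) [::]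
     (fun l => (~~ goodb N (lam N) m.+1 (blk sigma m.+1 N) e l)%:R) <= h / (C + C + 1).
  apply: near_ex; near=> m; split; near: m.
    exact: (cvg_le_near h0 (@int_envstep_cvgm c)).
  have [m1 _ hm1] := bad_small beta0 sigma0 s'1 c00 reg e0 eta0.
  by exists m1 => // m /= mm; apply: hm1 => /=; exact: leqW.
(* On a good history block increments are at most e, so e <= n puts them in the box where the spline
   is accurate. *)
have [n [hn ne nl]] : exists n, [/\ \int[P']_w envgrid c m n (increments sigma I w m.+1)
     <= \int[P']_w envstep c m (increments sigma I w m.+1) + h,
   e <= n%:R & c%:R * m.+1%:R * (2 / n.+1%:R) <= h].
  apply: near_ex; near=> n; split; near: n.
  - exact: (cvg_le_near h0 (@int_envgrid_cvgn c m)).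
  - by have := near_natmul e (ltr01 : 0 < 1 :> R); apply: filterS => n; rewrite mul1r.
  - exact: near_gridsize.
have [cf0 sf] := grid_approx_smooth m (envstep c m) n.
have cf00 : 0 <= cf0 by exact: (@c_ge0 _ _ _ _ (sf id)).
pose f := envgrid c m n.
near=> N.
have rg : regular beta sigma sigma' C1 c0 Amax N by near: N; exact: reg.
have bad : EE (K N) (horizon sigma N) [::]
   (fun l => (~~ goodb N (lam N) m.+1 (blk sigma m.+1 N) e l)%:R) <= h / (C + C + 1).
  by near: N; exact: badm.
have hN : \int[P']_w envgrid c m n (gpath m N w)
   <= \int[P']_w envgrid c m n (increments sigma I w m.+1) + h.
  by near: N; exact: (cvg_le_near h0 (@int_envgrid_cvgN c m n)).
have ger : EE (K N) (horizon sigma N) [::]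
   (gerr (tauw (lam N)) (Am (lam N)) cf0 (K N) (xi N (lam N))) <= h.
  near: N; exact: (gerr_small beta0 beta2 bcvg sigma0 ss' s'1 C10 c00 Amax1 reg z0 zpos cf00 h0).
have sp : sepN beta sigma e m.+1 N.
  by near: N; exact: (near_sepN beta0 beta2 bcvg sigma0 ss' s'1 reg zpos e (ltn0Sn m)).
have mN : (m.+1 <= N)%N by near: N; exact: nbhs_infty_ge.
have NL : C1 + m.+1%:R * e * C1 + Amax * (1 + C1) + (1 + blip beta sigma') + 1 + c0
   <= e * Num.sqrt N%:R by near: N; exact: near_sqrtmul.
have N1 : (0 < N)%N by exact: ltnW (reg_gt1 rg).
have LN := reg_horN s'1 rg.
set L := horizon sigma N in bad ger LN.
pose dir := blkdir (R := R) m.+1 (blk sigma m.+1 N).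
pose path := pathX (childX (@M N)) L.
pose good := goodb N (lam N) m.+1 (blk sigma m.+1 N) e.
(* On good histories 2h pays for closeness and spline error; on the others 2C covers any difference
   of values. *)
pose phi l : R := f (vpath dir (xi N (lam N)) l) + ((h + h) + (C + C) * (~~ good l)%:R).
have hh0 : 0 <= h + h by apply: addr_ge0; exact: ltW.
have CC0 : 0 <= C + C by exact: addr_ge0.
have phib l : `|phi l| <= C + ((h + h) + (C + C)).
  apply: le_trans (ler_normD _ _) _; apply: lerD; first exact: envgrid_bound.
  rewrite ger0_norm; last by apply: addr_ge0 => //; exact: mulr_ge0.
  by rewrite lerD2l ler_piMr// lern1 leq_b1.
have pw w : F (Y N w) <= phi (path w).
  have cY := cadlag_Y w N1.
  have FY : F (Y N w) <= C by apply: le_trans (ler_norm _) (FC cY).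
  have fb : - C <= f (vpath dir (xi N (lam N)) (path w)).
    by rewrite lerNl; apply: le_trans (ler_norm _) _; rewrite normrN; exact: envgrid_bound.
  rewrite /phi; have [gl|ngl] := boolP (good (path w)); last first.
    rewrite mulr1; apply: le_trans FY _.
    by apply: le_trans (lerD fb (lerD hh0 (lexx (C + C)))); rewrite add0r addKr.
  rewrite mulr0 addr0.
  have close := @walk_close _ _ _ _ beta0 beta2 bcvg sigma0 ss' s'1 z0 C1 c0 Amax e m.+1 N
    rg e0 isT sp mN NL _ _ (P N) (@M N) (@E N) (interp N) w gl.
  rewrite -/dir -/L -/(path w) in close.
  have s1' : F (Y N w) <= envstep c m (vpath dir (xi N (lam N)) (path w)) + h.
    have clE : 0 <= closeness beta sigma' Amax * e by rewrite mulr_ge0// ltW.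
    apply: le_trans (@env_self _ sigma F C FC c%:R _ (ler0n R c) cY) _.
    apply: le_trans (env_lip FC (ler0n R c) clE cY close) _.
    by rewrite /envstep lerD2l.
  have s2 : envstep c m (vpath dir (xi N (lam N)) (path w))
      <= f (vpath dir (xi N (lam N)) (path w)) + h.
    rewrite -lerBlDl; apply: le_trans (ler_norm _) _; rewrite distrC.
    apply: le_trans (envgrid_near c (m := m) (n := n) _) nl => r rm.
    have rm1 : (r < m.+1)%N by exact: leqW.
    rewrite (vpath_block (blk0 sigma m.+1 N) (blkS sigma0 m.+1 N) _ _ _ rm1).
    apply: le_trans _ ne.
    apply: (good_osc (blkS sigma0 m.+1 N) (horizon_blk sigma N (ltn0Sn m)) gl) => //.
      by rewrite size_pathX.
    by rewrite blkS// leqnSn.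
  by rewrite addrA; apply: le_trans s1' _; rewrite lerD2r.
have mX k i : (k < L)%N -> measurable [set w | childX (@M N) k w = i].
  by move=> kL; apply: (measurable_childX (interp N)); exact: leq_trans kL LN.
have i1 : \int[P N]_w F (Y N w) <= \int[P N]_w phi (path w).
  apply: le_Rintegral => //.
  - by apply: (bdd_integrable (P N) (C := C)) => // w; apply: FC; exact: cadlag_Y.
  - apply: (bdd_integrable (P N) (C := C + ((h + h) + (C + C)))) => // .
    exact: (measurable_fun_pathX mX phi (leqnn L)).
have i2 : \int[P N]_w phi (path w) = EE (K N) L [::] phi.
  apply: (@tree_law _ _ _ (P N) (K N) L (childX (@M N)) mX _ _ phi (C + ((h + h) + (C + C)))) => //.
    by move=> k w kL; apply: (childX_bound beta0 (interp N)); exact: leq_trans kL LN.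
  move=> k s x kL sk.
  apply: (childX_law (interp N)) => //; last exact: leq_trans kL LN.
  by move=> j _; apply: lambda2_gt0 => //; exact: (reg_gt1 rg).
have i3 : EE (K N) L [::] phi = EE (K N) L [::] (fun l => f (vpath dir (xi N (lam N)) l))
    + ((h + h) + (C + C) * EE (K N) L [::] (fun l => (~~ good l)%:R)).
  by rewrite EED EED EE_cst EEZ.
have i4 : EE (K N) L [::] (fun l => f (vpath dir (xi N (lam N)) l))
    <= \int[P']_w envgrid c m n (gpath m N w) + h.
  have := @lindeberg_gauss _ _ _ P' B (tauw (lam N)) (Am (lam N)) L BM (tauw0 (lam N)) _
    dir cf0 C f (sf _) (@envgrid_bound c m n) (K N) (xi N (lam N)).
  move=> H; rewrite -lerBlDl; apply: le_trans (ler_norm _) _; apply: le_trans (H _) ger.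
  move=> k kL; rewrite -subr_gt0 tauwS divr_gt0 ?Am_gt0// subr_gt0 -expR0 ltr_expR oppr_lt0.
  by apply: lambda2_gt0 => //; exact: (reg_gt1 rg).
have i5 : (C + C) * EE (K N) L [::] (fun l => (~~ good l)%:R) <= h.
  apply: (@le_trans _ _ ((C + C) * (h / (C + C + 1)))); first by rewrite ler_wpM2l ?addr_ge0.
  rewrite mulrCA ler_piMr ?(ltW h0)// ler_pdivrMr ?mul1r ?lerDl//.
  by rewrite ltr_wpDl// addr_ge0.
have e8 : eps = h + h + h + h + h + h + h + h by rewrite /h; field.
have i6 : \int[P N]_w F (Y N w) <= \int[P']_w envgrid c m n (gpath m N w) + h + (h + h + h).
  apply: le_trans i1 _; rewrite i2 i3; apply: lerD => //.
  by rewrite lerD2l.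
apply: le_trans i6 _.
have := le_trans hN (lerD hn (lexx h)) => q1.
have := le_trans q1 (lerD (lerD hm (lexx h)) (lexx h)) => q2.
have := le_trans q2 (lerD (lerD (lerD hc (lexx h)) (lexx h)) (lexx h)) => q3.
rewrite e8.
apply: le_trans (lerD (lerD q3 (lexx h)) (lexx (h + h + h))) _.
rewrite -!addrA lerD2l.
by rewrite le_eqVlt; apply/orP; left; apply/eqP; ring.
Unshelve. all: by end_near.
Qed.

End OneSided.

Theorem theorem5p4 (R : realType) (k : nat) (beta : nat -> R)
  (dN : nat -> measure_display) (Omega : forall N, measurableType (dN N))
  (P : forall N, probability (Omega N) R)
  (M : forall N, Omega N -> {set 'I_N} -> nat)
  (E : forall N, Omega N -> nat -> nat -> R)
  (d' : measure_display) (Omega' : measurableType d') (P' : probability Omega' R)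
  (B : Omega' -> R -> R) (X : Omega' -> R -> R) (sigma : R) :
  (3 <= k)%N ->
  (forall j, (2 <= j)%N -> 0 <= beta j) ->
  (forall j, (2 <= j <= k.-1)%N -> beta j = 1 / (j%:R * (j%:R - 1))) ->
  1 / (k%:R * (k%:R - 1)) < beta k ->
  cvg (series (betap_terms beta 1) @ \oo) ->
  (forall t, 0 < t < tstar beta -> zfun beta t != 0) ->
  (forall N, poisson_hypergraph (P N) beta (M N)) ->
  (forall N, exp_interpolation (P N) beta (M N) (E N)) ->
  brownian P' B ->
  (forall w t, 0 <= t <= sigma ->
     exists I, is_RS_integral (fun s => expR (betap beta s))
                 (fun s => B w (zfun beta s + s)) 0 t I
               /\ X w t = expR (- betap beta t) * I) ->
  0 < sigma < tstar beta ->
  cvg_dist_D sigma P (fun N w => scaled_walk beta (M N w) (E N w)) P' X.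
Proof.
move=> k3 beta0 betaj _ bcvg znz _ interp BM HX /andP[sigma0 sigmat].
have beta2 : beta 2%N = 1 / 2.
  rewrite betaj; last by rewrite /= -ltnS prednK// (leq_trans _ k3).
  by rewrite (_ : 2%:R - 1 = 1 :> R) ?mulr1//; ring.
have lb : has_lbound [set t | 0 <= t /\ zfun beta t < 0] by exists 0 => t [].
have zlt t : 0 <= t -> t < tstar beta -> 0 <= zfun beta t.
  move=> t0 tt; rewrite leNgt; apply/negP => zt.
  have : tstar beta <= t by apply: (ge_inf lb).
  by rewrite leNgt tt.
(* Indeed z(1) = -exp(-beta'(1)) < 0. *)
have ts1 : tstar beta <= 1.
  apply: (ge_inf lb); split=> //; rewrite /zfun subrr add0r oppr_lt0.
  exact: expR_gt0.
(* Beyond sigma there must be room for the extra step of [horizon]; below [tstar], z stays positive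
   and beta' is Lipschitz. *)
pose sigma' := (sigma + tstar beta) / 2.
have ss' : sigma < sigma' by rewrite /sigma' ltr_pdivlMr//; lra.
have s't : sigma' < tstar beta by rewrite /sigma' ltr_pdivrMr//; lra.
have s'1 : sigma' < 1 by exact: lt_le_trans ts1.
have z0 t : 0 <= t <= sigma' -> 0 <= zfun beta t.
  by move=> /andP[t0 ts]; apply: zlt => //; exact: le_lt_trans s't.
have zpos t : 0 < t <= sigma' -> 0 < zfun beta t.
  move=> /andP[t0 ts]; have tt : t < tstar beta by exact: le_lt_trans s't.
  by rewrite lt_neqAle eq_sym znz ?t0//= zlt// ltW.
have [C1 [c0 [Amax [C10 c00 Amax1 reg]]]] := ex_regular beta0 beta2 bcvg sigma0 ss' s'1.
(* The integral is given separately for each path and time; a choice over pairs assembles it into a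
   process. *)
have ex (p : Omega' * R) : exists i, 0 <= p.2 <= sigma ->
    is_RS_integral (fun s => expR (betap beta s)) (fun s => B p.1 (zfun beta s + s)) 0 p.2 i
    /\ X p.1 p.2 = expR (- betap beta p.2) * i.
  have [/(HX p.1)[i hi]|np] := boolP (0 <= p.2 <= sigma); first by exists i.
  by exists 0.
have [I0 hI0] := choice ex.
pose I w t := I0 (w, t).
have HI w t (ts : 0 <= t <= sigma) := (hI0 (w, t) ts).1.
have XI w t (ts : 0 <= t <= sigma) : X w t = expR (- betap beta t) * I w t.
  exact: (hI0 (w, t) ts).2.
have cY N w := cadlag_Y beta0 beta2 bcvg sigma0 ss' s'1 (@M) (@E) (N := N) w.
have cX w := cadlag_X beta0 beta2 bcvg sigma0 ss' s'1 BM HI XI w.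
move=> F [C FC] Fc mFY mFX.
have up G D : (forall x, cadlag_on sigma x -> `|G x| <= D) -> skorokhod_continuous sigma G ->
    (forall N, measurable_fun setT (fun w => G (scaled_walk beta (M N w) (E N w)))) ->
    measurable_fun setT (fun w => G (X w)) -> forall eps, 0 < eps -> \forall N \near \oo,
    \int[P N]_w G (scaled_walk beta (M N w) (E N w)) <= \int[P']_w G (X w) + eps.
  move=> GD Gc mGY mGX eps eps0.
  exact: (upper_bound beta0 beta2 bcvg sigma0 ss' s'1 z0 zpos C10 c00 Amax1 reg interp BM
    HI XI GD Gc mGX mGY eps0).
have iX : P'.-integrable setT (EFin \o (fun w => F (X w))).
  by apply: (bdd_integrable P' (C := C)) => // w; exact: FC.
have iY N : (0 < N)%N -> (P N).-integrable setT
    (EFin \o (fun w => F (scaled_walk beta (M N w) (E N w)))).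
  by move=> N0; apply: (bdd_integrable (P N) (C := C)) => // w; apply: FC; exact: cY.
have -> : (\int[P']_w (F (X w))%:E = (\int[P']_w F (X w))%R%:E)%E.
  by rewrite /Rintegral fineK//; exact: integrable_fin_num.
apply/fine_cvgP; split.
  near=> N; apply: integrable_fin_num => //; apply: iY.
  by near: N; exact: nbhs_infty_ge.
apply/cvgrPdist_le => e e0.
have upF := up F C FC Fc mFY mFX e e0.
have upN : \forall N \near \oo,
   \int[P N]_w (- F (scaled_walk beta (M N w) (E N w))) <= \int[P']_w (- F (X w)) + e.
  apply: (up (fun x => - F x) C) => //.
  - by move=> x xc; rewrite normrN; exact: FC.
  - move=> x xc eps eps0; have [dl dl0 H] := Fc x xc eps eps0; exists dl => // g gc gx.
    by rewrite -opprD normrN; exact: H.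
  - by move=> N; exact: measurableT_comp.
  - exact: measurableT_comp.
near=> N; rewrite /= -/(Rintegral _ _ _).
have N0 : (0 < N)%N by near: N; exact: nbhs_infty_ge.
have a1 : \int[P N]_w F (scaled_walk beta (M N w) (E N w)) <= \int[P']_w F (X w) + e.
  by near: N; exact: upF.
have a2 : \int[P N]_w (- F (scaled_walk beta (M N w) (E N w))) <= \int[P']_w (- F (X w)) + e.
  by near: N; exact: upN.
have negint (d0 : measure_display) (T : measurableType d0) (Q : probability T R) (g : T -> R) :
    Q.-integrable setT (EFin \o g) -> \int[Q]_w (- g w) = - \int[Q]_w g w.
  move=> ig; rewrite -mulN1r -RintegralZl//.
  by apply: eq_Rintegral => w _; rewrite mulN1r.
rewrite !negint// in a2; last exact: iY.
rewrite ler_norml; apply/andP; split; last by rewrite lerBlDr addrC -lerBlDr; lra.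
by rewrite lerBrDr; lra.
Unshelve. all: by end_near.
Qed.
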